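(* Let $(M,g,\circ,e,\mathcal{E})$ be a semi-simple Frobenius manifold with $\mathcal{L}_{\mathcal{E}}(g)=(2-d)g$, $d\in\mathbb{R}$. Let $(u^1,\dots,u^m)$ be a system of canonical local coordinates of $M$, let $\eta$ be the associated metric potential, and let $\eta_\alpha:=\partial\eta/\partial u^\alpha$. Define a matrix $K$ of functions by $$K:=\mathrm{diag}\Big(\frac{|\eta_1|}{\eta_1},\frac{|\eta_2|}{\eta_2},\dots,\frac{|\eta_m|}{\eta_m}\Big),$$ and let $\kappa:\mathcal{T}_M^{(1,0)}\to\mathcal{T}_M^{(1,0)}$ be the $\mathbb{C}$-anti-linear endomorphism defined by $\kappa\,\partial_{u^\alpha}=K_{\alpha\alpha}\partial_{u^\alpha}$. Then $(M,g,\circ,e,\mathcal{E},\kappa)$ is a CDV$\oplus$-structure on $M$ with $\mathcal{Q}=0$, and the matrix of $h=g(\cdot,\kappa\,\cdot)$ in the frame $(\partial_{u^\alpha})$ is $$h=\mathrm{diag}(|\eta_1|,|\eta_2|,\dots,|\eta_m|).$$ Moreover the connection forms $\omega_\alpha^\beta:=\sum_\gamma\partial h_{\alpha\gamma}\cdot h^{\gamma\beta}$ (where $(h^{\gamma\beta})$ is the inverse matrix of $(h_{\alpha\beta})$) for the Chern connection of $h$ are holomorphic, and the matrix $\omega=(\omega_\alpha^\beta)$ is given by $$\omega=\mathrm{diag}\Big(\frac{\partial\eta_1}{2\eta_1},\frac{\partial\eta_2}{2\eta_2},\dots,\frac{\partial\eta_m}{2\eta_m}\Big).$$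
   Context: Frobenius manifold. $M$ is a complex analytic manifold of dimension $m$, $\Theta_M$ is its sheaf of holomorphic vector fields; $g$ is a holomorphic symmetric non-degenerate bilinear form on $\Theta_M$ with Levi-Civita connection $\nabla$; $\circ$ is a holomorphic commutative associative product on $\Theta_M$ with unit field $e$; $\mathcal{E}$ is a holomorphic vector field (Euler field). These satisfy: $\nabla$ is flat; $g(X\circ Y,Z)=g(X,Y\circ Z)$; $\nabla e=0$; with $c(X,Y,Z):=g(X\circ Y,Z)$ the tensor $(\nabla_Zc)(U,V,W)$ is symmetric in its four arguments; $\nabla(\nabla\mathcal{E})=0$, $\mathcal{L}_{\mathcal{E}}(\circ)=\circ$, and $\mathcal{L}_{\mathcal{E}}(g)=(2-d)g$ for some constant $d$. It is semi-simple if near every point there are holomorphic coordinates $(u^1,\dots,u^m)$, called canonical, with $\partial_{u^\alpha}\circ\partial_{u^\beta}=\delta_{\alpha\beta}\partial_{u^\alpha}$. In canonical coordinates $g(\partial_{u^\alpha},\partial_{u^\beta})=0$ for $\alpha\ne\beta$, and there is locally a holomorphic function $\eta$ (the metric potential) with $g(\partial_{u^\alpha},\partial_{u^\alpha})=\partial\eta/\partial u^\alpha$ for all $\alpha$. $\mathcal{T}_M^{(1,0)}$ is the $C^\infty$ complex vector bundle underlying the holomorphic tangent bundle, with its operator $\overline\partial$; $g$, $\circ$ are extended $C^\infty$-linearly. The Chern connection $D_h=D'+\overline\partial$ of a Hermitian pseudo-metric $h$ is the unique connection with $(0,1)$-part $\overline\partial$ and $D_h(h)=0$. CDV-structure. Given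 a Frobenius manifold and a smooth fiberwise $\mathbb{C}$-anti-linear involution $\kappa$ of $\mathcal{T}_M^{(1,0)}$, put $h:=g(\cdot,\kappa\,\cdot)$, $D:=D_h$ with $(1,0)$-part $D'$ and $(0,1)$-part $D''=\overline\partial$, $C_XY:=-X\circ Y$, $\tilde C:=\kappa C\kappa$ (i.e. $\tilde C_{\overline X}=\kappa C_X\kappa$), $\mathcal{U}:=\mathcal{E}\circ$, $\mathcal{Q}:=D_{\mathcal{E}}-\mathcal{L}_{\mathcal{E}}-\frac{2-d}{2}\mathrm{Id}$. One says $(M,g,\circ,e,\mathcal{E},\kappa)$ is a CDV-structure if $d\in\mathbb{R}$, $D_ee=0$, and $(\mathcal{T}_M^{(1,0)}\to M,D,C,\tilde C,\kappa,h,\mathcal{U},\mathcal{Q})$ is a CV-structure, i.e.: (1) $(C+D'')^2=0$, $(\tilde C+D')^2=0$, $D'(C)=0$, $D''(\tilde C)=0$, $D'D''+D''D'=-(C\tilde C+\tilde CC)$; (2) $\kappa^2=\mathrm{Id}$, $D(\kappa)=0$ (i.e. $D'_X\kappa=\kappa D''_{\overline X}$ and $D''_{\overline X}\kappa=\kappa D'_X$), $\kappa C\kappa=\tilde C$; (3) $h$ is a Hermitian pseudo-metric (linear on the left, semi-linear on the right, non-degenerate, $h(b,a)=\overline{h(a,b)}$), real-valued on $\ker(\kappa-\mathrm{Id})$, with $h(C_Xa,b)=h(a,\tilde C_{\overline X}b)$ and $D(h)=0$; (4) $[C,\mathcal{U}]=0$, $D'(\mathcal{U})-[C,\mathcal{Q}]+C=0$,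 $D''(\mathcal{U})=0$, $D'(\mathcal{Q})+[C,\kappa\mathcal{U}\kappa]=0$, $\kappa\mathcal{Q}\kappa+\mathcal{Q}=0$, $h(\mathcal{U}a,b)=h(a,\kappa\mathcal{U}\kappa b)$, $h(\mathcal{Q}a,b)=h(a,\mathcal{Q}b)$. It is a CDV$\oplus$-structure if in addition $h$ is positive definite. *)

(* Defs.v *)
From HB Require Import structures.
From mathcomp Require Import all_boot all_order all_algebra.
From mathcomp Require Import all_classical all_reals all_analysis.
From mathcomp Require Import complex.

Set Implicit Arguments.
Unset Strict Implicit.
Unset Printing Implicit Defensive.

Import Order.TTheory GRing.Theory Num.Theory.
Import numFieldNormedType.Exports.

Local Open Scope classical_set_scope.
Local Open Scope ring_scope.
Local Open Scope complex_scope.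

(* C^m is encoded as R^m x R^m, the pair (x, y) standing for x + i y; in this
   way it is a normed space over R and real directional derivatives are the
   library's 'D_v. *)
Definition Cspace (R : realType) (m : nat) : normedModType R :=
  ('rV[R]_m * 'rV[R]_m)%type.

Section Calculus.
Variables (R : realType) (m : nat).
Local Notation V := (Cspace R m).
Implicit Types (Omega : set V) (f : V -> R[i]) (z : V).

Definition zcoord z (k : 'I_m) : R[i] := z.1 0 k +i* z.2 0 k.

Fixpoint Ck (n : nat) Omega (f : V -> R) : Prop :=
  match n with
  | 0 => forall z, Omega z -> {for z, continuous f}
  | n'.+1 => (forall z, Omega z -> differentiable f z) /\
             (forall v : V, Ck n' Omega (fun z => 'D_v f z))
  end.

Definition smooth Omega f : Prop :=
  forall n, Ck n Omega (fun z => complex.Re (f z)) /\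
            Ck n Omega (fun z => complex.Im (f z)).

Definition dirderiv (v : V) f z : R[i] :=
  ('D_v (fun w => complex.Re (f w)) z) +i* ('D_v (fun w => complex.Im (f w)) z).

Definition dx (j : 'I_m) : V := (delta_mx 0 j, 0).
Definition dy (j : 'I_m) : V := (0, delta_mx 0 j).

(* The Wirtinger derivatives d/dz_j and d/d\bar z_j. *)
Definition dz (j : 'I_m) f z : R[i] :=
  (dirderiv (dx j) f z - (0 +i* 1) * dirderiv (dy j) f z) / 2.
Definition dzbar (j : 'I_m) f z : R[i] :=
  (dirderiv (dx j) f z + (0 +i* 1) * dirderiv (dy j) f z) / 2.

Definition holomorphic Omega f : Prop :=
  smooth Omega f /\ forall z, Omega z -> forall j, dzbar j f z = 0.

Definition holomorphic_map Omega (F : V -> V) : Prop :=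
  forall k, holomorphic Omega (fun z => zcoord (F z) k).

End Calculus.

(* [cmap] and [cinv] are total functions; only their values on [dom] and on
   [cmap @` dom] are meaningful. *)
Record chart (R : realType) (m : nat) (M : topologicalType) := Chart {
  dom : set M;
  cmap : M -> Cspace R m;
  cinv : Cspace R m -> M;
  open_dom : open dom;
  open_cod : open (cmap @` dom);
  cmapK : forall p, dom p -> cinv (cmap p) = p;
  cmap_continuous : forall p, dom p -> {for p, continuous cmap};
  cinv_continuous : forall z, (cmap @` dom) z -> {for z, continuous cinv}
}.

Definition compatible (R : realType) (m : nat) (M : topologicalType)
    (phi psi : chart R m M) : Prop :=
  holomorphic_map (cmap phi @` (dom phi `&` dom psi)) (cmap psi \o cinv phi) /\
  holomorphic_map (cmap psi @` (dom phi `&` dom psi)) (cmap phi \o cinv psi).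

(* The atlas is maximal, so that its charts are exactly the systems of
   holomorphic local coordinates; in particular restrictions of charts to open
   subsets are again charts of the atlas. *)
Record complex_manifold (R : realType) (m : nat) := ComplexManifold {
  carrier :> topologicalType;
  atlas : set (chart R m carrier);
  manifold_hausdorff : hausdorff_space carrier;
  manifold_second_countable : @second_countable carrier;
  atlas_cover : forall p : carrier, exists2 phi, atlas phi & dom phi p;
  atlas_compatible :
    forall phi psi, atlas phi -> atlas psi -> compatible phi psi;
  atlas_maximal :
    forall phi, (forall psi, atlas psi -> compatible phi psi) -> atlas phi
}.

Arguments atlas {R m} _.

Section Tensors.
Variables (R : realType) (m : nat) (M : complex_manifold R m).
Local Notation C := R[i].
Local Notation chartM := (chart R m M).
Implicit Types (phi psi : chartM) (f : M -> C) (p : M).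

Definition pd phi (j : 'I_m) f : M -> C :=
  fun p => dz j (f \o cinv phi) (cmap phi p).
Definition pdbar phi (j : 'I_m) f : M -> C :=
  fun p => dzbar j (f \o cinv phi) (cmap phi p).

Definition smooth_on phi f : Prop :=
  smooth (cmap phi @` dom phi) (f \o cinv phi).
Definition holomorphic_on phi f : Prop :=
  holomorphic (cmap phi @` dom phi) (f \o cinv phi).

(* Sections of T_M^(1,0) over the domain of a chart are given by their
   components in the coordinate frame: s stands for \sum_j s_j d/dz_j. *)
Definition section := M -> 'rV[C]_m.

Definition smooth_section phi (s : section) : Prop :=
  forall j, smooth_on phi (fun p => s p 0 j).
Definition holomorphic_section phi (s : section) : Prop :=
  forall j, holomorphic_on phi (fun p => s p 0 j).

Definition pd_section phi j (s : section) : section :=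
  fun p => \row_k pd phi j (fun q => s q 0 k) p.
Definition pdbar_section phi j (s : section) : section :=
  fun p => \row_k pdbar phi j (fun q => s q 0 k) p.

Definition pd_mx phi j n1 n2 (A : M -> 'M[C]_(n1, n2)) : M -> 'M[C]_(n1, n2) :=
  fun p => \matrix_(a, b) pd phi j (fun q => A q a b) p.

Definition lie phi (X : section) f : M -> C :=
  fun p => \sum_j X p 0 j * pd phi j f p.

Definition bracket phi (X Y : section) : section :=
  fun p => \row_k (lie phi X (fun q => Y q 0 k) p
                   - lie phi Y (fun q => X q 0 k) p).

(* d/dz_j = \sum_k (jac phi psi p) j k d/dw_k, for the coordinates z of phi and
   w of psi. *)
Definition jac phi psi p : 'M[C]_m :=
  \matrix_(j, k) pd phi j (fun q => zcoord (cmap psi q) k) p.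

Definition on_overlaps (P : chartM -> chartM -> M -> Prop) : Prop :=
  forall phi psi p, atlas M phi -> atlas M psi -> dom phi p -> dom psi p ->
    P phi psi p.

(* A tensor on M is a family, indexed by the charts, of component functions
   obeying the appropriate transformation law. *)

Definition vector_field := chartM -> section.
Definition vector_field_law (X : vector_field) : Prop :=
  on_overlaps (fun phi psi p => X psi p = X phi p *m jac phi psi p).

(* G phi p j k = g(d/dz_j, d/dz_k) *)
Definition bilinear_form := chartM -> M -> 'M[C]_m.
Definition form_eval (G : 'M[C]_m) (x y : 'rV[C]_m) : C :=
  (x *m G *m y^T) 0 0.
Definition bilinear_form_law (G : bilinear_form) : Prop :=
  on_overlaps (fun phi psi p => forall x y : 'rV[C]_m,
    form_eval (G phi p) x y =
    form_eval (G psi p) (x *m jac phi psi p) (y *m jac phi psi p)).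

(* N phi p i j = (d/dz_i) o (d/dz_j) *)
Definition product := chartM -> M -> 'I_m -> 'I_m -> 'rV[C]_m.
Definition product_eval (N : 'I_m -> 'I_m -> 'rV[C]_m) (x y : 'rV[C]_m)
    : 'rV[C]_m :=
  \sum_i \sum_j (x 0 i * y 0 j) *: N i j.
Definition product_law (N : product) : Prop :=
  on_overlaps (fun phi psi p => forall x y : 'rV[C]_m,
    product_eval (N phi p) x y *m jac phi psi p =
    product_eval (N psi p) (x *m jac phi psi p) (y *m jac phi psi p)).

(* K phi p j k is the component of the image of d/dz_j on d/dz_k; the
   endomorphism is extended C-anti-linearly. *)
Definition antilinear_endo := chartM -> M -> 'M[C]_m.
Definition antilinear_eval (K : 'M[C]_m) (x : 'rV[C]_m) : 'rV[C]_m :=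
  map_mx (@conjc R) x *m K.
Definition antilinear_endo_law (K : antilinear_endo) : Prop :=
  on_overlaps (fun phi psi p => forall x : 'rV[C]_m,
    antilinear_eval (K phi p) x *m jac phi psi p =
    antilinear_eval (K psi p) (x *m jac phi psi p)).
Definition smooth_antilinear_endo (K : antilinear_endo) : Prop :=
  antilinear_endo_law K /\
  forall phi, atlas M phi ->
    forall j k, smooth_on phi (fun p => K phi p j k).

(* The (1,0)-part of a connection on T_M^(1,0), by its connection forms:
   nabla_(d/dz_i) (d/dz_j) = \sum_k (Gamma phi p i) j k d/dz_k. *)
Definition connection := chartM -> M -> 'I_m -> 'M[C]_m.
Definition connection_law (Gamma : connection) : Prop :=
  on_overlaps (fun phi psi p => forall i,
    Gamma phi p i *m jac phi psi p =
    pd_mx phi i (jac phi psi) p +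
    jac phi psi p *m (\sum_k jac phi psi p i k *: Gamma psi p k)).

Definition cov phi (Gamma : connection) (i : 'I_m) (s : section) : section :=
  fun p => pd_section phi i s p + s p *m Gamma phi p i.
Definition cov_along phi (Gamma : connection) (X s : section) : section :=
  fun p => \sum_i X p 0 i *: cov phi Gamma i s p.

End Tensors.

Record frobenius_data (R : realType) (m : nat) (M : complex_manifold R m) :=
  FrobeniusData {
    metric : bilinear_form M;
    fproduct : product M;
    unit_field : vector_field M;
    euler : vector_field M;
    conf_dim : R[i];
    nabla : connection M
  }.

Section Frobenius.
Variables (R : realType) (m : nat) (M : complex_manifold R m).
Variable F : frobenius_data M.
Local Notation C := R[i].
Local Notation chartM := (chart R m M).
Implicit Types (phi : chartM) (X Y Z U V W : section M) (p : M).

Definition gprod phi X Y : section M :=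
  fun p => product_eval (fproduct F phi p) (X p) (Y p).
Definition gmetric phi X Y : M -> C :=
  fun p => form_eval (metric F phi p) (X p) (Y p).
Definition gnabla phi X Y : section M := cov_along phi (nabla F) X Y.

Definition ctensor phi X Y Z : M -> C := gmetric phi (gprod phi X Y) Z.

(* (nabla_Z c)(U, V, W) *)
Definition nabla_c phi Z U V W : M -> C := fun p =>
  lie phi Z (ctensor phi U V W) p
  - ctensor phi (gnabla phi Z U) V W p
  - ctensor phi U (gnabla phi Z V) W p
  - ctensor phi U V (gnabla phi Z W) p.

Definition holomorphic_structure : Prop :=
  [/\ bilinear_form_law (metric F), product_law (fproduct F),
      vector_field_law (unit_field F) & vector_field_law (euler F)] /\
  forall phi, atlas M phi ->
    [/\ forall j k, holomorphic_on phi (fun p => metric F phi p j k),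
        forall i j k, holomorphic_on phi (fun p => fproduct F phi p i j 0 k),
        holomorphic_section phi (unit_field F phi) &
        holomorphic_section phi (euler F phi)].

Definition metric_axioms : Prop :=
  forall phi, atlas M phi -> forall p, dom phi p ->
    (metric F phi p)^T = metric F phi p /\ metric F phi p \in unitmx.

Definition product_axioms : Prop :=
  forall phi, atlas M phi -> forall p, dom phi p ->
    let mul := product_eval (fproduct F phi p) in
    [/\ commutative mul, associative mul & left_id (unit_field F phi p) mul].

(* nabla is the Levi-Civita connection of g: the torsion-free holomorphic
   connection compatible with g. *)
Definition levi_civita : Prop :=
  connection_law (nabla F) /\
  forall phi, atlas M phi ->
  [/\ forall i j k, holomorphic_on phi (fun p => nabla F phi p i j k),
      forall X Y, holomorphic_section phi X -> holomorphic_section phi Y ->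
        forall p, dom phi p ->
        gnabla phi X Y p - gnabla phi Y X p = bracket phi X Y p &
      forall X Y Z, holomorphic_section phi X -> holomorphic_section phi Y ->
        holomorphic_section phi Z -> forall p, dom phi p ->
        lie phi X (gmetric phi Y Z) p =
        gmetric phi (gnabla phi X Y) Z p + gmetric phi Y (gnabla phi X Z) p].

Definition nabla_flat : Prop :=
  forall phi, atlas M phi ->
  forall X Y Z, holomorphic_section phi X -> holomorphic_section phi Y ->
    holomorphic_section phi Z -> forall p, dom phi p ->
    gnabla phi X (gnabla phi Y Z) p - gnabla phi Y (gnabla phi X Z) p
    - gnabla phi (bracket phi X Y) Z p = 0.

Definition metric_invariant : Prop :=
  forall phi, atlas M phi -> forall p, dom phi p -> forall x y z : 'rV[C]_m,
    form_eval (metric F phi p) (product_eval (fproduct F phi p) x y) z =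
    form_eval (metric F phi p) x (product_eval (fproduct F phi p) y z).

Definition unit_flat : Prop :=
  forall phi, atlas M phi -> forall X, holomorphic_section phi X ->
    forall p, dom phi p -> gnabla phi X (unit_field F phi) p = 0.

(* Invariance under the three adjacent transpositions, which generate S_4. *)
Definition potentiality : Prop :=
  forall phi, atlas M phi ->
  forall Z U V W, holomorphic_section phi Z -> holomorphic_section phi U ->
    holomorphic_section phi V -> holomorphic_section phi W ->
    forall p, dom phi p ->
    [/\ nabla_c phi Z U V W p = nabla_c phi U Z V W p,
        nabla_c phi Z U V W p = nabla_c phi Z V U W p &
        nabla_c phi Z U V W p = nabla_c phi Z U W V p].

(* The second covariant derivative of E:
   (nabla_X (nabla E))(Y) = nabla_X (nabla_Y E) - nabla_(nabla_X Y) E. *)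
Definition euler_affine : Prop :=
  forall phi, atlas M phi ->
  forall X Y, holomorphic_section phi X -> holomorphic_section phi Y ->
    forall p, dom phi p ->
    let E := euler F phi in
    gnabla phi X (gnabla phi Y E) p - gnabla phi (gnabla phi X Y) E p = 0.

Definition euler_product : Prop :=
  forall phi, atlas M phi ->
  forall X Y, holomorphic_section phi X -> holomorphic_section phi Y ->
    forall p, dom phi p ->
    let LE := bracket phi (euler F phi) in
    LE (gprod phi X Y) p - gprod phi (LE X) Y p - gprod phi X (LE Y) p =
    gprod phi X Y p.

Definition euler_metric : Prop :=
  forall phi, atlas M phi ->
  forall X Y, holomorphic_section phi X -> holomorphic_section phi Y ->
    forall p, dom phi p ->
    let E := euler F phi in let LE := bracket phi E in
    lie phi E (gmetric phi X Y) p - gmetric phi (LE X) Y p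
    - gmetric phi X (LE Y) p = (2 - conf_dim F) * gmetric phi X Y p.

Definition is_frobenius_manifold : Prop :=
  [/\ [/\ holomorphic_structure, metric_axioms & product_axioms],
      [/\ levi_civita, nabla_flat, metric_invariant, unit_flat & potentiality] &
      [/\ euler_affine, euler_product & euler_metric]].

Definition canonical_coordinates phi : Prop :=
  atlas M phi /\
  forall p, dom phi p -> forall a b : 'I_m,
    product_eval (fproduct F phi p) (delta_mx 0 a) (delta_mx 0 b) =
    (a == b)%:R *: delta_mx 0 a.

Definition semisimple : Prop :=
  forall p, exists2 phi, canonical_coordinates phi & dom phi p.

Definition metric_potential phi (eta : M -> C) : Prop :=
  holomorphic_on phi eta /\
  forall p, dom phi p -> forall a : 'I_m,
    form_eval (metric F phi p) (delta_mx 0 a) (delta_mx 0 a) = pd phi a eta p.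

End Frobenius.

Section CV.
Variables (R : realType) (m : nat) (M : complex_manifold R m).
Local Notation C := R[i].
Local Notation chartM := (chart R m M).
Implicit Types (phi : chartM) (p : M).

(* Operators on local sections of T_M^(1,0), and operator-valued 1-forms
   \sum_i A (inl i) dz_i + \sum_i A (inr i) d\bar z_i. *)
Definition op := section M -> section M.
Definition opform := 'I_m + 'I_m -> op.

Definition zeroop : op := fun s p => 0.
Definition addop (A B : op) : op := fun s p => A s p + B s p.
Definition oppop (A : op) : op := fun s p => - A s p.
Definition compop (A B : op) : op := fun s => A (B s).

Definition zeroform : opform := fun=> zeroop.
Definition addform (A B : opform) : opform := fun a => addop (A a) (B a).

(* A and B act on sections with values in forms as operators of degree 1, and
   [wedge A B a b] is the coefficient of dx_a /\ dx_b in their composite. *)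
Definition wedge (A B : opform) (a b : 'I_m + 'I_m) : op :=
  addop (compop (A a) (B b)) (oppop (compop (A b) (B a))).

Definition commform (A : opform) (T : op) : opform :=
  fun a => addop (compop (A a) T) (oppop (compop T (A a))).

Definition opeq (phi : chartM) (A B : op) : Prop :=
  forall s, smooth_section phi s -> forall p, dom phi p -> A s p = B s p.
Definition formeq phi (A B : opform) : Prop := forall a, opeq phi (A a) (B a).
Definition form2eq phi (A B : 'I_m + 'I_m -> 'I_m + 'I_m -> op) : Prop :=
  forall a b, opeq phi (A a b) (B a b).

Definition fibermap := M -> 'rV[C]_m -> 'rV[C]_m.
Definition fiberop (k : fibermap) : op := fun s p => k p (s p).
Definition fiberform := M -> 'rV[C]_m -> 'rV[C]_m -> C.
Definition hsec (h : fiberform) (s t : section M) : M -> C :=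
  fun p => h p (s p) (t p).

(* D(h) = 0, for D = D' + D'' with D1, D2 standing for D', D''. *)
Definition metric_connection phi (h : fiberform) (D1 D2 : opform) : Prop :=
  forall s t, smooth_section phi s -> smooth_section phi t ->
  forall p, dom phi p -> forall i : 'I_m,
    pd phi i (hsec h s t) p =
      hsec h (D1 (inl i) s) t p + hsec h s (D2 (inr i) t) p /\
    pdbar phi i (hsec h s t) p =
      hsec h (D2 (inr i) s) t p + hsec h s (D1 (inl i) t) p.

Definition pseudo_hermitian phi (h : fiberform) : Prop :=
  forall p, dom phi p ->
  [/\ forall (c : C) x x' y, h p (c *: x + x') y = c * h p x y + h p x' y,
      forall (c : C) x y y', h p x (c *: y + y') = conjc c * h p x y + h p x y',
      forall x, (forall y, h p x y = 0) -> x = 0 &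
      forall x y, h p y x = conjc (h p x y)].

(* The conditions defining a CV-structure, over the domain of a chart; D1, D2,
   Ct are D', D'' and \tilde C. *)
Definition CV1 phi (D1 D2 Cc Ct : opform) : Prop :=
  [/\ form2eq phi (wedge (addform Cc D2) (addform Cc D2)) (fun _ _ => zeroop),
      form2eq phi (wedge (addform Ct D1) (addform Ct D1)) (fun _ _ => zeroop),
      form2eq phi (fun a b => addop (wedge D1 Cc a b) (wedge Cc D1 a b))
                  (fun _ _ => zeroop),
      form2eq phi (fun a b => addop (wedge D2 Ct a b) (wedge Ct D2 a b))
                  (fun _ _ => zeroop) &
      form2eq phi (fun a b => addop (wedge D1 D2 a b) (wedge D2 D1 a b))
        (fun a b => oppop (addop (wedge Cc Ct a b) (wedge Ct Cc a b)))].

Definition CV2 phi (D1 D2 Cc Ct : opform) (kappa : fibermap) : Prop :=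
  let k := fiberop kappa in
  [/\ forall p, dom phi p -> forall x, kappa p (kappa p x) = x,
      forall i, opeq phi (compop (D1 (inl i)) k) (compop k (D2 (inr i))),
      forall i, opeq phi (compop (D2 (inr i)) k) (compop k (D1 (inl i))) &
      forall i, opeq phi (compop k (compop (Cc (inl i)) k)) (Ct (inr i))].

Definition CV3 phi (D1 D2 Cc Ct : opform) (kappa : fibermap) (h : fiberform)
    : Prop :=
  [/\ pseudo_hermitian phi h,
      forall p, dom phi p -> forall x y, kappa p x = x -> kappa p y = y ->
        h p x y \is Num.real,
      forall i s t, smooth_section phi s -> smooth_section phi t ->
        forall p, dom phi p ->
        hsec h (Cc (inl i) s) t p = hsec h s (Ct (inr i) t) p &
      metric_connection phi h D1 D2].

Definition CV4 phi (D1 D2 Cc : opform) (kappa : fibermap) (h : fiberform)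
    (U Q : op) : Prop :=
  let k := fiberop kappa in
  let kUk := compop k (compop U k) in
  let neg (A : opform) : opform := fun a => oppop (A a) in
  [/\ formeq phi (commform Cc U) zeroform,
      formeq phi (addform (addform (commform D1 U) (neg (commform Cc Q))) Cc)
                 zeroform,
      formeq phi (commform D2 U) zeroform,
      formeq phi (addform (commform D1 Q) (commform Cc kUk)) zeroform &
  [/\ opeq phi (addop (compop k (compop Q k)) Q) zeroop,
      forall s t, smooth_section phi s -> smooth_section phi t ->
        forall p, dom phi p -> hsec h (U s) t p = hsec h s (kUk t) p &
      forall s t, smooth_section phi s -> smooth_section phi t ->
        forall p, dom phi p -> hsec h (Q s) t p = hsec h s (Q t) p]].

Definition is_CV_structure phi (D1 D2 Cc Ct : opform) (kappa : fibermap)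
    (h : fiberform) (U Q : op) : Prop :=
  [/\ CV1 phi D1 D2 Cc Ct, CV2 phi D1 D2 Cc Ct kappa,
      CV3 phi D1 D2 Cc Ct kappa h & CV4 phi D1 D2 Cc kappa h U Q].

End CV.

Section CDV.
Variables (R : realType) (m : nat) (M : complex_manifold R m).
Variables (F : frobenius_data M) (K : antilinear_endo M).
Local Notation C := R[i].
Local Notation chartM := (chart R m M).
Implicit Types (phi : chartM) (Gamma : connection M).

Definition kappa_map phi : fibermap M := fun p => antilinear_eval (K phi p).

Definition hform phi : fiberform M := fun p x y =>
  form_eval (metric F phi p) x (kappa_map phi p y).

Definition Dprime phi Gamma : opform M := fun a =>
  if a is inl i then cov phi Gamma i else @zeroop _ _ M.
Definition Ddoubleprime phi : opform M := fun a =>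
  if a is inr i then pdbar_section phi i else @zeroop _ _ M.

Definition Cform phi : opform M := fun a =>
  if a is inl i then
    fun s p => - product_eval (fproduct F phi p) (delta_mx 0 i) (s p)
  else @zeroop _ _ M.
Definition Ctilde phi : opform M := fun a =>
  if a is inr i then
    let k := fiberop (kappa_map phi) in
    compop k (compop (Cform phi (inl i)) k)
  else @zeroop _ _ M.

Definition Uop phi : op M := fun s => gprod F phi (euler F phi) s.
Definition Qop phi Gamma : op M := fun s p =>
  cov_along phi Gamma (euler F phi) s p - bracket phi (euler F phi) s p
  - ((2 - conf_dim F) / 2) *: s p.

(* Gamma is the (1,0)-part of the Chern connection of h = g(., kappa .); its
   (0,1)-part is dbar, and the condition D(h) = 0 determines Gamma. *)
Definition is_chern_connection Gamma : Prop :=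
  connection_law Gamma /\
  forall phi, atlas M phi ->
    (forall i j k, smooth_on phi (fun p => Gamma phi p i j k)) /\
    metric_connection phi (hform phi) (Dprime phi Gamma) (Ddoubleprime phi).

Definition is_CDV_structure Gamma : Prop :=
  [/\ is_frobenius_manifold F, smooth_antilinear_endo K,
      is_chern_connection Gamma, conf_dim F \is Num.real &
      forall phi, atlas M phi ->
        (forall p, dom phi p ->
           cov_along phi Gamma (unit_field F phi) (unit_field F phi) p = 0) /\
        is_CV_structure phi (Dprime phi Gamma) (Ddoubleprime phi)
          (Cform phi) (Ctilde phi) (kappa_map phi) (hform phi)
          (Uop phi) (Qop phi Gamma)].

Definition is_CDVplus_structure Gamma : Prop :=
  is_CDV_structure Gamma /\
  forall phi, atlas M phi -> forall p, dom phi p ->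
    forall x : 'rV[C]_m, x != 0 -> 0 < hform phi p x x.

(* kappa (d/du_a) = (|eta_a| / eta_a) d/du_a in all canonical coordinates u
   with metric potential eta. *)
Definition canonical_kappa : Prop :=
  antilinear_endo_law K /\
  forall phi eta, canonical_coordinates F phi -> metric_potential F phi eta ->
    forall p, dom phi p ->
    K phi p = diag_mx (\row_a (`|pd phi a eta p| / pd phi a eta p)).

Definition hmatrix phi p : 'M[C]_m :=
  \matrix_(a, b) hform phi p (delta_mx 0 a) (delta_mx 0 b).

(* The coefficient of dz_i in (omega_a^b) = (\sum_c dh_(a c) h^(c b)). *)
Definition omega phi (i : 'I_m) p : 'M[C]_m :=
  pd_mx phi i (hmatrix phi) p *m invmx (hmatrix phi p).

End CDV.

(* Main.v *)
Require Import Defs.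
From HB Require Import structures.
From mathcomp Require Import all_boot all_order all_algebra.
From mathcomp Require Import all_classical all_reals all_analysis.
From mathcomp Require Import complex.
From mathcomp Require Import ring lra.

Set Implicit Arguments.
Unset Strict Implicit.
Unset Printing Implicit Defensive.

Import Order.TTheory GRing.Theory Num.Theory.
Import numFieldNormedType.Exports.

Local Open Scope classical_set_scope.
Local Open Scope ring_scope.
Local Open Scope complex_scope.

(** Near every point there are canonical coordinates with a metric potential
    ([local_potential]), and in the frame of these coordinates everything is
    diagonal: the product is componentwise, the metric is the diagonal matrix of
    the eta_a, kappa sends the components f_a to k_a * conj f_a with
    k_a = |eta_a| / eta_a, and h is the diagonal matrix of the |eta_a|.  Put
    l_a = d eta_a / (2 eta_a).  Since eta_a is holomorphic, differentiating
    |eta_a|^2 = eta_a * conj eta_a gives d' |eta_a| = l_a |eta_a|, so the Chern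
    connection is f_a |-> d f_a + l_a f_a, with holomorphic closed connection
    forms; and d' k_a = - l_a k_a, d'' k_a = conj l_a * k_a express that kappa
    is parallel.

    The axioms have to be checked in every chart of the atlas.  If P is the
    Jacobian matrix from a chart z to canonical coordinates u, the components of
    a section s in the canonical frame are those of s P, and all the operators
    of a CV-structure act on each of these components separately, as
    dl * d_a + c with dl constant: D' has coefficients l_a, C has - du^a, its
    conjugate has - conj du^a, and U has the component eps_a of the Euler field.
    The commutator of two such operators only involves derivatives of their
    coefficients ([rep_comm]).  Thus the curvature equations say that the forms
    du^a and l_a are closed and holomorphic, and the equation for U says that
    d eps_a = du^a, a consequence of L_E(o) = o.  Finally L_E(g) = (2 - d) g
    becomes E(eta_a) = - d eta_a, whence Q f_a =
    (E f_a - d/2 f_a) - (E f_a - f_a) - (2 - d)/2 f_a = 0, and nabla e = 0 gives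
    e(eta_a) = 0, hence D_e e = 0.

    Two existence results carry the rest.  A metric potential exists locally
    because \sum_a g_aa du^a is closed ([diag_metric_closed]) and closed
    holomorphic forms on a ball have primitives ([complex_poincare]).  The
    involution kappa exists globally because two canonical frames agree up to
    the order of their vectors ([canonical_overlap]): these are the primitive
    idempotents of the product. *)

(** * Symmetry of second derivatives *)

Section RealCalculus.
Variables (R : realType) (V : normedModType R).
Implicit Types (f g : V -> R) (z u v : V) (O : set V).

Lemma differentiable_eps f z (e : R) : differentiable f z -> 0 < e ->
  \forall h \near (0 : V), `|f (h + z) - f z - 'd f z h| <= e * `|h|.
Proof.
move=> /diff_locally /eqaddoP H e0; have := H e e0.
by apply: filterS => h; rewrite !fctE /= opprD addrA.
Qed.

(** A continuous linear map is determined by its values up to o(h), so an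
    estimate of the increment identifies the differential; this form can be
    checked without constructing a remainder function. *)
Lemma is_diff_eps f z (L : {linear V -> R}) : continuous L ->
  (forall e, 0 < e ->
     \forall h \near (0 : V), `|f (h + z) - f z - L h| <= e * `|h|) ->
  is_diff z f L.
Proof.
move=> Lc H.
have fE : f \o shift z = cst (f z) + L +o_ (0 : V) id.
  apply/eqaddoP => e e0; apply: filterS (H e e0) => h.
  by rewrite !fctE /= opprD addrA.
have dE : 'd f z = L :> (V -> R) by apply: diff_unique.
by split => //; apply/diff_locallyP; rewrite dE.
Qed.

Lemma near_differentiable f g z : (\near z, f z = g z) ->
  differentiable f z -> differentiable g z.
Proof.
move=> fg df; suff: is_diff z g ('d f z) by move=> [].
apply: is_diff_eps; first exact: diff_continuous.
move=> e e0; have := differentiable_eps df e0.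
have fg0 : \forall h \near (0 : V), f (h + z) = g (h + z).
  by move: fg; rewrite (near_shift 0) /=; apply: filterS => h /=; rewrite subr0.
apply: filterS2 fg0 => h <-; rewrite (nbhs_singleton fg) //.
Qed.

Lemma is_derive_line f z v (s : R) : differentiable f (z + s *: v) ->
  is_derive s 1 (fun t : R => f (z + t *: v)) ('D_v f (z + s *: v)).
Proof.
move=> df.
have dl : is_diff s (fun t : R => z + t *: v) ( *:%R^~ v).
  have -> : *:%R^~ v = 0 + *:%R^~ v :> (R -> V) by rewrite add0r.
  exact: is_diffD.
have dc : is_diff s (f \o (fun t : R => z + t *: v)) ('d f (z + s *: v) \o *:%R^~ v).
  by apply: is_diff_comp; exact: differentiableP.
split; first by apply/derivable1_diffP; case: dc.
rewrite deriveE; last by case: dc.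
by rewrite diff_val /= scale1r deriveE.
Qed.

Lemma mean_value f z v : (forall t : R, 0 <= t <= 1 -> differentiable f (z + t *: v)) ->
  exists2 t : R, 0 <= t <= 1 & f (z + v) - f z = 'D_v f (z + t *: v).
Proof.
move=> df.
have [||t t01] := @MVT_segment R (fun t => f (z + t *: v)) (fun t =>
  'D_v f (z + t *: v)) 0 1 ler01.
- move=> t; rewrite in_itv /= => /andP[t0 t1]; apply: is_derive_line.
  by apply: df; rewrite !ltW.
- apply: derivable_within_continuous => t; rewrite in_itv /= => t01.
  by have [] := is_derive_line (df _ t01).
rewrite scale1r scale0r addr0 subr0 mulr1 => E.
by exists t => //; move: t01; rewrite in_itv.
Qed.

Lemma near0_scale2 z u v O : nbhs z O ->
  \forall s \near (0 : R), forall a b : R, 0 <= a <= 1 -> 0 <= b <= 1 ->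
     O (z + (a * s) *: u + (b * s) *: v).
Proof.
move=> /nbhs_ballP [e /= e0 He].
have N : 0 < `|u| + `|v| + 1 by rewrite ltr_wpDl // addr_ge0.
near=> s => a b /andP[a0 a1] /andP[b0 b1]; apply: He.
rewrite -ball_normE /ball_ /= -addrA opprD addNKr normrN.
have : `|s| < e / (`|u| + `|v| + 1).
  near: s; apply/nbhs_normP; exists (e / (`|u| + `|v| + 1)); first by rewrite /= divr_gt0.
  by move=> x /=; rewrite sub0r normrN.
rewrite ltr_pdivlMr // => H; apply: le_lt_trans H.
apply: le_trans (ler_normD _ _) _; rewrite !normrZ (ger0_norm a0) (ger0_norm b0).
have Hu : a * `|s| * `|u| <= `|s| * `|u| by rewrite ler_wpM2r // ler_piMl.
have Hv : b * `|s| * `|v| <= `|s| * `|v| by rewrite ler_wpM2r // ler_piMl.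
have := normr_ge0 s; nra.
Unshelve. all: by end_near. Qed.

(** The mean value theorem applied to w |-> f (w + s v) - f w on a segment
    parallel to u turns the second difference into s times an increment of 'D_u f, which
    the differential of 'D_u f at z approximates. *)
Lemma second_difference f z u v (e : R) : 0 < e ->
  (\forall w \near z, differentiable f w) -> differentiable ('D_u f) z ->
  \forall s \near (0 : R),
    `|f (z + s *: u + s *: v) - f (z + s *: u) - f (z + s *: v) + f z
      - s ^+ 2 * 'D_v ('D_u f) z| <= e * s ^+ 2.
Proof.
move=> e0 df ddf.
set N := `|u| + `|v| + 1.
have N0 : 0 < N by rewrite ltr_wpDl // addr_ge0.
have eN : 0 < e / (2 * N) by rewrite divr_gt0 // mulr_gt0.
have := differentiable_eps ddf eN => /(nbhs_ballP _ _) [r /= r0 Hr].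
have Hs : \forall s \near (0:R), `|s| * N < r.
  near=> s; rewrite -ltr_pdivlMr //; near: s.
  apply/nbhs_normP; exists (r / N); first by rewrite /= divr_gt0.
  by move=> x /=; rewrite sub0r normrN.
have Hd := near0_scale2 u v df.
near=> s.
have ds : forall a b : R, 0 <= a <= 1 -> 0 <= b <= 1 ->
     differentiable f (z + (a * s) *: u + (b * s) *: v) by near: s.
have rs : `|s| * N < r by near: s.
(* the increment of f in the direction v, as a function of the base point *)
set G := fun w => f (w + s *: v) - f w.
have dG w : differentiable f w -> differentiable f (w + s *: v) ->
   is_diff w G (('d f (w + s *: v) : V -> R) - ('d f w : V -> R)).
  move=> d1 d2.
  have := @differentiableP _ _ _ _ _ d1; have := @differentiableP _ _ _ _ _ d2 => h2 h1.
  have hs : is_diff w (fun w => w + s *: v) id.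
    by have -> : id = id + 0 :> (V -> V); [rewrite addr0|exact: is_diffD].
  have hc := @is_diff_comp _ _ _ _ (fun w => w + s *: v) id f _ w hs h2.
  exact: is_diffB.
have h01 : forall t : R, 0 <= t <= 1 -> differentiable f (z + t *: (s *: u)) /\
     differentiable f (z + t *: (s *: u) + s *: v).
  move=> t t01; split; last first.
    by have := ds t 1 t01; rewrite lexx ler01 mul1r scalerA; apply.
  by have := ds t 0 t01; rewrite lexx ler01 mul0r scale0r addr0 scalerA; apply.
have [t t01|t t01 E] := @mean_value G z (s *: u).
  have [h1 h2] := h01 t t01.
  by have [] := dG _ h1 h2.
have [h1 h2] := h01 t t01; move: E.
rewrite deriveE; last by have [] := dG _ h1 h2.
have lz w : 'd f w (s *: u) = s * 'd f w u by rewrite linearZ.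
rewrite (@diff_val _ _ _ _ _ _ _ (dG _ h1 h2)) !fctE /= !lz -mulrBr -!deriveE //.
rewrite /G => E.
have Hin (a : R) : 0 <= a <= 1 -> `|t *: (s *: u) + a *: (s *: v)| <= `|s| * N.
  move=> /andP[a0 a1]; move: t01 => /andP[t0 t1].
  apply: le_trans (ler_normD _ _) _; rewrite !normrZ (ger0_norm a0) (ger0_norm t0).
  have Hu : t * (`|s| * `|u|) <= `|s| * `|u| by rewrite ler_piMl // mulr_ge0.
  have Hv : a * (`|s| * `|v|) <= `|s| * `|v| by rewrite ler_piMl // mulr_ge0.
  rewrite /N; have := normr_ge0 s; lra.
have Hd2 (a : R) : 0 <= a <= 1 ->
   `|'D_u f (t *: (s *: u) + a *: (s *: v) + z) - 'D_u f z - 'd ('D_u f) z (t *: (s *: u) + a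
     *: (s *: v))|
     <= e / 2 * `|s|.
  move=> a01; have := Hin a a01 => Hn.
  apply: le_trans (Hr _ _) _.
    by rewrite -ball_normE /ball_ /= sub0r normrN; apply: le_lt_trans rs.
  have -> : e / 2 * `|s| = e / (2 * N) * (`|s| * N).
    by field; rewrite gt_eqF.
  by rewrite ler_wpM2l // ltW.
have := Hd2 0; rewrite lexx ler01 !scale0r !addr0 => /(_ isT) H0.
have := Hd2 1; rewrite lexx ler01 !scale1r => /(_ isT) H1.
have -> : f (z + s *: u + s *: v) - f (z + s *: u) - f (z + s *: v) + f z
      - s ^+ 2 * 'D_v ('D_u f) z =
   s * (('D_u f (t *: (s *: u) + s *: v + z) - 'D_u f z - 'd ('D_u f) z (t *: (s *: u) + s *:
     v))
    - ('D_u f (t *: (s *: u) + z) - 'D_u f z - 'd ('D_u f) z (t *: (s *: u)))).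
  have lz2 : 'd ('D_u f) z (s *: v) = s * 'd ('D_u f) z v by rewrite linearZ.
  rewrite deriveE // linearD /= lz2.
  rewrite [_ + s *: v + z]addrC addrA [_ + z]addrC.
  have -> : f (z + s *: u + s *: v) - f (z + s *: u) - f (z + s *: v) + f z =
    f (z + s *: u + s *: v) - f (z + s *: u) - (f (z + s *: v) - f z) by ring.
  rewrite E /=; ring.
rewrite normrM -[s ^+ 2]real_normK ?num_real // expr2 mulrCA ler_wpM2l //.
apply: le_trans (ler_normB _ _) _.
by rewrite [e]splitr mulrDl lerD.
Unshelve. all: by end_near. Qed.

Lemma common_approx (A B C D X Y e q : R) : 0 < q ->
  `|A - B - C + D - q * X| <= e / 2 * q -> `|A - C - B + D - q * Y| <= e / 2 * q ->
  `|X - Y| <= e.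
Proof.
move=> q0; have -> : A - C - B + D = A - B - C + D by ring.
rewrite distrC => K1 K2; rewrite -(ler_pM2r q0) -{1}(gtr0_norm q0) -normrM mulrBl ![_ * q]mulrC.
apply: le_trans (ler_distD _ _ _) _; apply: le_trans (lerD K1 K2) _.
by rewrite -mulrDl -splitr mulrC.
Qed.

(** The second difference is symmetric in u and v, and it is s^2 times either
    of the mixed derivatives up to o(s^2). *)
Theorem schwarz f z u v :
  (\forall w \near z, differentiable f w) ->
  differentiable ('D_u f) z -> differentiable ('D_v f) z ->
  'D_v ('D_u f) z = 'D_u ('D_v f) z.
Proof.
move=> df du dv; apply/eqP; rewrite -subr_eq0 -normr_le0; apply/ler_addgt0Pr => /= e e0.
rewrite add0r.
have e2 : 0 < e / 2 by rewrite divr_gt0.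
have H1 : \forall s \near (0 : R)^', _ := nbhs_dnbhs (second_difference v e2 df du).
have H2 : \forall s \near (0 : R)^', _ := nbhs_dnbhs (second_difference u e2 df dv).
have : \forall s \near (0 : R)^', `|'D_v ('D_u f) z - 'D_u ('D_v f) z| <= e.
  have H3 : \forall s \near (0 : R)^', s != 0 := nbhs_dnbhs_neq (0 : R).
  apply: filterS3 H1 H2 H3 => s K1 K2 s0.
  have s2 : 0 < s ^+ 2 by rewrite exprn_even_gt0.
  rewrite [z + s *: v + s *: u]addrAC in K2.
  exact: common_approx s2 K1 K2.
by move/filter_ex => [].
Qed.

End RealCalculus.

(** * Smooth functions *)

Section CkTheory.
Variables (R : realType) (m : nat).
Local Notation V := (Cspace R m).
Implicit Types (O : set V) (f g : V -> R) (z v : V).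

Lemma Ck_eq n O f g : open O -> (forall z, O z -> f z = g z) ->
  Ck n O f -> Ck n O g.
Proof.
move=> oO; elim: n f g => [|n IH] f g fg /=.
  move=> cf z Oz; have nfg : \forall w \near z, f w = g w.
    by apply: filterS (open_nbhs_nbhs (conj oO Oz)) => w; exact: fg.
  rewrite /prop_for /continuous_at -fg //; apply: cvg_trans (cf z Oz).
  exact: near_eq_cvg.
move=> [df Df]; have nfg z : O z -> \forall w \near z, f w = g w.
  by move=> Oz; apply: filterS (open_nbhs_nbhs (conj oO Oz)) => w; exact: fg.
split=> [z Oz|v]; first exact: near_differentiable (nfg z Oz) (df z Oz).
by apply: IH (Df v) => z Oz; apply: near_eq_derive; exact: nfg.
Qed.

Lemma Ck_sub n O (O' : set V) f : O' `<=` O -> Ck n O f -> Ck n O' f.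
Proof.
move=> sO; elim: n f => [|n IH] f /=; first by move=> H z /sO; exact: H.
by move=> [df Df]; split=> [z /sO|v]; [exact: df|exact: IH].
Qed.

Lemma Ck_local n O f : (forall z, O z -> exists2 U : set V, U z & Ck n U f) ->
  Ck n O f.
Proof.
elim: n f => [|n IH] f H /=; first by move=> z /H [U Uz]; exact.
split=> [z /H [U Uz] [] df _|v]; first exact: df.
by apply: IH => z /H [U Uz [_ Df]]; exists U => //; exact: Df.
Qed.

Lemma CkS n O f : Ck n.+1 O f -> Ck n O f.
Proof.
elim: n f => [|n IH] f [df Df].
  by move=> z Oz; exact/differentiable_continuous/df.
by split=> // v; apply: IH; exact: Df.
Qed.

Lemma Ck_cst n O (a : R) : Ck n O (fun=> a).
Proof.
elim: n a => [|n IH] a /=; first by move=> z _; exact: cvg_cst.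
split=> [z _|v]; first exact: differentiable_cst.
have -> : 'D_v (fun=> a) = (fun=> 0) :> (V -> R).
  by apply/funext => z; rewrite (derive_cst a).
exact: IH.
Qed.

Lemma CkD n O f g : open O -> Ck n O f -> Ck n O g -> Ck n O (fun z => f z + g z).
Proof.
move=> oO; elim: n f g => [|n IH] f g.
  by move=> cf cg z Oz; apply: continuousD; [exact: cf|exact: cg].
move=> [df Df] [dg Dg]; split=> [z Oz|v].
  by apply: differentiableD; [exact: df|exact: dg].
apply: Ck_eq (IH _ _ (Df v) (Dg v)) => // z Oz; apply/esym.
by apply: deriveD; apply: diff_derivable; [exact: df|exact: dg].
Qed.

Lemma derive_mul f g z v : differentiable f z -> differentiable g z ->
  'D_v (fun w => f w * g w) z = 'D_v f z * g z + f z * 'D_v g z.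
Proof.
move=> df dg; have /= -> := @deriveM _ _ f g z v (diff_derivable df) (diff_derivable dg).
by rewrite addrC [g z *: _]mulrC.
Qed.

Lemma CkM n O f g : open O -> Ck n O f -> Ck n O g -> Ck n O (fun z => f z * g z).
Proof.
move=> oO; elim: n f g => [|n IH] f g.
  by move=> cf cg z Oz; apply: continuousM; [exact: cf|exact: cg].
move=> Cf Cg; have [df Df] := Cf; have [dg Dg] := Cg; split=> [z Oz|v].
  by apply: differentiableM; [exact: df|exact: dg].
apply: Ck_eq (CkD oO (IH _ _ (CkS Cf) (Dg v)) (IH _ _ (CkS Cg) (Df v))) => // z Oz.
apply/esym; by apply: deriveM; apply: diff_derivable; [exact: df|exact: dg].
Qed.

Lemma CkN n O f : open O -> Ck n O f -> Ck n O (fun z => - f z).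
Proof.
move=> oO Cf; apply: Ck_eq (CkM oO (Ck_cst n O (-1)) Cf) => // z _.
by rewrite mulN1r.
Qed.

Lemma CkV n O f : open O -> (forall z, O z -> f z != 0) ->
  Ck n O f -> Ck n O (fun z => (f z)^-1).
Proof.
move=> oO f0; elim: n => [|n IH].
  by move=> cf z Oz; apply: continuousV; [exact: f0|exact: cf].
move=> Cf; have [df Df] := Cf; have IV := IH (CkS Cf); split=> [z Oz|v].
  by apply: differentiableV; [exact: df|exact: f0].
apply: Ck_eq (CkN oO (CkM oO (CkM oO IV IV) (Df v))) => // z Oz.
apply/esym; rewrite deriveV; [|exact: f0|by apply: diff_derivable; exact: df].
by rewrite /GRing.scale /= mulNr expr2 invfM.
Qed.

Lemma Ck_sqrt n O f : open O -> (forall z, O z -> 0 < f z) ->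
  Ck n O f -> Ck n O (fun z => Num.sqrt (f z)).
Proof.
move=> oO f0; elim: n => [|n IH].
  move=> cf z Oz; apply: (@continuous_comp _ _ _ f Num.sqrt); first exact: cf.
  exact: sqrt_continuous.
move=> Cf; have [df Df] := Cf; have IV := IH (CkS Cf).
have dS z : O z -> is_diff z (Num.sqrt \o f) ((fun h : R =>
  h *: (2 * Num.sqrt (f z))^-1) \o 'd f z).
  move=> Oz; have [ds Es] := is_derive1_sqrt (f0 z Oz).
  apply: is_diff_comp; first exact/differentiableP/df.
  have d1 : differentiable Num.sqrt (f z) by exact/derivable1_diffP.
  by split=> //; rewrite diff1E // derive1E Es.
split=> [z Oz|v]; first by have [] := dS z Oz.
have C2 : Ck n O (fun z => (2 * Num.sqrt (f z))^-1).
  apply: CkV => // [z Oz|]; last exact: CkM (Ck_cst _ _ _) IV.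
  by rewrite mulf_neq0 // gt_eqF // sqrtr_gt0 f0.
apply: Ck_eq (CkM oO (Df v) C2) => // z Oz.
rewrite [RHS]deriveE; last by have [] := dS z Oz.
by rewrite (@diff_val _ _ _ _ _ _ _ (dS z Oz)) /= deriveE //; exact: df.
Qed.

End CkTheory.

Section ComplexCalculus.
Variables (R : realType) (m : nat).
Local Notation V := (Cspace R m).
Local Notation C := R[i].
Implicit Types (O : set V) (f g : V -> C) (z v : V).

Definition cdiff f z : Prop :=
  differentiable (fun w => complex.Re (f w)) z /\
  differentiable (fun w => complex.Im (f w)) z.

Lemma cReD (x y : C) : complex.Re (x + y) = complex.Re x + complex.Re y.
Proof. by case: x; case: y. Qed.
Lemma cImD (x y : C) : complex.Im (x + y) = complex.Im x + complex.Im y.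
Proof. by case: x; case: y. Qed.
Lemma cReM (x y : C) : complex.Re (x * y) =
  complex.Re x * complex.Re y - complex.Im x * complex.Im y.
Proof. by case: x; case: y. Qed.
Lemma cImM (x y : C) : complex.Im (x * y) =
  complex.Re x * complex.Im y + complex.Im x * complex.Re y.
Proof. by case: x; case: y. Qed.
Lemma cReJ (x : C) : complex.Re (conjc x) = complex.Re x.
Proof. by case: x. Qed.
Lemma cImJ (x : C) : complex.Im (conjc x) = - complex.Im x.
Proof. by case: x. Qed.
Lemma complex_eq (x y : C) : complex.Re x = complex.Re y ->
  complex.Im x = complex.Im y -> x = y.
Proof. by case: x; case: y => ? ? ? ? /= -> ->. Qed.

Lemma cdiff_cst (a : C) z : cdiff (fun=> a) z.
Proof. by split; exact: differentiable_cst. Qed.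

Lemma cdiffD f g z : cdiff f z -> cdiff g z -> cdiff (fun w => f w + g w) z.
Proof.
move=> [f1 f2] [g1 g2]; split.
- by under eq_fun do rewrite cReD; exact: differentiableD.
- by under eq_fun do rewrite cImD; exact: differentiableD.
Qed.

Lemma cdiffM f g z : cdiff f z -> cdiff g z -> cdiff (fun w => f w * g w) z.
Proof.
move=> [f1 f2] [g1 g2]; split.
- by under eq_fun do rewrite cReM; apply: differentiableB; exact: differentiableM.
- by under eq_fun do rewrite cImM; apply: differentiableD; exact: differentiableM.
Qed.

Lemma dirderiv_cst v (a : C) z : dirderiv v (fun=> a) z = 0.
Proof. by rewrite /dirderiv (derive_cst (complex.Re a)) (derive_cst (complex.Im a)). Qed.

Lemma dirderiv_near v f g z : (\near z, f z = g z) -> dirderiv v f z = dirderiv v g z.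
Proof.
move=> fg; rewrite /dirderiv; congr (_ +i* _); apply: near_eq_derive;
  by apply: filterS fg => w ->.
Qed.

Lemma dirderivD v f g z : cdiff f z -> cdiff g z ->
  dirderiv v (fun w => f w + g w) z = dirderiv v f z + dirderiv v g z.
Proof.
move=> [f1 f2] [g1 g2]; apply: complex_eq; rewrite ?cReD ?cImD /=.
- under eq_fun do rewrite cReD.
  by apply: deriveD; exact: diff_derivable.
- under eq_fun do rewrite cImD.
  by apply: deriveD; exact: diff_derivable.
Qed.

Lemma dirderivM v f g z : cdiff f z -> cdiff g z ->
  dirderiv v (fun w => f w * g w) z = dirderiv v f z * g z + f z * dirderiv v g z.
Proof.
move=> [f1 f2] [g1 g2]; apply: complex_eq; rewrite ?cReD ?cImD ?cReM ?cImM /=.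
- under eq_fun do rewrite cReM.
  rewrite (@deriveB _ _ _ (fun w => complex.Re (f w) * complex.Re (g w))
    (fun w => complex.Im (f w) * complex.Im (g w))); last 2 first.
  - by apply: derivableM; exact: diff_derivable.
  - by apply: derivableM; exact: diff_derivable.
  rewrite (derive_mul v f1 g1).
  rewrite (derive_mul v f2 g2).
  ring.
- under eq_fun do rewrite cImM.
  rewrite (@deriveD _ _ _ (fun w => complex.Re (f w) * complex.Im (g w))
    (fun w => complex.Im (f w) * complex.Re (g w))); last 2 first.
  - by apply: derivableM; exact: diff_derivable.
  - by apply: derivableM; exact: diff_derivable.
  rewrite (derive_mul v f1 g2).
  rewrite (derive_mul v f2 g1).
  ring.
Qed.

Lemma dirderivJ v f z : cdiff f z ->
  dirderiv v (fun w => conjc (f w)) z = conjc (dirderiv v f z).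
Proof.
move=> [f1 f2]; apply: complex_eq; rewrite ?cReJ ?cImJ /=.
- by under eq_fun do rewrite cReJ.
- under eq_fun do rewrite cImJ.
  by apply: deriveN; exact: diff_derivable.
Qed.

Lemma dirderiv_schwarz u v f z : (\forall w \near z, cdiff f w) ->
  cdiff (dirderiv u f) z -> cdiff (dirderiv v f) z ->
  dirderiv v (dirderiv u f) z = dirderiv u (dirderiv v f) z.
Proof.
move=> df [u1 u2] [v1 v2]; apply: complex_eq => /=.
- by apply: schwarz => //; apply: filterS df => w [].
- by apply: schwarz => //; apply: filterS df => w [].
Qed.

Lemma smooth_eq O f g : open O -> (forall z, O z -> f z = g z) -> smooth O f -> smooth O g.
Proof.
move=> oO fg sf n; have [f1 f2] := sf n.
by split; [apply: Ck_eq f1|apply: Ck_eq f2] => // z /fg ->.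
Qed.

Lemma smooth_sub O (O' : set V) f : O' `<=` O -> smooth O f -> smooth O' f.
Proof. by move=> sO sf n; have [? ?] := sf n; split; exact: Ck_sub sO _. Qed.

Lemma smooth_local O f : (forall z, O z -> exists2 U : set V, U z & smooth U f) ->
  smooth O f.
Proof.
by move=> H n; split; apply: Ck_local => z /H [U Uz sf]; exists U => //; have [] := sf n.
Qed.

Lemma smooth_cdiff O f z : smooth O f -> O z -> cdiff f z.
Proof. by move=> sf Oz; have [[d1 _] [d2 _]] := sf 1%N; split; [exact: d1|exact: d2]. Qed.

Lemma smooth_cst O (a : C) : smooth O (fun=> a).
Proof. by move=> n; split; exact: Ck_cst. Qed.

Lemma smoothD O f g : open O -> smooth O f -> smooth O g -> smooth O (fun z => f z + g z).
Proof.
move=> oO sf sg n; have [f1 f2] := sf n; have [g1 g2] := sg n; split.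
- by under eq_fun do rewrite cReD; exact: CkD.
- by under eq_fun do rewrite cImD; exact: CkD.
Qed.

Lemma smoothM O f g : open O -> smooth O f -> smooth O g -> smooth O (fun z => f z * g z).
Proof.
move=> oO sf sg n; have [f1 f2] := sf n; have [g1 g2] := sg n; split.
- under eq_fun do rewrite cReM.
  apply: CkD => //; first exact: CkM.
  by apply: CkN => //; exact: CkM.
- by under eq_fun do rewrite cImM; apply: CkD => //; exact: CkM.
Qed.

Lemma smoothJ O f : open O -> smooth O f -> smooth O (fun z => conjc (f z)).
Proof.
move=> oO sf n; have [f1 f2] := sf n; split.
- by under eq_fun do rewrite cReJ.
- by under eq_fun do rewrite cImJ; exact: CkN.
Qed.

Lemma sqr_norm_gt0 (x : C) : x != 0 -> 0 < complex.Re x ^+ 2 + complex.Im x ^+ 2.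
Proof.
case: x => a b; rewrite eq_complex /= negb_and => H.
rewrite lt_neqAle addr_ge0 ?sqr_ge0 // andbT eq_sym paddr_eq0 ?sqr_ge0 //.
by rewrite !sqrf_eq0 negb_and.
Qed.

Lemma smooth_sqr_norm O f n : open O -> smooth O f ->
  Ck n O (fun z => complex.Re (f z) ^+ 2 + complex.Im (f z) ^+ 2).
Proof.
by move=> oO sf; have [f1 f2] := sf n; apply: CkD => //; exact: CkM.
Qed.

(** 1/f is conj f divided by the positive real function |f|^2. *)
Lemma smoothV O f : open O -> (forall z, O z -> f z != 0) -> smooth O f ->
  smooth O (fun z => (f z)^-1).
Proof.
move=> oO f0 sf n; have [f1 f2] := sf n.
have C2 : Ck n O (fun z => (complex.Re (f z) ^+ 2 + complex.Im (f z) ^+ 2)^-1).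
  apply: CkV => // [z Oz|]; last exact: smooth_sqr_norm.
  by rewrite gt_eqF // sqr_norm_gt0 // f0.
split.
- by apply: Ck_eq (CkM oO f1 C2) => // z _; case: (f z).
- apply: Ck_eq (CkN oO (CkM oO f2 C2)) => // z _; by case: (f z).
Qed.

(** The square root is smooth away from 0, which is why f must not vanish. *)
Lemma smooth_norm O f : open O -> (forall z, O z -> f z != 0) -> smooth O f ->
  smooth O (fun z => `|f z|).
Proof.
move=> oO f0 sf n; split; last first.
  by apply: Ck_eq (Ck_cst n O 0) => // z _; rewrite normc_def.
apply: Ck_eq (Ck_sqrt oO _ (smooth_sqr_norm n oO sf)) => // z Oz.
- by rewrite normc_def.
- by rewrite sqr_norm_gt0 // f0.
Qed.

Lemma smooth_dirderiv O f v : smooth O f -> smooth O (dirderiv v f).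
Proof. by move=> sf n; have [[_ f1] [_ f2]] := sf n.+1; split; [exact: f1|exact: f2]. Qed.

End ComplexCalculus.

(** * The Poincare lemma on a ball *)

Section BigSums.
Variables (R : realType) (V : normedModType R) (I : Type).

Lemma is_derive_bigsum (r : seq I) (h : I -> V -> R) (dh : I -> R) x v :
  (forall a, is_derive x v (h a) (dh a)) ->
  is_derive x v (fun y => \sum_(a <- r) h a y) (\sum_(a <- r) dh a).
Proof.
move=> dhP; elim: r => [|a r IH].
  rewrite big_nil; under eq_fun do rewrite big_nil.
  exact: is_derive_cst.
rewrite big_cons; under eq_fun do rewrite big_cons.
exact: is_deriveD.
Qed.

End BigSums.

Lemma continuous_bigsum (R : realType) (I : Type) (T : topologicalType) (r : seq I)
    (h : I -> T -> R) x :
  (forall a, {for x, continuous (h a)}) ->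
  {for x, continuous (fun y => \sum_(a <- r) h a y)}.
Proof.
move=> ch; elim: r => [|a r IH].
  have -> : (fun y => \sum_(a <- [::]) h a y) = cst 0.
    by apply/funext => y; rewrite big_nil.
  exact: cvg_cst.
have -> : (fun y => \sum_(a <- a :: r) h a y) = (fun y => h a y + \sum_(a <- r) h a y).
  by apply/funext => y; rewrite big_cons.
exact: continuousD.
Qed.

Section Poincare.
Variables (R : realType) (V : normedModType R) (I : finType).
Variable c : I -> {linear V -> R}.
Hypothesis c_le : forall a h, `|c a h| <= `|h|.
Variables (z0 : V) (r : R) (b : I -> V -> R).
Hypothesis db : forall a z, `|z - z0| < r -> differentiable (b a) z.
Hypothesis cdb : forall a v z, `|z - z0| < r -> {for z, continuous ('D_v (b a))}.
Hypothesis closed_form : forall u v z, `|z - z0| < r ->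
  \sum_a c a v * 'D_u (b a) z = \sum_a c a u * 'D_v (b a) z.

Let form z h := \sum_a c a h * b a z.

Let seg_ball (x : V) (t : R) : `|x| < r -> 0 <= t <= 1 -> `|z0 + t *: x - z0| < r.
Proof.
move=> xr /andP[t0 t1]; rewrite addrAC subrr add0r normrZ ger0_norm //.
by apply: le_lt_trans xr; rewrite ler_piMl.
Qed.

Let c_cont a : continuous (c a).
Proof.
by apply: bounded_linear_continuous; apply/bounded_funP => M; exists M => x; exact: le_trans.
Qed.

Let bc a z : `|z - z0| < r -> {for z, continuous (b a)}.
Proof. by move=> h; apply/differentiable_continuous/db. Qed.

Let comp_cont (T : topologicalType) (gam : T -> V) x (g : V -> R) :
  {for x, continuous gam} -> {for gam x, continuous g} ->
  {for x, continuous (fun y => g (gam y))}.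
Proof. exact: continuous_comp. Qed.

(* the integrand of the primitive at z + s v, and its derivative in s *)
Let f (z v : V) (s t : R) := form (z0 + t *: (s *: v + z - z0)) (s *: v + z - z0).
Let df (z v : V) (s t : R) :=
  \sum_a (c a (s *: v + z - z0) * (t * 'D_v (b a) (z0 + t *: (s *: v + z - z0)))
   + c a v * b a (z0 + t *: (s *: v + z - z0))).

Let is_derive_f (z v : V) (s t : R) : `|s *: v + z - z0| < r -> 0 <= t <= 1 ->
  is_derive s 1 (f z v ^~ t) (df z v s t).
Proof.
move=> sr t01; apply: is_derive_bigsum => a.
have d1 : is_derive s 1 (fun s0 : R => c a (s0 *: v + z - z0)) (c a v).
  have -> : (fun s0 : R => c a (s0 *: v + z - z0)) =
            (fun s0 : R => s0 * c a v) + cst (c a (z - z0)).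
    by apply/funext => s0; rewrite !fctE /= -addrA linearD linearZ.
  have : is_derive s 1 ((fun s0 : R => s0 * c a v) + cst (c a (z - z0))) (1 *: c a v + 0).
    apply: is_deriveD.
    have -> : (fun s0 : R => s0 * c a v) = id * cst (c a v) by [].
    by apply: is_derive_eq; rewrite scaler0 add0r /GRing.scale /= mulr1 mul1r.
  by rewrite scale1r addr0.
have d2 : is_derive s 1 (fun s0 : R => b a (z0 + t *: (s0 *: v + z - z0)))
   (t * 'D_v (b a) (z0 + t *: (s *: v + z - z0))).
  have E s0 : z0 + t *: (s0 *: v + z - z0) = (z0 + t *: (z - z0)) + s0 *: (t *: v).
    by rewrite -[s0 *: v + z - z0]addrA scalerDr !scalerA [s0 * t]mulrC addrA [_ + t *: (z -
      z0)]addrC addrA [_ + z0]addrC.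
  under eq_fun do rewrite E.
  have dd : differentiable (b a) (z0 + t *: (s *: v + z - z0)).
    by apply: db; apply: seg_ball.
  have := @is_derive_line R V (b a) (z0 + t *: (z - z0)) (t *: v) s.
  rewrite -E => /(_ dd); rewrite !deriveE //.
  have -> : 'd (b a) (z0 + t *: (s *: v + z - z0)) (t *: v) =
    t * 'd (b a) (z0 + t *: (s *: v + z - z0)) v.
    by rewrite linearZ.
  by [].
have := is_deriveM d1 d2; congr (is_derive _ _ _ _).
by congr (_ + _); exact: mulrC.
Qed.

Let mu := @lebesgue_measure R.

Let seg_cont (g : V -> R) (x : V) : `|x| < r ->
  (forall z, `|z - z0| < r -> {for z, continuous g}) ->
  {within `[0, 1], continuous (fun t : R => g (z0 + t *: x))}.
Proof.
move=> xr gc; apply: continuous_in_subspaceT => t; rewrite inE /= in_itv /= => t01.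
apply: continuous_comp; last by apply: gc; apply: seg_ball.
by apply: continuousD; [exact: cvg_cst|apply: continuousZ; [exact: cvg_id|exact: cvg_cst]].
Qed.

(* domination for differentiating under the integral, by compactness of a
   rectangle of parameters *)
Let df_bound z v (d : R) : 0 < d -> (forall s : R, `|s| <= d -> `|s *: v + z - z0| < r) ->
  exists M : R, forall s t : R, `|s| <= d -> 0 <= t <= 1 -> `|df z v s t| <= M.
Proof.
move=> d0 dr; pose A : set (R * R) := `[-d, d] `*` `[0, 1].
have cA : compact A by apply: compact_setX; exact: segment_compact.
have A0 : A !=set0 by exists (0, 0); split => /=;
  rewrite in_itv /= ?lexx ?ler01 // oppr_le0 ltW.
have [|[s0 t0] _ H] := @compact_EVT_max _ R (fun p : R * R => `|df z v p.1 p.2|) A A0 cA.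
  apply: continuous_in_subspaceT => -[s t]; rewrite inE /A /= !in_itv /= => -[sd t01].
  have sr : `|s *: v + z - z0| < r by apply: dr; rewrite ler_norml.
  have c1 : {for (s, t), continuous (fun p : R * R => p.1 *: v + z - z0)}.
    apply: continuousD; last exact: cvg_cst.
    apply: continuousD; last exact: cvg_cst.
    by apply: continuousZ; [exact: cvg_fst|exact: cvg_cst].
  have c2 : {for (s, t), continuous (fun p : R * R => z0 + p.2 *: (p.1 *: v + z - z0))}.
    apply: continuousD; first exact: cvg_cst.
    by apply: continuousZ; [exact: cvg_snd|exact: c1].
  have B2 := seg_ball sr t01.
  apply: cvg_norm.
  rewrite /form; apply: continuous_bigsum => a; apply: continuousD.
    apply: continuousM; first by apply: (comp_cont (g := c a) c1); exact: c_cont.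
    apply: continuousM; first exact: cvg_snd.
    by apply: (comp_cont (g := 'D_v (b a)) c2); exact: cdb.
  apply: continuousM; first exact: cvg_cst.
  by apply: (comp_cont (g := b a) c2); exact: bc.
exists `|df z v s0 t0| => s t sd t01; apply: (H (s, t)).
by rewrite inE /A /=; split; rewrite in_itv /= // -ler_norml.
Qed.

Let eta z := (\int[mu]_(t in `[0%R, 1%R]) form (z0 + t *: (z - z0)) (z - z0))%R.

Let form_cont x : `|x| < r -> {within `[0, 1], continuous (fun t : R => form (z0 + t *: x) x)}.
Proof.
move=> xr; apply: (@seg_cont (fun z => form z x)) => // z zr.
rewrite /form; apply: continuous_bigsum => a; apply: continuousM; first exact: cvg_cst.
exact: bc.
Qed.

(* the integrand is the t-derivative of t * form (z0 + t (z - z0)) v: here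
   closedness is used *)
Let int_form z v : `|z - z0| < r ->
  (\int[mu]_(t in `[0%R, 1%R]) df z v 0 t)%R = form z v.
Proof.
move=> zr; pose F (t : R) := t * form (z0 + t *: (z - z0)) v.
have dF (t : R) : 0 <= t <= 1 -> is_derive t 1 F (df z v 0 t).
  move=> t01; have B := seg_ball zr t01.
  have d1 : is_derive t 1 (fun t : R => form (z0 + t *: (z - z0)) v)
     (\sum_a c a v * 'D_(z - z0) (b a) (z0 + t *: (z - z0))).
    apply: is_derive_bigsum => a.
    have := is_deriveM (is_derive_cst (c a v) t 1) (is_derive_line (db a B)).
    by rewrite scaler0 addr0.
  have := is_deriveM (is_derive_id t 1) d1; congr (is_derive _ _ _ _).
  rewrite closed_form // /df scale0r add0r big_split /= /GRing.scale /= mulr1 mulr_sumr.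
  by congr (_ + _); apply: eq_bigr => a _; rewrite mulrCA.
have dfc : {within `[0, 1], continuous (df z v 0)}.
  have -> : df z v 0 = (fun t => \sum_a (c a (z - z0) * (t * 'D_v (b a) (z0 + t *: (z - z0)))
   + c a v * b a (z0 + t *: (z - z0)))) by rewrite /df scale0r add0r.
  apply: continuous_in_subspaceT => t; rewrite inE /= in_itv /= => t01.
  have B := seg_ball zr t01.
  have c2 : {for t, continuous (fun p : R => z0 + p *: (z - z0))}.
    by apply: continuousD; [exact: cvg_cst|apply: continuousZ; [exact: cvg_id|exact: cvg_cst]].
  rewrite /form; apply: continuous_bigsum => a; apply: continuousD.
    apply: continuousM; first exact: cvg_cst.
    apply: continuousM; first exact: cvg_id.
    by apply: (comp_cont (g := 'D_v (b a)) c2); exact: cdb.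
  apply: continuousM; first exact: cvg_cst.
  by apply: (comp_cont (g := b a) c2); exact: bc.
have Fc (t : R) : 0 <= t <= 1 -> {for t, continuous F}.
  by move=> t01; apply/differentiable_continuous/derivable1_diffP; have [] := dF t t01.
have h0 : 0 <= (0 : R) <= 1 by rewrite lexx ler01.
have h1 : 0 <= (1 : R) <= 1 by rewrite ler01 lexx.
rewrite /Rintegral (@continuous_FTC2 _ _ F) //=; last first.
- move=> t; rewrite in_itv /= => /andP[t0 t1].
  have t01 : 0 <= t <= 1 by rewrite !ltW.
  by rewrite derive1E; have [_ ->] := dF t t01.
- split.
  + move=> t; rewrite in_itv /= => /andP[t0 t1].
    have t01 : 0 <= t <= 1 by rewrite !ltW.
    by have [] := dF t t01.
  + by apply: cvg_at_right_filter; exact: Fc.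
  + by apply: cvg_at_left_filter; exact: Fc.
by rewrite /F mul0r subr0 mul1r scale1r addrC subrK.
Qed.

Let is_derive_eta z v : `|z - z0| < r -> is_derive z v eta (form z v).
Proof.
move=> zr; set w := `|z - z0| in zr *.
pose d := (r - w) / (2 * (`|v| + 1)).
have v1 : 0 < `|v| + 1 by rewrite ltr_wpDl.
have d0 : 0 < d by rewrite divr_gt0 ?subr_gt0 // mulr_gt0.
have dr (s : R) : `|s| <= d -> `|s *: v + z - z0| < r.
  move=> sd; rewrite -addrA; apply: le_lt_trans (ler_normD _ _) _; rewrite -/w -ltrBrDr normrZ.
  have h : d * (`|v| + 1) = (r - w) / 2 by rewrite /d; field; rewrite gt_eqF.
  apply: le_lt_trans (_ : (r - w) / 2 < _).
    by rewrite -h; apply: ler_pM => //; rewrite lerDl.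
  by rewrite ltr_pdivrMr // ltr_pMr ?subr_gt0 // ltr1n.
have [M HM] := df_bound d0 dr.
have I0 : `](-d), d[%classic (0 : R) by rewrite /= in_itv /= oppr_lt0 d0.
have sI (s : R) : `](-d), d[%classic s -> `|s| <= d.
  by rewrite /= in_itv /= => /andP[h1 h2]; rewrite ler_norml !ltW.
have E0 : 0 *: v + z - z0 = z - z0 by rewrite scale0r add0r.
have Ed (s t : R) : `](-d), d[%classic s -> `[0, 1]%classic t ->
  ((f z v ^~ t)^`())%classic s = df z v s t.
  move=> /sI Is; rewrite /= in_itv /= => t01; rewrite derive1E.
  by have [_ ->] := is_derive_f (dr s Is) t01.
have H : h^-1 *: ((eta \o shift z) (h *: v) - eta z) @[h --> 0^'] --> form z v.
  rewrite -int_form //.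
  have -> : (\int[mu]_(t in `[0%R, 1%R]) df z v 0 t)%R =
            (\int[mu]_(t in `[0%R, 1%R]) partial1of2 (f z v) 0 t)%R.
    by apply: eq_Rintegral => t t01; rewrite /partial1of2 Ed // -inE.
  have -> : (fun h : R => h^-1 *: ((eta \o shift z) (h *: v) - eta z)) =
    (fun h => h^-1 *: ((\int[mu]_(y in `[0%R, 1%R]) f z v (h + 0) y)%R - (\int[mu]_(y in
      `[0%R, 1%R]) f z v 0 y)%R)).
    apply/funext => h; rewrite addr0 /eta /f; congr (_ *: (_ - _)).
    by rewrite E0.
  apply: (@cvg_differentiation_under_integral R _ _ mu (f z v) `[0%R, 1%R]%classic
    (measurable_itv _) 0 (- d) d I0 _ _ (cst `|M|)).
  - move=> s /sI Is; apply: continuous_compact_integrable; first exact: segment_compact.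
    by apply: form_cont; apply: dr.
  - move=> s t /sI Is; rewrite /= in_itv /= => t01.
    by have [] := is_derive_f (dr s Is) t01.
  - by move=> t.
  - apply: continuous_compact_integrable; first exact: segment_compact.
    by move=> x; apply: cvg_cst.
  - move=> s t Is It; rewrite /partial1of2 Ed //; move: It; rewrite /= in_itv /= => t01.
    by apply: le_trans (ler_norm _); apply: HM => //; exact: sI.
split; first by apply/cvg_ex; exists (form z v).
exact/cvg_lim.
Qed.

(** The primitive is the integral of the form over the segment from z0 to z.
    Its derivative in a direction v is, by closedness, the integral over [0, 1]
    of d/dt [t * form (z0 + t (z - z0)) v], hence the value of the form at z on
    v. The form is a combination of constant covectors c a with coefficients
    b a; their norm is bounded by 1 so that they are continuous. *)
Theorem poincare : exists eta : V -> R, forall z, `|z - z0| < r ->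
  differentiable eta z /\ forall v, 'D_v eta z = \sum_a c a v * b a z.
Proof.
exists eta => z zr; suff H : differentiable eta z.
  by split=> // v; have [_ ->] := is_derive_eta v zr.
have lin_form : linear (form z).
  move=> k x y; rewrite /form /GRing.scale /= mulr_sumr -big_split /=.
  by apply: eq_bigr => a _; rewrite linearD linearZ /= mulrDl mulrA.
have [L LE] : exists L : {linear V -> R}, L = form z :> (V -> R).
  pose Lm := GRing.isLinear.Build _ _ _ _ (form z) lin_form.
  by pose L : {linear V -> R} := HB.pack (form z) Lm; exists L.
(* By the mean value theorem, an increment of eta is the form at an
   intermediate point, which is close to the form at z. *)
suff : is_diff z eta L by case.
apply: is_diff_eps; rewrite LE.
  move=> x; rewrite /form; apply: continuous_bigsum => a; apply: continuousM;
    last exact: cvg_cst.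
  exact: c_cont.
move=> e e0; have n0 : 0 < #|I|.+1%:R :> R by rewrite ltr0n.
have e1 : 0 < e / #|I|.+1%:R by rewrite divr_gt0.
have Hb : \forall w \near z, forall a, `|b a w - b a z| <= e / #|I|.+1%:R.
  have H1 a : \forall w \near z, `|b a w - b a z| <= e / #|I|.+1%:R.
    have := @bc a z zr; move=> /cvgrPdist_le /(_ _ e1); apply: filterS => w.
    by rewrite distrC.
  by apply: filter_forall.
have Hr : \forall w \near z, `|w - z0| < r.
  apply/nbhs_normP; exists (r - `|z - z0|); first by rewrite /= subr_gt0.
  move=> w /=; rewrite ltrBrDr => h; apply: le_lt_trans h.
  by apply: le_trans (ler_distD z _ _) _; rewrite [`|w - z|]distrC.
have /nbhs_normP [d /= d0 Hd] : \forall w \near z, (forall a, `|b a w - b a z| <= e /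
  #|I|.+1%:R) /\ `|w - z0| < r.
  by apply: filterS2 Hb Hr => w.
apply/nbhs_normP; exists d => // h; rewrite /ball_ /= sub0r normrN => hd.
have Hs (t : R) : 0 <= t <= 1 ->
  (forall a, `|b a (z + t *: h) - b a z| <= e / #|I|.+1%:R) /\ `|z + t *: h - z0| < r.
  move=> /andP[t0 t1]; apply: Hd; rewrite /= opprD addNKr normrN normrZ ger0_norm //.
  by apply: le_lt_trans hd; rewrite ler_piMl.
have dl (t : R) : 0 <= t <= 1 -> is_derive t 1 (fun t : R =>
  eta (z + t *: h)) (form (z + t *: h) h).
  move=> t01; have [dd <-] := is_derive_eta h (Hs t t01).2.
  have Ef : (fun k : R => k^-1 *: (((fun t0 : R =>
    eta (z + t0 *: h)) \o shift t) (k *: 1) - eta (z + t *: h)))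
    = (fun k => k^-1 *: ((eta \o shift (z + t *: h)) (k *: h) - eta (z + t *: h))).
    by apply/funext => k /=; rewrite [k *: 1]mulr1 scalerDl addrCA.
  by split; [rewrite /derivable Ef|rewrite /derive Ef].
have [||t] := @MVT_segment R (fun t : R => eta (z + t *: h)) (fun t : R =>
  form (z + t *: h) h) 0 1 ler01.
- by move=> t; rewrite in_itv /= => /andP[t0 t1]; apply: dl; rewrite !ltW.
- apply: derivable_within_continuous => t; rewrite in_itv /= => t01.
  by have [] := dl _ t01.
rewrite in_itv /= => t01; rewrite scale1r scale0r addr0 subr0 mulr1 [z + h]addrC => ->.
rewrite /form -sumrB.
apply: le_trans (ler_norm_sum _ _ _) _.
apply: le_trans (_ : \sum_(a : I) (e / #|I|.+1%:R * `|h|) <= _).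
  apply: ler_sum => a _; rewrite -mulrBr normrM mulrC; apply: ler_pM => //.
  exact: (Hs t t01).1.
rewrite sumr_const -mulrnAl ler_wpM2r // -mulr_natr mulrAC ler_pdivrMr // ler_wpM2l ?ltW //.
by rewrite ltr_nat.
Qed.

End Poincare.

(** * Wirtinger derivatives *)

Section WirtingerAlgebra.
Variable K : numFieldType.
Implicit Types (a b c d f g h i p q s t : K).

Lemma wirt_add h s a b c d :
  (a + b + s * (c + d)) * h = (a + s * c) * h + (b + s * d) * h.
Proof. ring. Qed.

Lemma wirt_mul h s a b c d f g :
  (a * g + f * b + s * (c * g + f * d)) * h = (a + s * c) * h * g + f * ((b + s * d) * h).
Proof. ring. Qed.

Lemma wirt_comm h s t a b c d :
  ((a + t * b) * h + s * ((c + t * d) * h)) * h = ((a + s * c) * h + t * ((b + s * d) * h)) * h.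
Proof. ring. Qed.

Lemma wirt_sum i a b : (b - i * a) / 2 + (b + i * a) / 2 = b.
Proof. by field. Qed.

Lemma wirt_dif i a b : i * i = -1 -> i * ((b - i * a) / 2 - (b + i * a) / 2) = a.
Proof.
move=> ii; transitivity (- (i * i) * a); first by field.
by rewrite ii opprK mul1r.
Qed.

Lemma wirt_split i a b p q :
  a * (p + q) + b * (i * (p - q)) = (a + i * b) * p + (a - i * b) * q.
Proof. ring. Qed.

Lemma wirt_comp i a b c p q :
  (a * p + (i * b) * q - i * (c * p + b * q)) / 2 = (a - i * c) / 2 * p.
Proof. ring. Qed.

End WirtingerAlgebra.

Section Wirtinger.
Variables (R : realType) (m : nat).
Local Notation V := (Cspace R m).
Local Notation C := R[i].
Implicit Types (O : set V) (f g : V -> C) (z v : V) (a b : 'I_m + 'I_m).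

(** The index set 'I_m + 'I_m is that of the differentials dz_i and
    d\bar z_i, so that both kinds of derivatives are treated at once. *)
Definition dw a f z : C := match a with inl j => dz j f z | inr j => dzbar j f z end.

Definition dw_bar a : 'I_m + 'I_m := match a with inl j => inr j | inr j => inl j end.

Let idx a : 'I_m := match a with inl j => j | inr j => j end.
Let sgi a : C := match a with inl _ => - (0 +i* 1) | inr _ => 0 +i* 1 end.

Lemma dwE a f z :
  dw a f z = (dirderiv (dx R (idx a)) f z + sgi a * dirderiv (dy R (idx a)) f z) / 2.
Proof. by case: a => j; rewrite /dw /dz /dzbar /= ?mulNr. Qed.

Lemma dw_cst a (c : C) z : dw a (fun=> c) z = 0.
Proof. by rewrite dwE !dirderiv_cst mulr0 addr0 mul0r. Qed.

Lemma dw_near a f g z : (\near z, f z = g z) -> dw a f z = dw a g z.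
Proof. by move=> fg; rewrite !dwE !(dirderiv_near _ fg). Qed.

Lemma dwD a f g z : cdiff f z -> cdiff g z ->
  dw a (fun w => f w + g w) z = dw a f z + dw a g z.
Proof. by move=> df dg; rewrite !dwE !dirderivD // wirt_add. Qed.

Lemma dwM a f g z : cdiff f z -> cdiff g z ->
  dw a (fun w => f w * g w) z = dw a f z * g z + f z * dw a g z.
Proof. by move=> df dg; rewrite !dwE !dirderivM // wirt_mul. Qed.

Lemma dwJ a f z : cdiff f z -> dw a (fun w => conjc (f w)) z = conjc (dw (dw_bar a) f z).
Proof.
move=> df; rewrite !dwE !dirderivJ //.
have -> (X Y t : C) : conjc ((X + t * Y) / 2) = (conjc X + conjc t * conjc Y) / 2.
  have h : conjc (2^-1 : C) = 2^-1 by rewrite conjc_inv conjc_nat.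
  transitivity (conjc (X + t * Y) * conjc (2^-1 : C)); first exact: rmorphM.
  rewrite h; congr (_ * _); transitivity (conjc X + conjc (t * Y)); first exact: rmorphD.
  by congr (_ + _); exact: rmorphM.
have -> : conjc (sgi (dw_bar a)) = sgi a.
  by case: a => j; apply: complex_eq; rewrite /= ?oppr0 ?opprK.
by have -> : idx (dw_bar a) = idx a by case: a.
Qed.

(** Wirtinger derivatives are combinations with constant coefficients of
    derivatives in the real directions dx_j and dy_j, which commute. *)
Lemma dw_schwarz O a b f z : open O -> O z -> smooth O f ->
  dw a (dw b f) z = dw b (dw a f) z.
Proof.
move=> oO Oz sf.
have near_df : \forall w \near z, cdiff f w.
  by apply: filterS (open_nbhs_nbhs (conj oO Oz)) => w; exact: smooth_cdiff.
have cd v : cdiff (dirderiv v f) z by apply: smooth_cdiff (smooth_dirderiv v sf) Oz.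
have E v c : dirderiv v (dw c f) z =
    (dirderiv v (dirderiv (dx R (idx c)) f) z + sgi c * dirderiv v (dirderiv (dy R (idx c))
      f) z) / 2.
  have -> : dw c f = (fun z =>
    (dirderiv (dx R (idx c)) f z + sgi c * dirderiv (dy R (idx c)) f z) * 2^-1).
    by apply/funext => w; rewrite dwE.
  have c1 := cdiffM (cdiff_cst (sgi c) z) (cd (dy R (idx c))).
  rewrite (@dirderivM _ _ v (fun z =>
    dirderiv (dx R (idx c)) f z + sgi c * dirderiv (dy R (idx c)) f z) (fun=> 2^-1)).
  - rewrite dirderiv_cst mulr0 addr0 dirderivD // dirderivM ?dirderiv_cst ?mul0r ?add0r //.
  - by apply: cdiffD.
  - exact: cdiff_cst.
have S u v := dirderiv_schwarz near_df (cd u) (cd v).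
rewrite (dwE a) (dwE b) !E.
rewrite (S (dx R (idx b)) (dx R (idx a))) (S (dy R (idx b)) (dx R (idx a))).
rewrite (S (dx R (idx b)) (dy R (idx a))) (S (dy R (idx b)) (dy R (idx a))).
exact: wirt_comm.
Qed.

Lemma smooth_dw O a f : open O -> smooth O f -> smooth O (dw a f).
Proof.
move=> oO sf.
have -> : dw a f = (fun z =>
  (dirderiv (dx R (idx a)) f z + sgi a * dirderiv (dy R (idx a)) f z) * 2^-1).
  by apply/funext => w; rewrite dwE.
apply: smoothM => //; last exact: smooth_cst.
apply: smoothD => //; first exact: smooth_dirderiv.
by apply: smoothM => //; [exact: smooth_cst|exact: smooth_dirderiv].
Qed.

Lemma dirderiv_dx j f z : dirderiv (dx R j) f z = dz j f z + dzbar j f z.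
Proof. by rewrite wirt_sum. Qed.

Lemma mulii : (0 +i* 1) * (0 +i* 1) = -1 :> C.
Proof. by apply: complex_eq; rewrite ?cReM ?cImM /=; ring. Qed.

Lemma dirderiv_dy j f z : dirderiv (dy R j) f z = (0 +i* 1) * (dz j f z - dzbar j f z).
Proof.
by rewrite wirt_dif // mulii.
Qed.

Lemma Cspace_decomp z :
  z = \sum_k complex.Re (zcoord z k) *: dx R k + \sum_k complex.Im (zcoord z k) *: dy R k.
Proof.
case: z => x y; rewrite /zcoord /=.
have -> : \sum_(k < m) x 0 k *: dx R k = (x, 0).
  rewrite {2}(row_sum_delta x); apply/esym.
  elim/big_rec2: _ => // k b1 b2 _ <-; rewrite /dx.
  by rewrite -[RHS]/(x 0 k *: 'e_k + b2, x 0 k *: 0 + 0) scaler0 add0r.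
have -> : \sum_(k < m) y 0 k *: dy R k = (0, y).
  rewrite {2}(row_sum_delta y); apply/esym.
  elim/big_rec2: _ => // k b1 b2 _ <-; rewrite /dy.
  by rewrite -[RHS]/(y 0 k *: 0 + 0, y 0 k *: 'e_k + b2) scaler0 add0r.
by congr pair; rewrite ?addr0 ?add0r.
Qed.

Lemma derive_zcoord_Re k z v :
  'D_v (fun w : V => complex.Re (zcoord w k)) z = complex.Re (zcoord v k).
Proof.
apply/lim_near_cst => //=; near=> h.
have h0 : h != 0 by near: h; exact: nbhs_dnbhs_neq.
by rewrite /= !mxE addrK /GRing.scale /= mulKf.
Unshelve. all: by end_near. Qed.

Lemma derive_zcoord_Im k z v :
  'D_v (fun w : V => complex.Im (zcoord w k)) z = complex.Im (zcoord v k).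
Proof.
apply/lim_near_cst => //=; near=> h.
have h0 : h != 0 by near: h; exact: nbhs_dnbhs_neq.
by rewrite /= !mxE addrK /GRing.scale /= mulKf.
Unshelve. all: by end_near. Qed.

Lemma dirderiv_zcoord v k z : dirderiv v (fun w => zcoord w k) z = zcoord v k.
Proof. by rewrite /dirderiv derive_zcoord_Re derive_zcoord_Im; case: (zcoord v k). Qed.

Lemma zcoord_dx (j k : 'I_m) : zcoord (dx R j) k =  (j == k)%:R.
Proof. by apply: complex_eq; rewrite /zcoord /= !mxE //= eq_sym; case: eqP. Qed.

Lemma zcoord_dy (j k : 'I_m) : zcoord (dy R j) k = (0 +i* 1) * (j == k)%:R.
Proof.
rewrite /zcoord /= !mxE /= eq_sym; case: eqP => _; apply: complex_eq;
  rewrite ?cReM ?cImM /=; ring.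
Qed.

Lemma dz_zcoord j k z : dz j (fun w => zcoord w k) z = (j == k)%:R.
Proof.
rewrite /dz !dirderiv_zcoord zcoord_dx zcoord_dy mulrA mulii.
by case: (j == k); field.
Qed.

Lemma derive_comp (F : V -> V) (g : V -> R) z v :
  (forall k, cdiff (fun w => zcoord (F w) k) z) -> differentiable g (F z) ->
  differentiable (g \o F) z /\
  'D_v (g \o F) z = \sum_k ('D_v (fun w =>
    complex.Re (zcoord (F w) k)) z * 'D_(dx R k) g (F z) +
     'D_v (fun w => complex.Im (zcoord (F w) k)) z * 'D_(dy R k) g (F z)).
Proof.
move=> cF dg.
pose F1 k w : V := complex.Re (zcoord (F w) k) *: dx R k.
pose F2 k w : V := complex.Im (zcoord (F w) k) *: dy R k.
have FE : F = (\sum_k F1 k) + (\sum_k F2 k).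
  by apply/funext => w; rewrite !fctE !fct_sumE; exact: Cspace_decomp.
have d1 k : differentiable (F1 k) z by apply: differentiableZl; case: (cF k).
have d2 k : differentiable (F2 k) z by apply: differentiableZl; case: (cF k).
have dF : differentiable F z.
  by rewrite FE; apply: differentiableD; exact: differentiable_sum.
have dgF : differentiable (g \o F) z by exact: differentiable_comp.
have e1 k : 'D_v (F1 k) z = 'D_v (fun w => complex.Re (zcoord (F w) k)) z *: dx R k.
  have [c1 c2] := cF k; rewrite deriveE // diffZl //; congr (_ *: _).
  by rewrite deriveE.
have e2 k : 'D_v (F2 k) z = 'D_v (fun w => complex.Im (zcoord (F w) k)) z *: dy R k.
  have [c1 c2] := cF k; rewrite deriveE // diffZl //; congr (_ *: _).
  by rewrite deriveE.
have E : 'd F z v = \sum_k 'D_v (F1 k) z + \sum_k 'D_v (F2 k) z.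
  transitivity ('D_v ((\sum_k F1 k) + (\sum_k F2 k)) z); first by rewrite -FE deriveE.
  rewrite deriveD; last 2 first.
  - by apply: derivable_sum => k; exact: diff_derivable.
  - by apply: derivable_sum => k; exact: diff_derivable.
  by rewrite !derive_sum // => k; exact: diff_derivable.
split=> //; rewrite deriveE // diff_comp // -[LHS]/('d g (F z) ('d F z v)).
have L1 : 'd g (F z) (\sum_k 'D_v (F1 k) z) =
    \sum_k 'D_v (fun w => complex.Re (zcoord (F w) k)) z * 'D_(dx R k) g (F z).
  by rewrite linear_sum; apply: eq_bigr => k _; rewrite e1 linearZ -deriveE.
have L2 : 'd g (F z) (\sum_k 'D_v (F2 k) z) =
    \sum_k 'D_v (fun w => complex.Im (zcoord (F w) k)) z * 'D_(dy R k) g (F z).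
  by rewrite linear_sum; apply: eq_bigr => k _; rewrite e2 linearZ -deriveE.
rewrite E.
transitivity ('d g (F z) (\sum_k 'D_v (F1 k) z) + 'd g (F z) (\sum_k 'D_v (F2 k) z)).
  exact: linearD.
apply: etrans (congr2 +%R L1 L2) _.
exact: (esym (big_split _ _ _ _ _)).
Qed.

Lemma complex_combine (a b p q p' q' x y : R) :
  (a * p + b * q + x) +i* (a * p' + b * q' + y) =
  a%:C * (p +i* p') + b%:C * (q +i* q') + (x +i* y).
Proof. by apply: complex_eq; rewrite /=; ring. Qed.

Lemma complex_split (a b : R) : a +i* b = a%:C + (0 +i* 1) * b%:C.
Proof. by apply: complex_eq; rewrite /=; ring. Qed.

(** The differential of g is the sum of dg/dz_k dz_k + dg/d\bar z_k d\bar z_k,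
    and F pulls d\bar z_k back to the conjugate of the differential of its k-th
    component. *)
Lemma dirderiv_comp (F : V -> V) g z v :
  (forall k, cdiff (fun w => zcoord (F w) k) z) -> cdiff g (F z) ->
  dirderiv v (g \o F) z =
  \sum_k (dirderiv v (fun w => zcoord (F w) k) z * dz k g (F z) +
          conjc (dirderiv v (fun w => zcoord (F w) k) z) * dzbar k g (F z)).
Proof.
move=> cF [g1 g2]; have [_ E1] := derive_comp v cF g1; have [_ E2] := derive_comp v cF g2.
transitivity (\sum_k (('D_v (fun w =>
  complex.Re (zcoord (F w) k)) z)%:C * dirderiv (dx R k) g (F z)
   + ('D_v (fun w => complex.Im (zcoord (F w) k)) z)%:C * dirderiv (dy R k) g (F z))).
  rewrite /dirderiv /= [X in X +i* _]E1 [X in _ +i* X]E2.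
  elim/big_rec3: _ => [|k x y w _ <-]; first by [].
  exact: complex_combine.
apply: eq_bigr => k _; rewrite dirderiv_dx dirderiv_dy wirt_split.
rewrite -complex_split; congr (_ * _ + _ * _).
rewrite /dirderiv; move: ('D_v _ _) ('D_v _ _) => A B.
by apply: complex_eq; rewrite /=; ring.
Qed.

(** When F is holomorphic, the conjugates of its components have no
    derivative in z_i, so only the first half of the chain rule remains. *)
Lemma dz_comp (F : V -> V) g z i :
  (forall k, cdiff (fun w => zcoord (F w) k) z) ->
  (forall k j, dzbar j (fun w => zcoord (F w) k) z = 0) -> cdiff g (F z) ->
  dz i (g \o F) z = \sum_k dz i (fun w => zcoord (F w) k) z * dz k g (F z).
Proof.
move=> cF hF cg.
have hJ k : dirderiv (dx R i) (fun w => zcoord (F w) k) z =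
   - ((0 +i* 1) * dirderiv (dy R i) (fun w => zcoord (F w) k) z).
  have := hF k i; rewrite /dzbar => /eqP; rewrite mulf_eq0 invr_eq0 pnatr_eq0 orbF.
  by rewrite addr_eq0 => /eqP.
rewrite {1}/dz !dirderiv_comp // mulr_sumr -sumrB mulr_suml; apply: eq_bigr => k _.
have hJ2 : conjc (dirderiv (dx R i) (fun w => zcoord (F w) k) z) =
   (0 +i* 1) * conjc (dirderiv (dy R i) (fun w => zcoord (F w) k) z).
  rewrite hJ rmorphN rmorphM /= -mulNr; congr (_ * _).
  by apply: complex_eq; rewrite /= ?oppr0 ?opprK.
by rewrite hJ2 wirt_comp.
Qed.

End Wirtinger.

(** * Calculus in a chart *)

Section ChartCalculus.
Variables (R : realType) (m : nat) (M : complex_manifold R m).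
Local Notation V := (Cspace R m).
Local Notation C := R[i].
Local Notation chartM := (chart R m M).
Implicit Types (phi psi : chartM) (W : set M) (f g : M -> C) (p q : M) (a b : 'I_m + 'I_m).

Definition chart_open phi W := open W /\ W `<=` dom phi.

Lemma chart_open_dom phi : chart_open phi (dom phi).
Proof. by split=> //; exact: open_dom. Qed.

Lemma chart_openI phi W (W' : set M) : chart_open phi W -> open W' -> chart_open phi (W `&` W').
Proof. by move=> [oW sW] oW'; split; [exact: openI|move=> p [/sW]]. Qed.

Lemma cinv_img phi W z : W `<=` dom phi -> (cmap phi @` W) z ->
  W (cinv phi z) /\ cmap phi (cinv phi z) = z.
Proof. by move=> sW [p Wp <-]; rewrite cmapK //; exact: sW. Qed.

Lemma chart_open_img phi W : chart_open phi W -> open (cmap phi @` W).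
Proof.
move=> [oW sW]; rewrite openE => z [p Wp <-{z}].
have dp := sW _ Wp.
have cc : (cmap phi @` dom phi) (cmap phi p) by exists p.
have n1 := open_nbhs_nbhs (conj (@open_cod _ _ _ phi) cc).
have n2 : nbhs (cmap phi p) (cinv phi @^-1` W).
  by apply: (cinv_continuous cc); rewrite cmapK //; exact: open_nbhs_nbhs.
apply: filterS2 n1 n2 => z [q dq <-] /=; rewrite cmapK // => Wq.
by exists q.
Qed.

(** Derivatives are taken on the chart's image; this carries statements on an
    open set of the manifold over to a neighbourhood in that image. *)
Lemma near_chart_open phi W p (P : M -> Prop) : chart_open phi W -> W p ->
  (forall q, W q -> P q) ->
  \forall z \near cmap phi p, P (cinv phi z).
Proof.
move=> pW Wp H; have oi := chart_open_img pW.
apply: filterS (open_nbhs_nbhs (conj oi (imageP _ Wp))) => z.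
by move=> /(cinv_img pW.2) [/H].
Qed.

Definition smooth_in phi W f := smooth (cmap phi @` W) (f \o cinv phi).
(** The derivatives [pd] for indices [inl i] and [pdbar] for indices [inr i]. *)
Definition pdd phi a f : M -> C := fun p => dw a (f \o cinv phi) (cmap phi p).

Lemma smooth_in_cdiff phi W f p : smooth_in phi W f -> W p ->
  cdiff (f \o cinv phi) (cmap phi p).
Proof. by move=> sf Wp; apply: smooth_cdiff sf _; exists p. Qed.

Lemma smooth_in_eq phi W f g : chart_open phi W -> (forall q, W q -> f q = g q) ->
  smooth_in phi W f -> smooth_in phi W g.
Proof.
move=> pW fg; apply: smooth_eq; first exact: chart_open_img.
by move=> z /(cinv_img pW.2) [Wz _]; exact: fg.
Qed.

Lemma smooth_in_sub phi W (W' : set M) f : W' `<=` W -> smooth_in phi W f -> smooth_in phi W' f.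
Proof. by move=> sW; apply: smooth_sub; exact: image_subset. Qed.

Lemma smooth_in_local phi W f :
  (forall p, W p -> exists2 U : set M, U p & smooth_in phi U f) -> smooth_in phi W f.
Proof.
move=> H; apply: smooth_local => z [p Wp <-]; have [U Up sU] := H p Wp.
by exists (cmap phi @` U) => //; exists p.
Qed.

Lemma smooth_in_cst phi W (c : C) : smooth_in phi W (fun=> c).
Proof. exact: smooth_cst. Qed.

Lemma smooth_inD phi W f g : chart_open phi W -> smooth_in phi W f -> smooth_in phi W g ->
  smooth_in phi W (fun q => f q + g q).
Proof. by move=> /chart_open_img; exact: smoothD. Qed.

Lemma smooth_inM phi W f g : chart_open phi W -> smooth_in phi W f -> smooth_in phi W g ->
  smooth_in phi W (fun q => f q * g q).
Proof. by move=> /chart_open_img; exact: smoothM. Qed.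

Lemma smooth_inN phi W f : chart_open phi W -> smooth_in phi W f ->
  smooth_in phi W (fun q => - f q).
Proof.
move=> pW sf; apply: smooth_in_eq (smooth_inM pW (smooth_in_cst phi W (-1)) sf) => //.
by move=> q _; rewrite mulN1r.
Qed.

Lemma smooth_inJ phi W f : chart_open phi W -> smooth_in phi W f ->
  smooth_in phi W (fun q => conjc (f q)).
Proof. by move=> /chart_open_img; exact: smoothJ. Qed.

Lemma smooth_inV phi W f : chart_open phi W -> (forall q, W q -> f q != 0) ->
  smooth_in phi W f -> smooth_in phi W (fun q => (f q)^-1).
Proof.
move=> pW f0; apply: smoothV; first exact: chart_open_img.
by move=> z /(cinv_img pW.2) [Wz _]; exact: f0.
Qed.

Lemma smooth_in_norm phi W f : chart_open phi W -> (forall q, W q -> f q != 0) ->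
  smooth_in phi W f -> smooth_in phi W (fun q => `|f q|).
Proof.
move=> pW f0; apply: smooth_norm; first exact: chart_open_img.
by move=> z /(cinv_img pW.2) [Wz _]; exact: f0.
Qed.

Lemma smooth_in_sum phi W (I : Type) (r : seq I) (P : pred I) (F : I -> M ->
  C) : chart_open phi W ->
  (forall i, smooth_in phi W (F i)) -> smooth_in phi W (fun q => \sum_(i <- r | P i) F i q).
Proof.
move=> pW sF; elim: r => [|i r IH].
  by under eq_fun do rewrite big_nil; exact: smooth_in_cst.
under eq_fun do rewrite big_cons.
by case: (P i) => //; exact: smooth_inD.
Qed.

Lemma smooth_in_prod phi W (I : Type) (r : seq I) (P : pred I) (F : I -> M ->
  C) : chart_open phi W ->
  (forall i, smooth_in phi W (F i)) -> smooth_in phi W (fun q => \prod_(i <- r | P i) F i q).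
Proof.
move=> pW sF; elim: r => [|i r IH].
  by under eq_fun do rewrite big_nil; exact: smooth_in_cst.
under eq_fun do rewrite big_cons.
by case: (P i) => //; exact: smooth_inM.
Qed.

Lemma smooth_in_pdd phi W a f : chart_open phi W -> smooth_in phi W f ->
  smooth_in phi W (pdd phi a f).
Proof.
move=> pW sf; have oi := chart_open_img pW.
have h := smooth_dw a oi sf; apply: (smooth_eq oi _ h) => z /(cinv_img pW.2) [_ E].
by rewrite /pdd /= E.
Qed.

Lemma pdd_eq phi W a f g p : chart_open phi W -> (forall q, W q -> f q = g q) -> W p ->
  pdd phi a f p = pdd phi a g p.
Proof.
move=> pW fg Wp; apply: dw_near.
exact: (near_chart_open (P := fun q => f q = g q) pW Wp).
Qed.

Lemma pdd_cst phi a (c : C) p : pdd phi a (fun=> c) p = 0.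
Proof. exact: dw_cst. Qed.

Lemma pddD phi W a f g p : smooth_in phi W f -> smooth_in phi W g -> W p ->
  pdd phi a (fun q => f q + g q) p = pdd phi a f p + pdd phi a g p.
Proof. by move=> sf sg Wp; apply: dwD; [move: sf|move: sg] => /smooth_in_cdiff; exact. Qed.

Lemma pddM phi W a f g p : chart_open phi W ->
  smooth_in phi W f -> smooth_in phi W g -> W p ->
  pdd phi a (fun q => f q * g q) p = pdd phi a f p * g p + f p * pdd phi a g p.
Proof.
move=> pW sf sg Wp; have dp := pW.2 _ Wp.
have h := dwM a (smooth_in_cdiff sf Wp) (smooth_in_cdiff sg Wp).
have fE : (f \o cinv phi) (cmap phi p) = f p by rewrite /= cmapK.
have gE : (g \o cinv phi) (cmap phi p) = g p by rewrite /= cmapK.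
by rewrite fE gE in h.
Qed.

Lemma pddN phi W a f p : chart_open phi W -> smooth_in phi W f -> W p ->
  pdd phi a (fun q => - f q) p = - pdd phi a f p.
Proof.
move=> pW sf Wp; have -> : (fun q => - f q) = (fun q => -1 * f q).
  by apply/funext => q; rewrite mulN1r.
rewrite (pddM _ pW) //; last exact: smooth_in_cst.
by rewrite pdd_cst mul0r add0r mulN1r.
Qed.

Lemma pddV phi W a f p : chart_open phi W -> (forall q, W q -> f q != 0) ->
  smooth_in phi W f -> W p ->
  pdd phi a (fun q => (f q)^-1) p = - pdd phi a f p / f p ^+ 2.
Proof.
move=> pW f0 sf Wp; have sV := smooth_inV pW f0 sf.
have : pdd phi a (fun q => f q * (f q)^-1) p = 0.
  rewrite -(pdd_cst phi a 1 p); apply: (pdd_eq _ pW) => // q Wq.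
  by rewrite mulfV // f0.
rewrite (pddM _ pW) // => /eqP; rewrite addrC addr_eq0 => /eqP E.
apply: (mulfI (f0 _ Wp)); rewrite E mulNr mulrN expr2; congr (- _).
by rewrite invfM mulrCA; congr (_ * _); rewrite mulVKf // f0.
Qed.

Lemma pddJ phi W a f p : smooth_in phi W f -> W p ->
  pdd phi a (fun q => conjc (f q)) p = conjc (pdd phi (dw_bar a) f p).
Proof. by move=> sf Wp; exact: dwJ (smooth_in_cdiff sf Wp). Qed.

Lemma pdd_sum phi W a (I : Type) (r : seq I) (P : pred I) (F : I -> M -> C) p :
  chart_open phi W -> (forall i, smooth_in phi W (F i)) -> W p ->
  pdd phi a (fun q => \sum_(i <- r | P i) F i q) p = \sum_(i <- r | P i) pdd phi a (F i) p.
Proof.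
move=> pW sF Wp; elim: r => [|i r IH].
  by rewrite big_nil; under eq_fun do rewrite big_nil; exact: pdd_cst.
rewrite big_cons; under eq_fun do rewrite big_cons.
case: (P i) => //; rewrite (pddD a (sF i) _ Wp) ?IH //.
exact: smooth_in_sum.
Qed.

Lemma pdd_schwarz phi W a b f p : chart_open phi W -> smooth_in phi W f -> W p ->
  pdd phi a (pdd phi b f) p = pdd phi b (pdd phi a f) p.
Proof.
move=> pW sf Wp; have oi := chart_open_img pW.
have E c d : pdd phi c (pdd phi d f) p = dw c (dw d (f \o cinv phi)) (cmap phi p).
  apply: dw_near; apply: filterS (open_nbhs_nbhs (conj oi (imageP _ Wp))) => z.
  by move=> /(cinv_img pW.2) [_ zE]; rewrite /pdd /= zE.
by rewrite !E; apply: (dw_schwarz _ _ oi _ sf); exact: imageP.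
Qed.

(** * Holomorphic functions in a chart *)

Definition hol_in phi W f := smooth_in phi W f /\
  forall p, W p -> forall j, pdd phi (inr j) f p = 0.

Lemma hol_inE phi W f : holomorphic (cmap phi @` W) (f \o cinv phi) <-> hol_in phi W f.
Proof.
split=> -[sf hf]; split=> //; first by move=> p Wp j; apply: hf; exists p.
by move=> _ [p Wp <-] j; exact: hf.
Qed.

Lemma hol_in_eq phi W f g : chart_open phi W -> (forall q, W q -> f q = g q) ->
  hol_in phi W f -> hol_in phi W g.
Proof.
move=> pW fg [sf hf]; split; first exact: smooth_in_eq sf.
by move=> p Wp j; rewrite -(pdd_eq (inr j) pW fg Wp) hf.
Qed.

Lemma hol_in_sub phi W (W' : set M) f : W' `<=` W -> hol_in phi W f -> hol_in phi W' f.
Proof.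
by move=> sW [sf hf]; split; [exact: smooth_in_sub sf|move=> p /sW; exact: hf].
Qed.

Lemma hol_in_cst phi W (c : C) : hol_in phi W (fun=> c).
Proof. by split; [exact: smooth_in_cst|move=> p _ j; exact: pdd_cst]. Qed.

Lemma hol_inD phi W f g : chart_open phi W -> hol_in phi W f -> hol_in phi W g ->
  hol_in phi W (fun q => f q + g q).
Proof.
move=> pW [sf hf] [sg hg]; split; first exact: smooth_inD.
by move=> p Wp j; rewrite (pddD _ sf sg Wp) hf // hg // addr0.
Qed.

Lemma hol_inM phi W f g : chart_open phi W -> hol_in phi W f -> hol_in phi W g ->
  hol_in phi W (fun q => f q * g q).
Proof.
move=> pW [sf hf] [sg hg]; split; first exact: smooth_inM.
by move=> p Wp j; rewrite (pddM _ pW sf sg Wp) hf // hg // mul0r mulr0 addr0.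
Qed.

Lemma hol_inV phi W f : chart_open phi W -> (forall q, W q -> f q != 0) ->
  hol_in phi W f -> hol_in phi W (fun q => (f q)^-1).
Proof.
move=> pW f0 [sf hf]; split; first exact: smooth_inV.
by move=> p Wp j; rewrite (pddV _ pW f0 sf Wp) hf // oppr0 mul0r.
Qed.

Lemma hol_in_sum phi W (I : Type) (r : seq I) (P : pred I) (F : I -> M ->
  C) : chart_open phi W ->
  (forall i, hol_in phi W (F i)) -> hol_in phi W (fun q => \sum_(i <- r | P i) F i q).
Proof.
move=> pW hF; split; first by apply: smooth_in_sum => // i; case: (hF i).
move=> p Wp j; rewrite (pdd_sum _ _ _ pW) //; last by move=> i; case: (hF i).
by apply: big1 => i _; case: (hF i) => _; exact.
Qed.

Lemma hol_in_pd phi W i f : chart_open phi W -> hol_in phi W f ->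
  hol_in phi W (pdd phi (inl i) f).
Proof.
move=> pW [sf hf]; split; first exact: smooth_in_pdd.
move=> p Wp j; rewrite (pdd_schwarz _ _ pW sf Wp) -(pdd_cst phi (inl i) 0 p).
by apply: (pdd_eq _ pW) => // q Wq; exact: hf.
Qed.

(** * Matrix-valued functions *)

Section Matrices.
Variables (n1 n2 n3 : nat).

Definition pdd_mx phi a k l (A : M -> 'M[C]_(k, l)) p : 'M[C]_(k, l) :=
  \matrix_(i, j) pdd phi a (fun q => A q i j) p.
Definition smooth_mx phi W k l (A : M -> 'M[C]_(k, l)) :=
  forall i j, smooth_in phi W (fun q => A q i j).
Definition hol_mx phi W k l (A : M -> 'M[C]_(k, l)) :=
  forall i j, hol_in phi W (fun q => A q i j).

Lemma hol_mx_smooth phi W k l (A : M -> 'M[C]_(k, l)) : hol_mx phi W A -> smooth_mx phi W A.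
Proof. by move=> h i j; case: (h i j). Qed.

Lemma hol_mx_pdbar phi W k l (A : M -> 'M[C]_(k, l)) j p : hol_mx phi W A -> W p ->
  pdd_mx phi (inr j) A p = 0.
Proof. by move=> h Wp; apply/matrixP => i i'; rewrite !mxE; case: (h i i') => _; exact. Qed.

Lemma pdd_mx_eq phi W a k l (A B : M -> 'M[C]_(k, l)) p : chart_open phi W ->
  (forall q, W q -> A q = B q) -> W p -> pdd_mx phi a A p = pdd_mx phi a B p.
Proof.
move=> pW AB Wp; apply/matrixP => i j; rewrite !mxE.
by apply: (pdd_eq _ pW) => // q Wq; rewrite AB.
Qed.

Lemma smooth_mx_eq phi W k l (A B : M -> 'M[C]_(k, l)) : chart_open phi W ->
  (forall q, W q -> A q = B q) -> smooth_mx phi W A -> smooth_mx phi W B.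
Proof.
by move=> pW AB sA i j; apply: smooth_in_eq (sA i j) => // q Wq; rewrite AB.
Qed.

Lemma hol_mx_eq phi W k l (A B : M -> 'M[C]_(k, l)) : chart_open phi W ->
  (forall q, W q -> A q = B q) -> hol_mx phi W A -> hol_mx phi W B.
Proof.
by move=> pW AB sA i j; apply: hol_in_eq (sA i j) => // q Wq; rewrite AB.
Qed.

Lemma pdd_mx_cst phi a k l (A : 'M[C]_(k, l)) p : pdd_mx phi a (fun=> A) p = 0.
Proof. by apply/matrixP => i j; rewrite !mxE pdd_cst. Qed.

Lemma smooth_mxM phi W (A : M -> 'M[C]_(n1, n2)) (B : M -> 'M[C]_(n2, n3)) : chart_open phi W ->
  smooth_mx phi W A -> smooth_mx phi W B -> smooth_mx phi W (fun q => A q *m B q).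
Proof.
move=> pW sA sB i j; under eq_fun do rewrite mxE.
by apply: smooth_in_sum => // k; exact: smooth_inM.
Qed.

Lemma hol_mxM phi W (A : M -> 'M[C]_(n1, n2)) (B : M -> 'M[C]_(n2, n3)) : chart_open phi W ->
  hol_mx phi W A -> hol_mx phi W B -> hol_mx phi W (fun q => A q *m B q).
Proof.
move=> pW sA sB i j; under eq_fun do rewrite mxE.
by apply: hol_in_sum => // k; exact: hol_inM.
Qed.

Lemma hol_mxD phi W (A B : M -> 'M[C]_(n1, n2)) : chart_open phi W ->
  hol_mx phi W A -> hol_mx phi W B -> hol_mx phi W (fun q => A q + B q).
Proof. by move=> pW sA sB i j; under eq_fun do rewrite mxE; exact: hol_inD. Qed.

Lemma smooth_mx_map_conj phi W (A : M -> 'M[C]_(n1, n2)) : chart_open phi W ->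
  smooth_mx phi W A -> smooth_mx phi W (fun q => map_mx conjc (A q)).
Proof. by move=> pW sA i j; under eq_fun do rewrite mxE; exact: smooth_inJ. Qed.

Lemma pdd_mxM phi W a (A : M -> 'M[C]_(n1, n2)) (B : M ->
  'M[C]_(n2, n3)) p : chart_open phi W ->
  smooth_mx phi W A -> smooth_mx phi W B -> W p ->
  pdd_mx phi a (fun q => A q *m B q) p = pdd_mx phi a A p *m B p + A p *m pdd_mx phi a B p.
Proof.
move=> pW sA sB Wp; apply/matrixP => i j; rewrite !mxE.
under [X in pdd _ _ X]eq_fun do rewrite mxE.
rewrite (pdd_sum _ _ _ pW) //; last by move=> k; exact: smooth_inM.
rewrite -big_split /=; apply: eq_bigr => k _; rewrite !mxE.
exact: (pddM a pW (sA i k) (sB k j) Wp).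
Qed.

End Matrices.

Lemma smooth_in_det phi W n (A : M -> 'M[C]_n) : chart_open phi W -> smooth_mx phi W A ->
  smooth_in phi W (fun q => \det (A q)).
Proof.
move=> pW sA; apply: smooth_in_sum => // s; apply: smooth_inM => //.
  exact: smooth_in_cst.
by apply: smooth_in_prod.
Qed.

(** By Cramer's rule the entries are quotients of polynomials in the entries
    of A. *)
Lemma smooth_mx_inv phi W n (A : M -> 'M[C]_n) : chart_open phi W -> (forall q, W q ->
  A q \in unitmx) ->
  smooth_mx phi W A -> smooth_mx phi W (fun q => invmx (A q)).
Proof.
move=> pW uA sA i j.
apply: (@smooth_in_eq _ _ (fun q =>
  (\det (A q))^-1 * ((-1) ^+ (j + i) * \det (row' j (col' i (A q)))))) => //.
  by move=> q Wq; rewrite /invmx uA // !mxE.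
have d0 q : W q -> \det (A q) != 0 by move=> Wq; rewrite -unitfE -unitmxE uA.
have s1 := smooth_inV pW d0 (smooth_in_det pW sA).
have s2 : smooth_in phi W (fun q => \det (row' j (col' i (A q)))).
  by apply: smooth_in_det => // k l; under eq_fun do rewrite !mxE; exact: sA.
exact: smooth_inM pW s1 (smooth_inM pW (smooth_in_cst _ _ _) s2).
Qed.

Lemma mulmx_solve n (A X Y D : 'M[C]_n) :
  Y *m A = 1%:M -> A *m X = - (D *m Y) -> X = - (Y *m D *m Y).
Proof. by move=> YA AX; rewrite -[X]mul1mx -YA -mulmxA AX mulmxN mulmxA. Qed.

Lemma pdd_mxV phi W a n (A : M -> 'M[C]_n) p : chart_open phi W -> (forall q, W q ->
  A q \in unitmx) ->
  smooth_mx phi W A -> W p ->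
  pdd_mx phi a (fun q => invmx (A q)) p = - (invmx (A p) *m pdd_mx phi a A p *m invmx (A p)).
Proof.
move=> pW uA sA Wp; have sV := smooth_mx_inv pW uA sA.
have : pdd_mx phi a (fun q => A q *m invmx (A q)) p = 0.
  rewrite -(pdd_mx_cst phi a (1%:M : 'M[C]_n) p); apply: (pdd_mx_eq _ pW) => // q Wq.
  by rewrite mulmxV // uA.
rewrite (pdd_mxM _ pW) // => /eqP; rewrite addrC addr_eq0 => /eqP E.
exact: mulmx_solve (mulVmx (uA _ Wp)) E.
Qed.

(** The derivatives of A^-1 are - A^-1 (dA) A^-1. *)
Lemma hol_mx_inv phi W n (A : M -> 'M[C]_n) : chart_open phi W -> (forall q, W q ->
  A q \in unitmx) ->
  hol_mx phi W A -> hol_mx phi W (fun q => invmx (A q)).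
Proof.
move=> pW uA hA i j; have sA := hol_mx_smooth hA; split; first exact: smooth_mx_inv.
move=> p Wp k; have /matrixP /(_ i j) := pdd_mxV (inr k) pW uA sA Wp.
by rewrite (hol_mx_pdbar _ hA Wp) mulmx0 mul0mx oppr0 !mxE.
Qed.

(** * Changes of charts *)

Definition overlap phi psi := dom phi `&` dom psi.

Lemma chart_open_overlap phi psi : chart_open phi (overlap phi psi).
Proof. by apply: chart_openI; [exact: chart_open_dom|exact: open_dom]. Qed.

Lemma hol_cmap phi psi k : atlas M phi -> atlas M psi ->
  hol_in phi (overlap phi psi) (fun q => zcoord (cmap psi q) k).
Proof.
by move=> aphi apsi; apply/hol_inE; have [H _] := atlas_compatible aphi apsi; exact: H.
Qed.

Lemma jacE phi psi j k p :
  jac phi psi p j k = pdd phi (inl j) (fun q => zcoord (cmap psi q) k) p.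
Proof. exact: mxE. Qed.

Lemma hol_mx_jac phi psi : atlas M phi -> atlas M psi ->
  hol_mx phi (overlap phi psi) (jac phi psi).
Proof.
move=> aphi apsi j k; have h := hol_in_pd j (chart_open_overlap phi psi) (hol_cmap k aphi apsi).
by apply: hol_in_eq h => [|q _]; [exact: chart_open_overlap|rewrite mxE].
Qed.

(** The columns of a Jacobian matrix are gradients of coordinates, so this is
    the symmetry of second derivatives. *)
Lemma jac_sym phi psi i j k p : atlas M phi -> atlas M psi -> overlap phi psi p ->
  pdd phi (inl i) (fun q => jac phi psi q j k) p = pdd phi (inl j) (fun q =>
    jac phi psi q i k) p.
Proof.
move=> aphi apsi Op; have pO := chart_open_overlap phi psi.
have [sf _] := hol_cmap k aphi apsi.
have E l : (fun q => jac phi psi q l k) = pdd phi (inl l) (fun q => zcoord (cmap psi q) k).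
  by apply/funext => q; rewrite jacE.
rewrite !E; exact: (pdd_schwarz _ _ pO sf Op).
Qed.

(** The transition map is holomorphic, so that no antiholomorphic derivative
    of f enters. *)
Lemma pd_chain phi psi i f p : atlas M phi -> atlas M psi -> overlap phi psi p ->
  cdiff (f \o cinv psi) (cmap psi p) ->
  pdd phi (inl i) f p = \sum_k jac phi psi p i k * pdd psi (inl k) f p.
Proof.
move=> aphi apsi Op cf; have pO := chart_open_overlap phi psi.
pose F := cmap psi \o cinv phi.
have Fp : F (cmap phi p) = cmap psi p by rewrite /F /= cmapK //; case: Op.
have cF k : cdiff (fun w => zcoord (F w) k) (cmap phi p).
  by have [sf _] := hol_cmap k aphi apsi; exact: smooth_in_cdiff sf Op.
have hF k j : dzbar j (fun w => zcoord (F w) k) (cmap phi p) = 0.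
  by have [_ hf] := hol_cmap k aphi apsi; exact: hf _ Op j.
transitivity (dz i ((f \o cinv psi) \o F) (cmap phi p)).
  apply: (dw_near (inl i)).
  apply: (near_chart_open (P := fun q => f q = f (cinv psi (cmap psi q))) pO Op) => q [_ dq].
  by rewrite cmapK.
rewrite (dz_comp i cF hF); last by rewrite Fp.
by apply: eq_bigr => k _; rewrite Fp jacE.
Qed.

Lemma jac_same phi psi p : chart_open phi (dom phi) -> dom phi p ->
  (forall q, dom phi q -> cmap psi q = cmap phi q) -> jac phi psi p = 1%:M.
Proof.
move=> pW dp E; apply/matrixP => j k; rewrite !mxE.
transitivity (dz j (fun w => zcoord w k) (cmap phi p)); last exact: dz_zcoord.
apply: (dw_near (inl j)).
have oi := chart_open_img pW.
apply: filterS (open_nbhs_nbhs (conj oi (imageP _ dp))) => z /(cinv_img pW.2) [dz zE] /=.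
by rewrite E // zE.
Qed.

Lemma jac_chain phi psi chi p : atlas M phi -> atlas M psi -> atlas M chi ->
  dom phi p -> dom psi p -> dom chi p ->
  jac phi chi p = jac phi psi p *m jac psi chi p.
Proof.
move=> aphi apsi achi d1 d2 d3; apply/matrixP => i k; rewrite !mxE.
have [sf _] := hol_cmap k apsi achi.
have cf := smooth_in_cdiff sf (conj d2 d3).
apply: etrans (pd_chain i aphi apsi (conj d1 d2) cf) _.
by apply: eq_bigr => l _; rewrite -jacE.
Qed.

Lemma jac_mulV phi psi p : atlas M phi -> atlas M psi -> overlap phi psi p ->
  jac phi psi p *m jac psi phi p = 1%:M.
Proof.
move=> aphi apsi [d1 d2]; rewrite -jac_chain //.
by apply: jac_same => //; exact: chart_open_dom.
Qed.

Lemma jac_unit phi psi p : atlas M phi -> atlas M psi -> overlap phi psi p ->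
  jac phi psi p \in unitmx.
Proof. by move=> aphi apsi Op; have /mulmx1_unit [H _] := jac_mulV aphi apsi Op; exact: H. Qed.

End ChartCalculus.

(** * Primitives of closed holomorphic forms *)

Section ComplexPoincare.
Variables (R : realType) (m : nat).
Local Notation V := (Cspace R m).
Local Notation C := R[i].

Definition rcoord (a : 'I_m + 'I_m) (v : V) : R :=
  match a with inl k => v.1 0 k | inr k => v.2 0 k end.

Lemma rcoord_linear a : linear (rcoord a).
Proof. by case: a => k c x y; rewrite /rcoord /= !mxE. Qed.

HB.instance Definition _ a := GRing.isLinear.Build R V R _ (rcoord a) (rcoord_linear a).

Lemma coord_le_norm (x : 'rV[R]_m) k : `|x 0 k| <= `|x|.
Proof.
rewrite -[`|x|]/(mx_norm x) mx_normrE.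
exact: (@le_bigmax _ _ _ 0 (fun i : 'I_1 * 'I_m => `|x i.1 i.2|) (0, k)).
Qed.

Lemma rcoord_le a v : `|rcoord a v| <= `|v|.
Proof.
rewrite prod_normE le_max; apply/orP.
by case: a => k; [left|right]; exact: coord_le_norm.
Qed.

Lemma differentiable_rcoord a z : differentiable (rcoord a) z.
Proof.
apply: linear_differentiable.
by apply: bounded_linear_continuous; apply/bounded_funP => r; exists r => x;
  exact: le_trans (rcoord_le a x).
Qed.

Lemma cdiff_zcoord k z : cdiff (fun w : V => zcoord w k) z.
Proof. by split; [exact: (differentiable_rcoord (inl k))|exact: (differentiable_rcoord (inr
  k))]. Qed.

Lemma dirderiv_wirtinger (g : V -> C) z v : cdiff g z ->
  dirderiv v g z = \sum_k (zcoord v k * dz k g z + conjc (zcoord v k) * dzbar k g z).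
Proof.
move=> cg; rewrite -[LHS]/(dirderiv v (g \o id) z) dirderiv_comp //; last first.
  by move=> k; exact: cdiff_zcoord.
by apply: eq_bigr => k _; rewrite dirderiv_zcoord.
Qed.

Lemma open_normball (z0 : V) (r : R) : open [set z : V | `|z - z0| < r].
Proof.
rewrite openE => z /= zr; suff : \forall w \near z, `|w - z0| < r by [].
apply/nbhs_normP; exists (r - `|z - z0|); first by rewrite /= subr_gt0.
move=> w /=; rewrite ltrBrDr => h; apply: le_lt_trans h.
by apply: le_trans (ler_distD z _ _) _; rewrite [`|w - z|]distrC.
Qed.

Variables (z0 : V) (r : R) (G : 'I_m -> V -> C).
Let B : set V := [set z | `|z - z0| < r].
Hypothesis holG : forall k, holomorphic B (G k).
Hypothesis symG : forall j k z, B z -> dz j (G k) z = dz k (G j) z.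

Let oB : open B.
Proof. exact: open_normball. Qed.

Let symD u v z : B z ->
  \sum_k zcoord v k * dirderiv u (G k) z = \sum_k zcoord u k * dirderiv v (G k) z.
Proof.
move=> Bz.
have E w k : dirderiv w (G k) z = \sum_j zcoord w j * dz j (G k) z.
  have [sG hG] := holG k; rewrite dirderiv_wirtinger; last exact: smooth_cdiff sG Bz.
  by apply: eq_bigr => j _; rewrite hG // mulr0 addr0.
transitivity (\sum_k \sum_j zcoord v k * (zcoord u j * dz j (G k) z)).
  by apply: eq_bigr => k _; rewrite E mulr_sumr.
rewrite exchange_big; apply: eq_bigr => j _; rewrite E mulr_sumr.
by apply: eq_bigr => k _; rewrite mulrCA symG.
Qed.

(* the coefficients of the real and imaginary parts of \sum_k G_k dz_k on the
   forms dx_k and dy_k, for z_k = x_k + i y_k *)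
Let bR (a : 'I_m + 'I_m) (z : V) : R :=
  match a with inl k => complex.Re (G k z) | inr k => - complex.Im (G k z) end.
Let bI (a : 'I_m + 'I_m) (z : V) : R :=
  match a with inl k => complex.Im (G k z) | inr k => complex.Re (G k z) end.

Let G_cdiff k z : B z -> cdiff (G k) z.
Proof. by move=> Bz; have [sG _] := holG k; exact: smooth_cdiff sG Bz. Qed.

Let Ck_bR n a : Ck n B (bR a).
Proof.
case: a => k; have [sG _] := holG k; have [c1 c2] := sG n => //.
exact: CkN.
Qed.

Let Ck_bI n a : Ck n B (bI a).
Proof. by case: a => k; have [sG _] := holG k; have [c1 c2] := sG n. Qed.

Let Re_sum (I : finType) (F : I -> C) : complex.Re (\sum_i F i) = \sum_i complex.Re (F i).
Proof. by elim/big_rec2: _ => // i x y _ <-; rewrite cReD. Qed.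
Let Im_sum (I : finType) (F : I -> C) : complex.Im (\sum_i F i) = \sum_i complex.Im (F i).
Proof. by elim/big_rec2: _ => // i x y _ <-; rewrite cImD. Qed.

Let Re_form (H : 'I_m -> C) v : complex.Re (\sum_k zcoord v k * H k) =
  \sum_(a : 'I_m + 'I_m) rcoord a v * (match a with inl k => complex.Re (H k) | inr k =>
    - complex.Im (H k) end).
Proof.
rewrite Re_sum big_sumType /= -big_split /=; apply: eq_bigr => k _.
by rewrite cReM mulrN.
Qed.

Let Im_form (H : 'I_m -> C) v : complex.Im (\sum_k zcoord v k * H k) =
  \sum_(a : 'I_m + 'I_m) rcoord a v * (match a with inl k => complex.Im (H k) | inr k =>
    complex.Re (H k) end).
Proof.
rewrite Im_sum big_sumType /= -big_split /=; apply: eq_bigr => k _.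
by rewrite cImM.
Qed.

Let DbR a u z : B z -> 'D_u (bR a) z =
  (match a with inl k => complex.Re (dirderiv u (G k) z) | inr k =>
    - complex.Im (dirderiv u (G k) z) end).
Proof.
move=> Bz; case: a => k //=; have [_ c2] := G_cdiff k Bz.
by apply: deriveN; exact: diff_derivable.
Qed.

Let DbI a u z : B z -> 'D_u (bI a) z =
  (match a with inl k => complex.Im (dirderiv u (G k) z) | inr k =>
    complex.Re (dirderiv u (G k) z) end).
Proof. by case: a. Qed.

(** The real and imaginary parts of \sum_k G_k dz_k are closed real forms
    and have primitives on the ball. The complex function that these define has
    the derivative \sum_k v_k G_k in the direction v; this is complex linear in
    v, which is the Cauchy-Riemann equation. *)
Theorem complex_poincare : exists eta : V -> C, holomorphic B eta /\
  forall z, B z -> forall k, dz k eta z = G k z.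
Proof.
have [|||e1 He1] := @poincare R V _ (fun a => rcoord a : {linear V -> R}) rcoord_le z0 r bR.
- by move=> a z Bz; have [H _] := Ck_bR 1 a; exact: H.
- by move=> a v z Bz; have [_ H] := Ck_bR 1 a; exact: H.
- move=> u v z Bz.
  have E := etrans (esym (Re_form _ v)) (etrans (congr1 (@complex.Re R) (symD u v Bz))
    (Re_form _ u)).
  apply: etrans (etrans E _); apply: eq_bigr => a _; by rewrite DbR.
have [|||e2 He2] := @poincare R V _ (fun a => rcoord a : {linear V -> R}) rcoord_le z0 r bI.
- by move=> a z Bz; have [H _] := Ck_bI 1 a; exact: H.
- by move=> a v z Bz; have [_ H] := Ck_bI 1 a; exact: H.
- move=> u v z Bz.
  have E := etrans (esym (Im_form _ v)) (etrans (congr1 (@complex.Im R) (symD u v Bz))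
    (Im_form _ u)).
  apply: etrans (etrans E _); apply: eq_bigr => a _; by rewrite DbI.
pose eta z := e1 z +i* e2 z.
have DE v z : B z -> dirderiv v eta z = \sum_k zcoord v k * G k z.
  move=> Bz; apply: complex_eq.
  - by rewrite Re_form; exact: (He1 z Bz).2.
  - by rewrite Im_form; exact: (He2 z Bz).2.
have smooth_form v : smooth B (fun z => \sum_k zcoord v k * G k z).
  elim: (index_enum _) => [|k s IH].
    by under eq_fun do rewrite big_nil; exact: smooth_cst.
  under eq_fun do rewrite big_cons.
  by apply: smoothD => //; apply: smoothM => //; [exact: smooth_cst|have [] := holG k].
have sdx j z : \sum_k zcoord (dx R j) k * G k z = G j z.
  rewrite (bigD1 j) //= zcoord_dx eqxx mul1r big1 ?addr0 // => k kj.
  by rewrite zcoord_dx eq_sym (negbTE kj) mul0r.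
have sdy j z : \sum_k zcoord (dy R j) k * G k z = (0 +i* 1) * G j z.
  rewrite (bigD1 j) //= zcoord_dy eqxx mulr1 big1 ?addr0 // => k kj.
  by rewrite zcoord_dy eq_sym (negbTE kj) mulr0 mul0r.
exists eta; split; last first.
  move=> z Bz k; rewrite /dz !DE // sdx sdy mulrA mulii mulN1r opprK.
  by rewrite -mulr2n -[X in X / _]mulr_natr mulfK // pnatr_eq0.
split; last first.
  by move=> z Bz j; rewrite /dzbar !DE // sdx sdy mulrA mulii mulN1r subrr mul0r.
case=> [|n].
  by split=> z Bz; apply: differentiable_continuous; [exact: (He1 z Bz).1|exact: (He2 z Bz).1].
have CR v : Ck n B ('D_v e1).
  have [c1 _] := smooth_form v n; apply: Ck_eq c1 => // z Bz.
  by rewrite -DE.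
have CI v : Ck n B ('D_v e2).
  have [_ c2] := smooth_form v n; apply: Ck_eq c2 => // z Bz.
  by rewrite -DE.
split; (split; last by []) => z Bz; [exact: (He1 z Bz).1|exact: (He2 z Bz).1].
Qed.

End ComplexPoincare.

(** * Forms and products on basis vectors *)

Section LinearAlgebra.
Variables (K : comNzRingType) (m : nat).
Implicit Types (x y : 'rV[K]_m).

Lemma mulmx_delta_diag x (d : 'rV[K]_m) a : (x *m diag_mx d) 0 a = x 0 a * d 0 a.
Proof. by rewrite mul_mx_diag mxE. Qed.

Lemma sum_delta (a : 'I_m) (f : 'I_m -> K) : \sum_i (delta_mx 0 a : 'rV[K]_m) 0 i * f i = f a.
Proof.
rewrite (bigD1 a) //= mxE !eqxx mul1r big1 ?addr0 // => i ia.
by rewrite mxE (negbTE ia) andbF mul0r.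
Qed.

Lemma sum_deltaZ n k (a : 'I_m) (f : 'I_m -> 'M[K]_(n, k)) :
  \sum_i (delta_mx 0 a : 'rV[K]_m) 0 i *: f i = f a.
Proof.
rewrite (bigD1 a) //= mxE !eqxx scale1r big1 ?addr0 // => i ia.
by rewrite mxE (negbTE ia) andbF scale0r.
Qed.

End LinearAlgebra.

Section Pointwise.
Variables (R : realType) (m : nat).
Local Notation C := R[i].
Implicit Types (x y : 'rV[C]_m) (G : 'M[C]_m).

Lemma form_delta G a b : form_eval G (delta_mx 0 a) (delta_mx 0 b) = G a b.
Proof. by rewrite /form_eval trmx_delta -rowE -colE !mxE. Qed.

Lemma form_diag (d : 'rV[C]_m) x y : form_eval (diag_mx d) x y = \sum_a x 0 a * y 0 a * d 0 a.
Proof.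
rewrite /form_eval mxE; apply: eq_bigr => a _.
by rewrite mul_mx_diag !mxE mulrAC.
Qed.

Lemma product_delta (N : 'I_m -> 'I_m -> 'rV[C]_m) a b :
  product_eval N (delta_mx 0 a) (delta_mx 0 b) = N a b.
Proof.
rewrite /product_eval.
transitivity (\sum_i (delta_mx 0 a : 'rV[C]_m) 0 i *: (\sum_j (delta_mx 0 b : 'rV[C]_m) 0 j
  *: N i j)).
  by apply: eq_bigr => i _; rewrite scaler_sumr; apply: eq_bigr => j _; rewrite scalerA.
by rewrite sum_deltaZ sum_deltaZ.
Qed.

Lemma product_diag (N : 'I_m -> 'I_m -> 'rV[C]_m) x y :
  (forall a b, N a b = (a == b)%:R *: delta_mx 0 a) ->
  product_eval N x y = \row_a (x 0 a * y 0 a).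
Proof.
move=> NE; rewrite /product_eval [RHS]row_sum_delta; apply: eq_bigr => i _.
rewrite (bigD1 i) //= NE eqxx scale1r mxE big1 ?addr0 // => j ji.
by rewrite NE eq_sym (negbTE ji) scale0r scaler0.
Qed.

End Pointwise.

(** * Canonical coordinates *)

Section Canonical.
Variables (R : realType) (m : nat) (M : complex_manifold R m) (F : frobenius_data M).
Hypothesis frobF : is_frobenius_manifold F.
Local Notation C := R[i].
Local Notation chartM := (chart R m M).
Local Notation del a := (fun=> delta_mx 0 a).
Implicit Types (phi chi : chartM) (p q : M).

Lemma hol_delta phi (x : 'rV[C]_m) : holomorphic_section phi (fun=> x).
Proof. by move=> j; apply/hol_inE; exact: hol_in_cst. Qed.

Lemma pd_sectionE phi i (s : section M) p : pd_section phi i s p = pdd_mx phi (inl i) s p.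
Proof. by apply/rowP => k; rewrite !mxE. Qed.

Lemma pdbar_sectionE phi i (s : section M) p : pdbar_section phi i s p = pdd_mx phi (inr i) s p.
Proof. by apply/rowP => k; rewrite !mxE. Qed.

Lemma lieE phi (X : section M) f p : lie phi X f p = \sum_j X p 0 j * pdd phi (inl j) f p.
Proof. by []. Qed.

Lemma gnabla_delta phi i (Y : section M) p :
  gnabla F phi (del i) Y p = pdd_mx phi (inl i) Y p + Y p *m nabla F phi p i.
Proof. by rewrite /gnabla /cov_along sum_deltaZ /cov pd_sectionE. Qed.

Lemma lie_delta phi i f p : lie phi (del i) f p = pdd phi (inl i) f p.
Proof. by rewrite lieE sum_delta. Qed.

Lemma bracket_delta phi (X : section M) b p :
  bracket phi X (del b) p = - pdd_mx phi (inl b) X p.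
Proof.
apply/rowP => k; rewrite !mxE lie_delta lieE big1 ?sub0r // => j _.
by rewrite pdd_cst mulr0.
Qed.

Lemma bracket_eq phi (X Y Z : section M) p : dom phi p ->
  (forall q, dom phi q -> Y q = Z q) -> bracket phi X Y p = bracket phi X Z p.
Proof.
move=> dp YZ; apply/rowP => k; rewrite !mxE; congr (_ - _); rewrite !lieE.
  apply: eq_bigr => j _; congr (_ * _); apply: (pdd_eq _ (chart_open_dom phi)) => // q dq.
  by rewrite YZ.
by rewrite YZ.
Qed.

Lemma christoffel_sym phi p i j : atlas M phi -> dom phi p ->
  (delta_mx 0 j : 'rV[C]_m) *m nabla F phi p i = delta_mx 0 i *m nabla F phi p j.
Proof.
move=> aphi dp; have [_ [[_ LC] _ _ _ _] _] := frobF; have [_ tors _] := LC _ aphi.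
have := tors _ _ (hol_delta phi (delta_mx 0 i)) (hol_delta phi (delta_mx 0 j)) _ dp.
rewrite !gnabla_delta bracket_delta !pdd_mx_cst !add0r oppr0.
by move/eqP; rewrite subr_eq0 => /eqP.
Qed.

Lemma lie_metric phi p i (Y Z : section M) : atlas M phi -> dom phi p ->
  holomorphic_section phi Y -> holomorphic_section phi Z ->
  pdd phi (inl i) (gmetric F phi Y Z) p =
  form_eval (metric F phi p) (pdd_mx phi (inl i) Y p + Y p *m nabla F phi p i) (Z p) +
  form_eval (metric F phi p) (Y p) (pdd_mx phi (inl i) Z p + Z p *m nabla F phi p i).
Proof.
move=> aphi dp hY hZ; have [_ [[_ LC] _ _ _ _] _] := frobF; have [_ _ comp] := LC _ aphi.
have := comp _ _ _ (hol_delta phi (delta_mx 0 i)) hY hZ _ dp.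
by rewrite lie_delta /gmetric !gnabla_delta.
Qed.

Lemma unit_parallel phi p i : atlas M phi -> dom phi p ->
  pdd_mx phi (inl i) (unit_field F phi) p + unit_field F phi p *m nabla F phi p i = 0.
Proof.
move=> aphi dp; have [_ [_ _ _ uf _] _] := frobF.
by have := uf _ aphi _ (hol_delta phi (delta_mx 0 i)) _ dp; rewrite gnabla_delta.
Qed.

Variable chi : chartM.
Hypothesis canchi : canonical_coordinates F chi.
Let achi : atlas M chi := canchi.1.

(** The derivatives of a metric potential, but available before one is known
    to exist. *)
Definition diag_metric (a : 'I_m) : M -> C := fun q => metric F chi q a a.

Lemma canonical_product q x y : dom chi q ->
  product_eval (fproduct F chi q) x y = \row_a (x 0 a * y 0 a).
Proof.
by move=> dq; apply: product_diag => a b; have := canchi.2 _ dq a b; rewrite product_delta.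
Qed.

Lemma canonical_unit q : dom chi q -> unit_field F chi q = const_mx 1.
Proof.
move=> dq; have [[_ _ pa] _ _] := frobF; have [_ _ le] := pa _ achi _ dq.
apply/rowP => a; have /rowP /(_ a) := le (delta_mx 0 a).
by rewrite canonical_product // !mxE !eqxx mulr1.
Qed.

(** g(d_a, d_b) = g(d_a o d_a, d_b) = g(d_a, d_a o d_b), and d_a o d_b = 0
    for distinct a and b. *)
Lemma canonical_metric q : dom chi q ->
  metric F chi q = diag_mx (\row_a diag_metric a q).
Proof.
move=> dq; apply/matrixP => a b; rewrite !mxE.
case: eqP => [->|/eqP ab]; first by rewrite mulr1n.
have [_ [_ _ mi _ _] _] := frobF.
have := mi _ achi _ dq (delta_mx 0 a) (delta_mx 0 a) (delta_mx 0 b).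
rewrite !(canchi.2 _ dq) eqxx (negbTE ab) scale1r scale0r form_delta => ->.
by rewrite /form_eval trmx0 mulmx0 mxE mulr0n.
Qed.

Lemma canonical_form_eval q x y : dom chi q ->
  form_eval (metric F chi q) x y = \sum_a x 0 a * y 0 a * diag_metric a q.
Proof.
by move=> dq; rewrite canonical_metric // form_diag; apply: eq_bigr => a _; rewrite mxE.
Qed.

Lemma diag_metric_neq0 q a : dom chi q -> diag_metric a q != 0.
Proof.
move=> dq; have [[_ ma _] _ _] := frobF; have [_] := ma _ achi _ dq.
rewrite canonical_metric // unitmxE det_diag unitfE; apply: contraNneq => e0.
by rewrite (bigD1 a) //= mxE e0 mul0r.
Qed.

Lemma diag_metric_hol a : hol_in chi (dom chi) (diag_metric a).
Proof.
by have [[[_ hs] _ _] _ _] := frobF; have [hm _ _ _] := hs _ achi; apply/hol_inE; exact: hm.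
Qed.

Let hol_unit : holomorphic_section chi (unit_field F chi).
Proof. by have [[[_ hs] _ _] _ _] := frobF; have [_ _ hu _] := hs _ achi. Qed.

(** g_bb = g(e, d_b) since d_b o e = d_b. As e is parallel, the derivative
    along d_a is g(e, nabla_a d_b), and nabla_a d_b = nabla_b d_a because nabla
    has no torsion. *)
Lemma diag_metric_closed a b q : dom chi q ->
  pdd chi (inl a) (diag_metric b) q = pdd chi (inl b) (diag_metric a) q.
Proof.
move=> dq.
have E c d : pdd chi (inl c) (diag_metric d) q =
    form_eval (metric F chi q) (unit_field F chi q) (delta_mx 0 d *m nabla F chi q c).
  rewrite -(@pdd_eq _ _ _ _ (dom chi) _ (gmetric F chi (unit_field F chi) (del d))) //;
    first last.
  - move=> r dr; rewrite /gmetric canonical_form_eval // canonical_unit //.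
    rewrite (bigD1 d) //= !mxE !eqxx !mul1r big1 ?addr0 // => i id.
    by rewrite !mxE (negbTE id) mulr0 mul0r.
  - exact: chart_open_dom.
  rewrite lie_metric //; last exact: hol_delta.
  by rewrite unit_parallel // pdd_mx_cst add0r /form_eval !mul0mx mxE add0r.
by rewrite !E christoffel_sym.
Qed.

(** The unit field e = \sum_c d_c has constant components, so
    nabla_e d_a = nabla_a e = 0. *)
Lemma unit_christoffel a q : dom chi q ->
  \sum_c (delta_mx 0 a : 'rV[C]_m) *m nabla F chi q c = 0.
Proof.
move=> dq; have := unit_parallel a achi dq.
rewrite (@pdd_mx_eq _ _ _ _ (dom chi) _ _ _ _ (fun=> const_mx 1)) //; first last.
- by move=> r dr; rewrite canonical_unit.
- exact: chart_open_dom.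
rewrite pdd_mx_cst add0r canonical_unit // => E.
transitivity (\sum_c (delta_mx 0 c : 'rV[C]_m) *m nabla F chi q a).
  by apply: eq_bigr => c _; rewrite christoffel_sym.
rewrite -mulmx_suml -[RHS]E; congr (_ *m _).
by rewrite [RHS]row_sum_delta; apply: eq_bigr => c _; rewrite mxE scale1r.
Qed.

(** e(g(d_a, d_a)) = 2 g(nabla_e d_a, d_a). *)
Lemma unit_diag_metric a q : dom chi q -> \sum_b pdd chi (inl b) (diag_metric a) q = 0.
Proof.
move=> dq.
pose G := metric F chi q; pose d : 'rV[C]_m := delta_mx 0 a.
have E b : pdd chi (inl b) (diag_metric a) q =
   (d *m nabla F chi q b *m (G *m (d)^T)) 0 0 +
   ((d *m G) *m (d *m nabla F chi q b)^T) 0 0.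
  rewrite -(@pdd_eq _ _ _ _ (dom chi) _ (gmetric F chi (del a) (del a))) //; first last.
  - by move=> r dr; rewrite /gmetric form_delta.
  - exact: chart_open_dom.
  rewrite lie_metric //; try exact: hol_delta.
  by rewrite !pdd_mx_cst !add0r /form_eval !mulmxA.
under eq_bigr do rewrite E.
rewrite big_split /=.
have := unit_christoffel a dq => U.
have -> : \sum_b (d *m nabla F chi q b *m (G *m (d)^T)) 0 0 =
   ((\sum_b d *m nabla F chi q b) *m (G *m (d)^T)) 0 0.
  by rewrite mulmx_suml summxE.
have -> : \sum_b ((d *m G) *m (d *m nabla F chi q b)^T) 0 0 =
   ((d *m G) *m (\sum_b d *m nabla F chi q b)^T) 0 0.
  by rewrite linear_sum mulmx_sumr summxE.
by rewrite U trmx0 mulmx0 mul0mx !mxE addr0.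
Qed.

(** In components, L_E(o) = o applied to d_a o d_a reads
    v_c - 2 v_c delta_ac = delta_ac for v = [E, d_a]. Hence [E, d_a] = - d_a. *)
Lemma euler_canonical a q : dom chi q ->
  pdd_mx chi (inl a) (euler F chi) q = delta_mx 0 a.
Proof.
move=> dq; have [_ _ [_ ep _]] := frobF.
have /= := ep _ achi _ _ (hol_delta chi (delta_mx 0 a)) (hol_delta chi (delta_mx 0 a)) _ dq.
rewrite (@bracket_eq _ _ (gprod F chi (del a) (del a)) (del a)) //; last first.
  by move=> r dr; rewrite /gprod (canchi.2 _ dr) eqxx scale1r.
rewrite /gprod !bracket_delta (canchi.2 _ dq) eqxx scale1r !canonical_product //.
move: (pdd_mx _ _ _ _) => L /rowP E; apply/rowP => c.
have := E c; rewrite !mxE /=; case: (c =P a) => [->|_] /=; last first.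
  by rewrite mulr0 mul0r !subr0 => /eqP; rewrite oppr_eq0 => /eqP.
by rewrite mulr1 mul1r opprK addNr add0r.
Qed.

(** Since [E, d_a] = - d_a, the equation L_E(g) = (2 - d) g on (d_a, d_a)
    is E(g_aa) + 2 g_aa = (2 - d) g_aa. *)
Lemma euler_diag_metric a q : dom chi q ->
  \sum_b euler F chi q 0 b * pdd chi (inl b) (diag_metric a) q = - conf_dim F * diag_metric a q.
Proof.
move=> dq; have [_ _ [_ _ em]] := frobF.
have /= := em _ achi _ _ (hol_delta chi (delta_mx 0 a)) (hol_delta chi (delta_mx 0 a)) _ dq.
have -> : gmetric F chi (del a) (del a) = diag_metric a.
  by apply/funext => r; rewrite /gmetric form_delta.
rewrite /gmetric !bracket_delta euler_canonical //.
have -> : form_eval (metric F chi q) (- delta_mx 0 a) (delta_mx 0 a) = - diag_metric a q.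
  by rewrite /form_eval !mulNmx mxE -[X in - X]/(form_eval _ _ _) form_delta.
have -> : form_eval (metric F chi q) (delta_mx 0 a) (- delta_mx 0 a) = - diag_metric a q.
  by rewrite /form_eval linearN /= mulmxN mxE -[X in - X]/(form_eval _ _ _) form_delta.
rewrite lieE => E.
apply: (addIr (diag_metric a q + diag_metric a q)); rewrite !opprK -addrA in E; rewrite E.
ring.
Qed.

End Canonical.

(** * Existence of metric potentials *)

Section Restriction.
Variables (R : realType) (m : nat) (M : topologicalType).
Local Notation chartM := (chart R m M).
Variables (phi : chartM) (B : set (Cspace R m)).
Hypothesis oB : open B.
Hypothesis sB : B `<=` cmap phi @` dom phi.

Let rdom : set M := dom phi `&` cmap phi @^-1` B.

Let rcod : cmap phi @` rdom = B.
Proof.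
apply/seteqP; split=> [z [p [_ Bp] <-]//|z Bz].
by have [p dp E] := sB Bz; exists p => //; split=> //=; rewrite E.
Qed.

Let open_rdom : open rdom.
Proof.
rewrite openE => p [dp Bp].
have n1 : nbhs p (dom phi) by apply: open_nbhs_nbhs; split=> //; exact: open_dom.
have n2 : nbhs p (cmap phi @^-1` B).
  by apply: (cmap_continuous dp); exact: open_nbhs_nbhs.
exact: filterI n1 n2.
Qed.

Let open_rcod : open (cmap phi @` rdom).
Proof. by rewrite rcod. Qed.

Let rK p : rdom p -> cinv phi (cmap phi p) = p.
Proof. by move=> [dp _]; exact: cmapK. Qed.

Let r_continuous p : rdom p -> {for p, continuous (cmap phi)}.
Proof. by move=> [dp _]; exact: cmap_continuous. Qed.

Let rinv_continuous z : (cmap phi @` rdom) z -> {for z, continuous (cinv phi)}.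
Proof. by rewrite rcod => /sB; exact: cinv_continuous. Qed.

Definition chart_restrict : chartM :=
  Chart open_rdom open_rcod rK r_continuous rinv_continuous.

Lemma chart_restrict_cod : cmap phi @` dom chart_restrict = B.
Proof. exact: rcod. Qed.

End Restriction.

Section Potential.
Variables (R : realType) (m : nat) (M : complex_manifold R m) (F : frobenius_data M).
Hypothesis frobF : is_frobenius_manifold F.
Local Notation C := R[i].
Local Notation V := (Cspace R m).
Local Notation chartM := (chart R m M).

Lemma holomorphic_map_sub (O O' : set V) (f : V -> V) : O' `<=` O ->
  holomorphic_map O f -> holomorphic_map O' f.
Proof.
move=> sO hf k; have [sf hk] := hf k; split; first exact: smooth_sub sf.
by move=> z /sO; exact: hk.
Qed.

(** Compatibility with the charts of the atlas passes to subsets, so this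
    follows from maximality. *)
Lemma atlas_restrict (phi : chartM) (B : set V) (oB : open B) (sB : B `<=` cmap phi @` dom
  phi) :
  atlas M phi -> atlas M (chart_restrict oB sB).
Proof.
move=> aphi; apply: atlas_maximal => psi apsi; have [h1 h2] := atlas_compatible aphi apsi.
split.
- apply: holomorphic_map_sub h1; apply: image_subset => p [[dp _] dq].
  by split.
- apply: holomorphic_map_sub h2; apply: image_subset => p [[dp _] dq].
  by split.
Qed.

Lemma canonical_restrict (phi : chartM) (B : set V) (oB : open B) (sB : B `<=` cmap phi @`
  dom phi) :
  canonical_coordinates F phi -> canonical_coordinates F (chart_restrict oB sB).
Proof.
move=> [aphi can]; have achi := atlas_restrict oB sB aphi; split=> // p dp a b.
have dphi : dom phi p by case: dp.
have [[[[_ pl _ _] _] _ _] _ _] := frobF.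
have := pl _ _ _ aphi achi dphi dp (delta_mx 0 a) (delta_mx 0 b).
rewrite (@jac_same _ _ _ phi) //; last exact: chart_open_dom.
by rewrite !mulmx1 => <-; exact: can.
Qed.

(** A closed form has a primitive on a ball. The image of a canonical chart
    contains a ball around each of its points, and restricting the chart to it
    gives a chart that is still canonical. *)
Lemma local_potential (phi : chartM) p : canonical_coordinates F phi -> dom phi p ->
  exists chi, [/\ canonical_coordinates F chi, dom chi p & exists eta, metric_potential F chi
    eta].
Proof.
move=> can dp; have [aphi _] := can.
pose z0 := cmap phi p.
have cz : (cmap phi @` dom phi) z0 by exists p.
have /nbhs_normP [r /= r0 sr] := open_nbhs_nbhs (conj (@open_cod _ _ _ phi) cz).
pose B : set V := [set z | `|z - z0| < r].
have oB : open B by exact: open_normball.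
have sB : B `<=` cmap phi @` dom phi.
  by move=> z Bz; apply: sr; rewrite /ball_ /= distrC.
pose chi := chart_restrict oB sB.
have canchi : canonical_coordinates F chi by exact: canonical_restrict.
have dchi : dom chi p by split=> //; rewrite /B /= subrr normr0.
have codE : cmap chi @` dom chi = B by exact: chart_restrict_cod.
have holG k : holomorphic B (diag_metric F chi k \o cinv chi).
  by rewrite -codE; apply/hol_inE; exact: diag_metric_hol.
have symG j k z : B z -> dz j (diag_metric F chi k \o cinv chi) z =
  dz k (diag_metric F chi j \o cinv chi) z.
  by rewrite -codE => -[q dq <-]; exact: (diag_metric_closed frobF canchi).
have [eta [heta deta]] := complex_poincare holG symG.
have etaE z : B z -> (eta \o cmap chi \o cinv chi) z = eta z.
  by rewrite -codE => -[q dq <-] /=; rewrite (@cmapK _ _ _ chi).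
exists chi; split=> //; exists (eta \o cmap chi); split.
  rewrite /holomorphic_on codE; have [se he] := heta; split.
    by apply: smooth_eq se => // z Bz; rewrite -etaE.
  move=> z Bz j; rewrite -[RHS](he z Bz j); apply: (dw_near (inr j)).
  by apply: filterS (open_nbhs_nbhs (conj oB Bz)) => w; exact: etaE.
move=> q dq a; rewrite form_delta.
have Bq : B (cmap chi q) by rewrite -codE; exists q.
transitivity (dz a eta (cmap chi q)); first by rewrite deta //= (@cmapK _ _ _ chi).
apply: (dw_near (inl a)).
by apply: filterS (open_nbhs_nbhs (conj oB Bq)) => w Bw; rewrite -etaE.
Qed.

End Potential.

(** * The canonical frame in an arbitrary chart *)

(** The chart phi is arbitrary and chi is canonical. Derivatives are taken in
    phi, but components of vectors are read in the frame of chi, by multiplying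
    by the Jacobian matrix P. *)
Section Frame.
Variables (R : realType) (m : nat) (M : complex_manifold R m) (F : frobenius_data M).
Hypothesis frobF : is_frobenius_manifold F.
Local Notation C := R[i].
Local Notation chartM := (chart R m M).
Variables phi chi : chartM.
Hypothesis aphi : atlas M phi.
Hypothesis canchi : canonical_coordinates F chi.
Let achi : atlas M chi := canchi.1.
Implicit Types (p q : M) (f g : M -> C) (s t : section M).

Let W := overlap phi chi.
Let P := jac phi chi.
Let eta := diag_metric F chi.

Let pW : chart_open phi W := chart_open_overlap phi chi.

Lemma frame_unitmx q : W q -> P q \in unitmx.
Proof. exact: jac_unit. Qed.

Lemma frame_inj q (x y : 'rV[C]_m) : W q -> x *m P q = y *m P q -> x = y.
Proof. by move=> Wq E; rewrite -[x](mulmxK (frame_unitmx Wq)) E mulmxK // frame_unitmx. Qed.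

Lemma frame_product q x y : W q ->
  product_eval (fproduct F phi q) x y *m P q = \row_a ((x *m P q) 0 a * (y *m P q) 0 a).
Proof.
move=> Wq; have [d1 d2] := Wq; have [[[[_ pl _ _] _] _ _] _ _] := frobF.
by rewrite (pl _ _ _ aphi achi d1 d2) canonical_product.
Qed.

Lemma frame_form q x y : W q ->
  form_eval (metric F phi q) x y = \sum_a (x *m P q) 0 a * (y *m P q) 0 a * eta a q.
Proof.
move=> Wq; have [d1 d2] := Wq; have [[[[fl _ _ _] _] _ _] _ _] := frobF.
by rewrite (fl _ _ _ aphi achi d1 d2) canonical_form_eval.
Qed.

Lemma frame_euler q : W q -> euler F phi q *m P q = euler F chi q.
Proof.
move=> Wq; have [d1 d2] := Wq; have [[[[_ _ _ el] _] _ _] _ _] := frobF.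
by rewrite (el _ _ _ aphi achi d1 d2).
Qed.

Lemma frame_unit q : W q -> unit_field F phi q *m P q = const_mx 1.
Proof.
move=> Wq; have [d1 d2] := Wq; have [[[[_ _ ul _] _] _ _] _ _] := frobF.
by rewrite -(ul _ _ _ aphi achi d1 d2) canonical_unit.
Qed.

Lemma frame_eta_neq0 q a : W q -> eta a q != 0.
Proof. by move=> [_ dq]; exact: diag_metric_neq0. Qed.

Lemma frame_hol : hol_mx phi W P.
Proof. exact: hol_mx_jac. Qed.

Lemma frame_inv_hol : hol_mx phi W (fun q => invmx (P q)).
Proof. by apply: hol_mx_inv => //; [exact: frame_unitmx|exact: frame_hol]. Qed.

(** eta a is the value of the metric on a vector of the canonical frame,
    whose components in phi are a row of the inverse Jacobian matrix. *)
Lemma frame_eta_hol a : hol_in phi W (eta a).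
Proof.
have hr : hol_mx phi W (fun q => row a (invmx (P q))).
  by move=> i j; under eq_fun do rewrite mxE; exact: frame_inv_hol.
have hc : hol_mx phi W (fun q => (row a (invmx (P q)))^T).
  by move=> i j; under eq_fun do rewrite mxE; exact: hr.
have hg : hol_mx phi W (metric F phi).
  move=> i j; have [[[_ hs] _ _] _ _] := frobF; have [hm _ _ _] := hs _ aphi.
  by apply: (@hol_in_sub _ _ _ _ (dom phi)); [move=> q []|apply/hol_inE; exact: hm].
have h := hol_mxM pW (hol_mxM pW hr hg) hc.
apply: hol_in_eq (h 0 0) => // q Wq.
rewrite -[LHS]/(form_eval _ _ _) frame_form // -row_mul mulVmx ?frame_unitmx //.
rewrite (bigD1 a) //= !mxE eqxx !mul1r big1 ?addr0 // => b ba.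
by rewrite !mxE eq_sym (negbTE ba) mul0r mul0r.
Qed.

(** The components of E in canonical coordinates have the derivatives
    delta_ab there, and the chain rule turns these into Jacobian entries. *)
Lemma frame_euler_deriv q i a : W q ->
  pdd phi (inl i) (fun r => (euler F phi r *m P r) 0 a) q = P q i a.
Proof.
move=> Wq; have [d1 d2] := Wq.
rewrite (@pdd_eq _ _ _ _ W _ _ (fun r => euler F chi r 0 a)) //; last first.
  by move=> r Wr; rewrite frame_euler.
have he : hol_in chi (dom chi) (fun r => euler F chi r 0 a).
  have [[[_ hs] _ _] _ _] := frobF; have [_ _ _ hE] := hs _ achi.
  by apply/hol_inE; exact: hE.
rewrite (pd_chain i aphi achi Wq (smooth_in_cdiff he.1 d2)).
have hE b : pdd chi (inl b) (fun r => euler F chi r 0 a) q = (a == b)%:R.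
  have /rowP /(_ a) := euler_canonical frobF canchi b d2.
  by rewrite mxE => ->; rewrite mxE eqxx.
rewrite (bigD1 a) // hE eqxx mulr1 big1; first exact: addr0.
by move=> b ba; rewrite hE eq_sym (negbTE ba) mulr0.
Qed.

Lemma frame_vector_eta q (x : 'rV[C]_m) a : W q ->
  \sum_i x 0 i * pdd phi (inl i) (eta a) q =
  \sum_k (x *m P q) 0 k * pdd chi (inl k) (eta a) q.
Proof.
move=> Wq; have [d1 d2] := Wq.
have he := diag_metric_hol frobF canchi a.
transitivity (\sum_i \sum_k x 0 i * (P q i k * pdd chi (inl k) (eta a) q)).
  apply: eq_bigr => i _; rewrite (pd_chain i aphi achi Wq (smooth_in_cdiff he.1 d2)).
  by rewrite mulr_sumr.
rewrite exchange_big; apply: eq_bigr => k _; rewrite mxE mulr_suml.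
by apply: eq_bigr => i _; rewrite mulrA.
Qed.

Lemma frame_euler_eta q a : W q ->
  \sum_i euler F phi q 0 i * pdd phi (inl i) (eta a) q = - conf_dim F * eta a q.
Proof. by move=> Wq; rewrite frame_vector_eta // frame_euler // euler_diag_metric //;
  case: Wq. Qed.

Lemma frame_unit_eta q a : W q ->
  \sum_i unit_field F phi q 0 i * pdd phi (inl i) (eta a) q = 0.
Proof.
move=> Wq; rewrite frame_vector_eta // frame_unit // -[RHS](unit_diag_metric frobF canchi a
  Wq.2).
by apply: eq_bigr => k _; rewrite mxE mul1r.
Qed.

(** Half the logarithmic derivative of eta a: in the canonical frame, the
    Chern connection is diagonal with these coefficients of dz_i. *)
Definition chern_coef (i : 'I_m) (a : 'I_m) : M -> C :=
  fun q => pdd phi (inl i) (eta a) q / (2 * eta a q).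

Lemma chern_coef_hol i a : hol_in phi W (chern_coef i a).
Proof.
apply: hol_inM => //; first by apply: hol_in_pd => //; exact: frame_eta_hol.
apply: hol_inV => //; first by move=> q Wq; rewrite mulf_neq0 ?pnatr_eq0 // frame_eta_neq0.
by apply: hol_inM => //; [exact: hol_in_cst|exact: frame_eta_hol].
Qed.

Lemma norm_eta_smooth a : smooth_in phi W (fun q => `|eta a q|).
Proof.
by apply: smooth_in_norm => //; [move=> q; exact: frame_eta_neq0|have [] := frame_eta_hol a].
Qed.

Lemma half_solve (x n e eb : C) : n != 0 -> e != 0 -> n ^+ 2 = e * eb ->
  forall y, y * n + n * y = x * eb -> y = x / (2 * e) * n.
Proof.
move=> n0 e0 ne y E; have n2 : 2 * n != 0 :> C by rewrite mulf_neq0 ?pnatr_eq0.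
have eb_ : eb = n ^+ 2 / e by rewrite ne mulrAC mulfV ?mul1r.
apply: (mulfI n2); transitivity (y * n + n * y); first by ring.
by rewrite E eb_; field.
Qed.

(** Differentiate |eta|^2 = eta * conj eta, where conj eta is antiholomorphic. *)
Lemma pd_norm_eta q i a : W q ->
  pdd phi (inl i) (fun r => `|eta a r|) q = chern_coef i a q * `|eta a q|.
Proof.
move=> Wq; have sn := norm_eta_smooth a; have [se he] := frame_eta_hol a.
have e0 := frame_eta_neq0 a Wq.
apply: (@half_solve _ _ _ (conjc (eta a q))) => //; first by rewrite normr_eq0.
  exact: sqr_normc.
have <- : pdd phi (inl i) (fun r => `|eta a r| * `|eta a r|) q =
   pdd phi (inl i) (eta a) q * conjc (eta a q).
  rewrite (@pdd_eq _ _ _ _ W _ _ (fun r => eta a r * conjc (eta a r))) //; last first.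
    by move=> r _; rewrite -expr2 sqr_normc.
  have sj := smooth_inJ pW se.
  by rewrite (pddM _ pW se sj Wq) (pddJ _ se Wq) he // conjc0 mulr0 addr0.
by rewrite (pddM _ pW sn sn Wq).
Qed.

(** |eta| is real, so its two derivatives are conjugate to each other. *)
Lemma pdbar_norm_eta q i a : W q ->
  pdd phi (inr i) (fun r => `|eta a r|) q = conjc (chern_coef i a q) * `|eta a q|.
Proof.
move=> Wq; have sn := norm_eta_smooth a.
rewrite (@pdd_eq _ _ _ _ W _ _ (fun r => conjc `|eta a r|)) //; last first.
  by move=> r _; rewrite normc_def conjc_real.
rewrite (pddJ _ sn Wq) pd_norm_eta //.
transitivity (conjc (chern_coef i a q) * conjc `|eta a q|); first exact: rmorphM.
by congr (_ * _); rewrite normc_def conjc_real.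
Qed.

(** In the canonical frame, kappa conjugates the components of a vector and
    multiplies them by these functions. *)
Definition kappa_coef (a : 'I_m) : M -> C := fun q => `|eta a q| / eta a q.

Lemma kappa_coef_smooth a : smooth_in phi W (kappa_coef a).
Proof.
have [se he] := frame_eta_hol a; apply: smooth_inM => //; first exact: norm_eta_smooth.
by apply: smooth_inV => // q; exact: frame_eta_neq0.
Qed.

Lemma kappa_coef_unimodular q a : W q -> conjc (kappa_coef a q) * kappa_coef a q = 1.
Proof.
move=> Wq; have e0 := frame_eta_neq0 a Wq.
rewrite mulrC -sqr_normc /kappa_coef normf_div normr_id divff ?normr_eq0 //.
by rewrite expr1n.
Qed.

Lemma pd_kappa_coef q i a : W q -> pdd phi (inl i) (kappa_coef a) q =
  - (chern_coef i a q * kappa_coef a q).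
Proof.
move=> Wq; have [se he] := frame_eta_hol a; have e0 := frame_eta_neq0 a Wq.
have nz r : W r -> eta a r != 0 by exact: frame_eta_neq0.
rewrite (pddM _ pW (norm_eta_smooth a) (smooth_inV pW nz se) Wq).
rewrite pd_norm_eta // (pddV _ pW nz se Wq) /kappa_coef /chern_coef.
move: (pdd _ _ _ _) (`|eta a q|) (eta a q) e0 => d n e e0.
by field.
Qed.

Lemma pdbar_kappa_coef q i a : W q -> pdd phi (inr i) (kappa_coef a) q =
  conjc (chern_coef i a q) * kappa_coef a q.
Proof.
move=> Wq; have [se he] := frame_eta_hol a; have e0 := frame_eta_neq0 a Wq.
have nz r : W r -> eta a r != 0 by exact: frame_eta_neq0.
rewrite (pddM _ pW (norm_eta_smooth a) (smooth_inV pW nz se) Wq).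
by rewrite pdbar_norm_eta // (pddV _ pW nz se Wq) he // oppr0 mul0r mulr0 addr0 mulrA.
Qed.

End Frame.

(** * Chern connection, involution and metric in the canonical frame *)

Section DiagonalOperators.
Variables (R : realType) (m : nat) (M : complex_manifold R m) (F : frobenius_data M).
Variable K : antilinear_endo M.
Hypothesis frobF : is_frobenius_manifold F.
Hypothesis canK : canonical_kappa F K.
Local Notation C := R[i].
Local Notation chartM := (chart R m M).
Variables phi chi : chartM.
Hypothesis aphi : atlas M phi.
Hypothesis canchi : canonical_coordinates F chi.
Hypothesis potchi : exists e, metric_potential F chi e.
Let achi : atlas M chi := canchi.1.
Implicit Types (p q : M) (f g : M -> C) (s t : section M) (L : op M) (a b : 'I_m + 'I_m).

Let W := overlap phi chi.
Let P := jac phi chi.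
Let eta := diag_metric F chi.
Let lm := chern_coef F phi chi.
Let kp := kappa_coef F chi.
Let pW : chart_open phi W := chart_open_overlap phi chi.
Let Pu q : W q -> P q \in unitmx.
Proof. by move=> Wq; exact: jac_unit. Qed.
Let hP : hol_mx phi W P.
Proof. exact: hol_mx_jac. Qed.
Let sP : smooth_mx phi W P := hol_mx_smooth hP.
Let sPV : smooth_mx phi W (fun q => invmx (P q)).
Proof. exact: smooth_mx_inv. Qed.
Let injP q (x y : 'rV[C]_m) : W q -> x *m P q = y *m P q -> x = y.
Proof. by move=> Wq; exact: (frame_inj aphi canchi Wq). Qed.

Let addE (A B : 'rV[C]_m) x : (A + B) 0 x = A 0 x + B 0 x.
Proof. by rewrite mxE. Qed.

Let oppE (A : 'rV[C]_m) x : (- A) 0 x = - A 0 x.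
Proof. by rewrite mxE. Qed.

Let eta0 q x : W q -> eta x q != 0.
Proof. by move=> [_ dq]; exact: (diag_metric_neq0 frobF canchi). Qed.

Lemma canonical_K q : dom chi q -> K chi q = diag_mx (\row_a kp a q).
Proof.
move=> dq; have [e he] := potchi; have [_ Kc] := canK; rewrite (Kc _ _ canchi he _ dq).
congr diag_mx; apply/rowP => a; rewrite !mxE.
by have [_ /(_ _ dq a)] := he; rewrite form_delta => <-.
Qed.

Lemma frame_kappa q (x : 'rV[C]_m) : W q ->
  antilinear_eval (K phi q) x *m P q = \row_a (conjc ((x *m P q) 0 a) * kp a q).
Proof.
move=> Wq; have [d1 d2] := Wq; have [Kl _] := canK.
rewrite (Kl _ _ _ aphi achi d1 d2) canonical_K // /antilinear_eval.
by apply/rowP => a; rewrite mulmx_delta_diag !mxE.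
Qed.

Lemma frame_h q x y : W q -> hform F K phi q x y =
  \sum_a (x *m P q) 0 a * conjc ((y *m P q) 0 a) * `|eta a q|.
Proof.
move=> Wq; rewrite /hform (frame_form frobF aphi canchi) //; apply: eq_bigr => a _.
rewrite /kappa_map frame_kappa // mxE -!mulrA; congr (_ * (_ * _)).
by rewrite mulVf ?mulr1 //; exact: eta0.
Qed.

Lemma frame_K q : W q -> K phi q *m P q = map_mx conjc (P q) *m diag_mx (\row_a kp a q).
Proof.
move=> Wq; apply/row_matrixP => b; rewrite !row_mul.
have := frame_kappa (delta_mx 0 b) Wq; rewrite /antilinear_eval.
have -> : map_mx conjc (delta_mx 0 b : 'rV[C]_m) = delta_mx 0 b.
  by apply/rowP => a; rewrite !mxE conjc_nat.
rewrite -rowE => ->; apply/rowP => a.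
by rewrite mulmx_delta_diag -rowE !mxE.
Qed.

Lemma smooth_mx_diag (d : 'I_m -> M -> C) : (forall x, smooth_in phi W (d x)) ->
  smooth_mx phi W (fun q => diag_mx (\row_x d x q)).
Proof.
move=> sd i j; under eq_fun do rewrite !mxE.
by case: (i == j); [exact: sd|exact: smooth_in_cst].
Qed.

Lemma hol_mx_diag (d : 'I_m -> M -> C) : (forall x, hol_in phi W (d x)) ->
  hol_mx phi W (fun q => diag_mx (\row_x d x q)).
Proof.
move=> sd i j; under eq_fun do rewrite !mxE.
by case: (i == j); [exact: sd|exact: hol_in_cst].
Qed.

Lemma frame_K_smooth : smooth_mx phi W (K phi).
Proof.
have sk : smooth_mx phi W (fun q => diag_mx (\row_a kp a q)).
  by apply: smooth_mx_diag => a; exact: kappa_coef_smooth.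
apply: (@smooth_mx_eq _ _ _ _ _ _ _ (fun q =>
  map_mx conjc (P q) *m diag_mx (\row_a kp a q) *m invmx (P q))) => //.
  by move=> q Wq; rewrite -frame_K // mulmxK // Pu.
by do 2![apply: smooth_mxM => //]; exact: smooth_mx_map_conj.
Qed.

Let D q := diag_mx (\row_a `|eta a q|).
Let Lm i q := diag_mx (\row_a lm i a q).
Let Pc q := (map_mx conjc (P q))^T.

Let PcE x y q : Pc q x y = conjc (P q y x).
Proof. by rewrite /Pc mxE mxE. Qed.

Lemma frame_hmatrix q : W q -> hmatrix F K phi q = P q *m D q *m Pc q.
Proof.
move=> Wq; apply/matrixP => a b; rewrite mxE frame_h // [RHS]mxE.
by apply: eq_bigr => c _; rewrite -!rowE mul_mx_diag !mxE mulrAC.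
Qed.

Lemma hmatrix_unit q : W q -> hmatrix F K phi q \in unitmx.
Proof.
move=> Wq; rewrite frame_hmatrix // !unitmx_mul unitmx_tr map_unitmx Pu // andbT /=.
rewrite unitmxE det_diag unitfE prodf_seq_neq0; apply/allP => a _ /=.
by rewrite mxE normr_eq0; exact: eta0.
Qed.

Lemma sD : smooth_mx phi W D.
Proof. by apply: smooth_mx_diag => a; exact: norm_eta_smooth. Qed.

Lemma sPc : smooth_mx phi W Pc.
Proof. by move=> i j; under eq_fun do rewrite PcE; apply: smooth_inJ => //; exact: sP. Qed.

Lemma pd_D i q : W q -> pdd_mx phi (inl i) D q = Lm i q *m D q.
Proof.
move=> Wq; apply/matrixP => x y; rewrite mul_diag_mx.
rewrite [LHS]mxE [RHS]mxE.
have [->|xy] := eqVneq x y.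
  have -> : (fun r => D r y y) = (fun r => `|eta y r|).
    by apply/funext => r; rewrite !mxE eqxx mulr1n.
  by rewrite pd_norm_eta // !mxE eqxx mulr1n.
have -> : (fun r => D r x y) = (fun=> 0).
  by apply/funext => r; rewrite !mxE (negbTE xy) mulr0n.
by rewrite pdd_cst !mxE (negbTE xy) mulr0n mulr0.
Qed.

Lemma pd_Pc i q : W q -> pdd_mx phi (inl i) Pc q = 0.
Proof.
move=> Wq; apply/matrixP => x y; rewrite [LHS]mxE [RHS]mxE.
under [X in pdd _ _ X]eq_fun do rewrite PcE.
have [_ hb] := hP y x.
by apply: etrans (pddJ _ (sP y x) Wq) _; rewrite hb // conjc0.
Qed.

Let chern_algebra (A P0 L D0 Q0 : 'M[C]_m) : P0 \in unitmx ->
  (A *m D0 + P0 *m (L *m D0)) *m Q0 = (A + P0 *m L) *m invmx P0 *m (P0 *m D0 *m Q0).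
Proof. by move=> u; rewrite !mulmxA mulmxKV // !mulmxDl. Qed.

(** The matrix of h is P D P^* with D the diagonal matrix of the |eta a|. As P
    is holomorphic, (1,0)-derivatives act on the first two factors only, and
    dh * h^-1 = (dP + P Lambda) P^-1 where dD = Lambda D. *)
Lemma frame_omega i q : W q ->
  omega F K phi i q *m P q = pdd_mx phi (inl i) P q + P q *m Lm i q.
Proof.
move=> Wq; rewrite /omega.
have -> : pd_mx phi i (hmatrix F K phi) q =
   (pdd_mx phi (inl i) P q + P q *m Lm i q) *m invmx (P q) *m hmatrix F K phi q.
  rewrite -[LHS]/(pdd_mx phi (inl i) (hmatrix F K phi) q).
  rewrite (@pdd_mx_eq _ _ _ _ W _ _ _ _ (fun r => P r *m D r *m Pc r)) //; last first.
    by move=> r Wr; rewrite frame_hmatrix.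
  rewrite (pdd_mxM _ pW (smooth_mxM pW sP sD) sPc Wq) (pdd_mxM _ pW sP sD Wq) pd_Pc // pd_D //.
  rewrite mulmx0 addr0 frame_hmatrix //.
  by apply: chern_algebra; exact: Pu.
by rewrite mulmxK ?hmatrix_unit // mulmxKV // Pu.
Qed.

Lemma frame_omega_hol i : hol_mx phi W (omega F K phi i).
Proof.
apply: (@hol_mx_eq _ _ _ _ _ _ _ (fun q =>
  (pdd_mx phi (inl i) P q + P q *m Lm i q) *m invmx (P q))) => //.
  by move=> q Wq; rewrite -frame_omega // mulmxK // Pu.
apply: hol_mxM => //; last exact: hol_mx_inv.
apply: (hol_mxD pW).
  by move=> j k; under eq_fun do rewrite mxE; apply: (hol_in_pd _ pW); exact: hP.
apply: (hol_mxM pW hP); apply: hol_mx_diag => x; exact: chern_coef_hol.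
Qed.

Definition chern : connection M := fun psi q i => omega F K psi i q.

Definition frame_comp s x : M -> C := fun q => (s q *m P q) 0 x.

Lemma frame_comp_smooth s x : smooth_mx phi W s -> smooth_in phi W (frame_comp s x).
Proof. by move=> ss; exact: (smooth_mxM pW ss sP 0 x). Qed.

Lemma smooth_mx_of_comp s : (forall x, smooth_in phi W (frame_comp s x)) -> smooth_mx phi W s.
Proof.
move=> h; apply: (@smooth_mx_eq _ _ _ _ _ _ _ (fun q => s q *m P q *m invmx (P q))) => //.
  by move=> q Wq; rewrite mulmxK // Pu.
by apply: smooth_mxM => // i j; rewrite ord1; exact: h.
Qed.

Lemma frame_comp_pd s a x q : smooth_mx phi W s -> W q ->
  (pdd_mx phi a s q *m P q) 0 x = pdd phi a (frame_comp s x) q - (s q *m pdd_mx phi a P q) 0 x.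
Proof.
move=> ss Wq; have /matrixP /(_ 0 x) := pdd_mxM a pW ss sP Wq.
rewrite addE => E; apply/eqP; rewrite eq_sym subr_eq -E; apply/eqP.
by rewrite [RHS]mxE.
Qed.

Lemma frame_cov i s x q : smooth_mx phi W s -> W q ->
  (cov phi chern i s q *m P q) 0 x =
    pdd phi (inl i) (frame_comp s x) q + lm i x q * frame_comp s x q.
Proof.
move=> ss Wq; rewrite /cov pd_sectionE mulmxDl -mulmxA frame_omega // mulmxDr mxE
  frame_comp_pd //.
rewrite addE addrA subrK; congr (_ + _).
by rewrite mulmxA mulmx_delta_diag [(\row_ _ _) _ _]mxE mulrC.
Qed.

Lemma frame_dbar i s x q : smooth_mx phi W s -> W q ->
  (pdbar_section phi i s q *m P q) 0 x = pdd phi (inr i) (frame_comp s x) q.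
Proof.
move=> ss Wq; rewrite pdbar_sectionE frame_comp_pd // (hol_mx_pdbar _ hP Wq) mulmx0.
by rewrite [X in _ - X]mxE subr0.
Qed.

Lemma pdE psi i f : pd psi i f = pdd psi (inl i) f. Proof. by []. Qed.
Lemma pdbarE psi i f : pdbar psi i f = pdd psi (inr i) f. Proof. by []. Qed.

Opaque pdd jac.

(** * Operators that are diagonal in the canonical frame *)

(** L acts on each component in the canonical frame as a first-order operator
    whose leading coefficient dl is constant. All the operators of the structure
    are of this kind, with dl = 1 for D' and D'' and dl = 0 for the linear ones. *)
Definition diag_rep L (dl : C) a (c : 'I_m -> M -> C) : Prop :=
  forall s, smooth_mx phi W s -> forall q, W q -> forall x,
  frame_comp (L s) x q = dl * pdd phi a (frame_comp s x) q + c x q * frame_comp s x q.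

Lemma rep_comp_smooth L dl a c s x : diag_rep L dl a c ->
  (forall y, smooth_in phi W (c y)) -> smooth_mx phi W s ->
    smooth_in phi W (frame_comp (L s) x).
Proof.
move=> rL sc ss; have sf := frame_comp_smooth x ss.
apply: (@smooth_in_eq _ _ _ _ _ (fun q =>
  dl * pdd phi a (frame_comp s x) q + c x q * frame_comp s x q)) => //.
  by move=> q Wq; rewrite rL.
apply: (smooth_inD pW).
  by apply: (smooth_inM pW (smooth_in_cst _ _ _)); exact: smooth_in_pdd.
exact: smooth_inM pW (sc x) sf.
Qed.

Lemma rep_smooth L dl a c s : diag_rep L dl a c ->
  (forall y, smooth_in phi W (c y)) -> smooth_mx phi W s -> smooth_mx phi W (L s).
Proof. by move=> rL sc ss; apply: smooth_mx_of_comp => x; exact: rep_comp_smooth rL sc ss. Qed.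

Lemma rep_comp L dl a c L' dl' b c' s x q : diag_rep L dl a c -> diag_rep L' dl' b c' ->
  (forall y, smooth_in phi W (c' y)) -> smooth_mx phi W s -> W q ->
  frame_comp (L (L' s)) x q =
    dl * (dl' * pdd phi a (pdd phi b (frame_comp s x)) q
          + (pdd phi a (c' x) q * frame_comp s x q + c' x q * pdd phi a (frame_comp s x) q))
    + c x q * (dl' * pdd phi b (frame_comp s x) q + c' x q * frame_comp s x q).
Proof.
move=> rL rL' sc' ss Wq; have sL' := rep_smooth rL' sc' ss; have sf := frame_comp_smooth x ss.
rewrite (rL _ sL' _ Wq x) (rL' _ ss _ Wq x); congr (_ * _ + _).
have s1 : smooth_in phi W (fun r => dl' * pdd phi b (frame_comp s x) r).
  by apply: (smooth_inM pW (smooth_in_cst _ _ _)); exact: smooth_in_pdd.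
have s2 : smooth_in phi W (fun r => c' x r * frame_comp s x r)
  by exact: smooth_inM pW (sc' x) sf.
rewrite (@pdd_eq _ _ _ _ W _ _ (fun r =>
  dl' * pdd phi b (frame_comp s x) r + c' x r * frame_comp s x r)) //; last first.
  by move=> r Wr; rewrite rL'.
rewrite (pddD a s1 s2 Wq) (pddM a pW (sc' x) sf Wq); congr (_ + _).
rewrite (pddM a pW (smooth_in_cst _ _ _) (smooth_in_pdd b pW sf) Wq).
by rewrite pdd_cst mul0r add0r.
Qed.

Let comm_algebra (dl dl' c c' f fa fb fab ca cb : C) :
  dl * (dl' * fab + (ca * f + c' * fa)) + c * (dl' * fb + c' * f)
  - (dl' * (dl * fab + (cb * f + c * fb)) + c' * (dl * fa + c * f)) =
  (dl * ca - dl' * cb) * f.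
Proof. ring. Qed.

Lemma frame_comp_sub s t x q : frame_comp (fun r => s r - t r) x q =
  frame_comp s x q - frame_comp t x q.
Proof. by rewrite /frame_comp mulmxBl !mxE. Qed.

Lemma frame_comp_add s t x q : frame_comp (fun r => s r + t r) x q =
  frame_comp s x q + frame_comp t x q.
Proof. by rewrite /frame_comp mulmxDl !mxE. Qed.

(** Coordinate derivatives commute and the leading coefficients are constant,
    so that only the derivatives of the zeroth-order coefficients survive. *)
Lemma rep_comm L dl a c L' dl' b c' s x q : diag_rep L dl a c -> diag_rep L' dl' b c' ->
  (forall y, smooth_in phi W (c y)) -> (forall y, smooth_in phi W (c' y)) ->
  smooth_mx phi W s -> W q ->
  frame_comp (addop (compop L L') (oppop (compop L' L)) s) x q =
  (dl * pdd phi a (c' x) q - dl' * pdd phi b (c x) q) * frame_comp s x q.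
Proof.
move=> rL rL' sc sc' ss Wq.
rewrite -[LHS]/(frame_comp (fun r => L (L' s) r - L' (L s) r) x q) frame_comp_sub.
rewrite (rep_comp x rL rL' sc' ss Wq) (rep_comp x rL' rL sc ss Wq).
rewrite (pdd_schwarz b a pW (frame_comp_smooth x ss) Wq); exact: comm_algebra.
Qed.

Lemma rep_add L dl a c L' dl' c' : diag_rep L dl a c -> diag_rep L' dl' a c' ->
  diag_rep (addop L L') (dl + dl') a (fun x q => c x q + c' x q).
Proof.
move=> rL rL' s ss q Wq x.
rewrite -[LHS]/(frame_comp (fun r =>
  L s r + L' s r) x q) frame_comp_add (rL _ ss _ Wq x) (rL' _ ss _ Wq x).
by rewrite !mulrDl addrACA.
Qed.

Definition opeqW (A B : op M) : Prop :=
  forall s, smooth_mx phi W s -> forall q, W q -> A s q = B s q.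

Lemma frame_comp_inj s t q : W q -> (forall x, frame_comp s x q = frame_comp t x q) ->
  s q = t q.
Proof. by move=> Wq E; apply: (injP Wq); apply/rowP => x; exact: E. Qed.

Lemma frame_comp0 x q : frame_comp (fun=> 0) x q = 0.
Proof. by rewrite /frame_comp mul0mx mxE. Qed.

Lemma rep_comm_zero L dl a c L' dl' b c' : diag_rep L dl a c -> diag_rep L' dl' b c' ->
  (forall y, smooth_in phi W (c y)) -> (forall y, smooth_in phi W (c' y)) ->
  (forall q x, W q -> dl * pdd phi a (c' x) q = dl' * pdd phi b (c x) q) ->
  opeqW (addop (compop L L') (oppop (compop L' L))) (@zeroop R m M).
Proof.
move=> rL rL' sc sc' E s ss q Wq; apply: (frame_comp_inj Wq) => x.
by rewrite (rep_comm x rL rL') // E // subrr mul0r frame_comp0.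
Qed.

Let sub_swap (v1 v2 v3 v4 : 'rV[C]_m) : v1 - v2 + (v3 - v4) = v1 - v4 - (v2 - v3).
Proof. by rewrite opprB addrACA [RHS]addrACA [- v4 - v2]addrC. Qed.

(** The coefficient with index a of an operator-valued form involves the
    derivative with the same index a. *)
Definition form_rep (X : opform M) (dl : 'I_m + 'I_m -> C) (c : 'I_m + 'I_m -> 'I_m ->
  M -> C) : Prop :=
  (forall a, diag_rep (X a) (dl a) a (c a)) /\ forall a x, smooth_in phi W (c a x).

Lemma form_rep_wedge X dl c : form_rep X dl c ->
  (forall a b x q, W q -> dl a * pdd phi a (c b x) q = dl b * pdd phi b (c a x) q) ->
  forall a b, opeqW (wedge X X a b) (@zeroop R m M).
Proof.
by move=> [rX sX] E a b; apply: (rep_comm_zero (rX a) (rX b)) => // q x; exact: E.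
Qed.

Lemma form_rep_mixed X dl c Y dl' c' : form_rep X dl c -> form_rep Y dl' c' ->
  (forall a b x q, W q -> dl a * pdd phi a (c' b x) q - dl' b * pdd phi b (c a x) q =
      dl b * pdd phi b (c' a x) q - dl' a * pdd phi a (c b x) q) ->
  forall a b, opeqW (addop (wedge X Y a b) (wedge Y X a b)) (@zeroop R m M).
Proof.
move=> [rX sX] [rY sY] E a b s ss q Wq; apply: (frame_comp_inj Wq) => x.
have E1 := rep_comm x (rX a) (rY b) (sX a) (sY b) ss Wq.
have E2 := rep_comm x (rX b) (rY a) (sX b) (sY a) ss Wq.
transitivity (frame_comp (fun r => addop (compop (X a) (Y b)) (oppop (compop (Y b) (X a))) s r -
   addop (compop (X b) (Y a)) (oppop (compop (Y a) (X b))) s r) x q).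
  rewrite /frame_comp; congr ((_ *m _) _ _); rewrite /wedge /addop /oppop /compop.
  exact: sub_swap.
by rewrite frame_comp_sub E1 E2 E // subrr frame_comp0.
Qed.

Let D1 := Dprime phi chern.
Let D2 := Ddoubleprime phi.
Let Cc := Cform F phi.
Let Ct := Ctilde F K phi.

(** * The curvature equations *)

Definition lead_D1 a : C := match a with inl _ => 1 | inr _ => 0 end.
Definition lead_D2 a : C := match a with inl _ => 0 | inr _ => 1 end.
Definition coef_C a x q : C := match a with inl i => - P q i x | inr _ => 0 end.
Definition coef_Ct a x q : C := match a with inl _ => 0 | inr i => - conjc (P q i x) end.
Definition coef_D1 a x q : C := match a with inl i => lm i x q | inr _ => 0 end.

Lemma coef_C_smooth a x : smooth_in phi W (coef_C a x).
Proof.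
case: a => i; last exact: smooth_in_cst.
exact: smooth_inN pW (sP i x).
Qed.

Lemma coef_Ct_smooth a x : smooth_in phi W (coef_Ct a x).
Proof.
case: a => i; first exact: smooth_in_cst.
exact: smooth_inN pW (smooth_inJ pW (sP i x)).
Qed.

Lemma coef_D1_smooth a x : smooth_in phi W (coef_D1 a x).
Proof.
case: a => i; last exact: smooth_in_cst.
by have [] := chern_coef_hol frobF aphi canchi i x.
Qed.

Lemma frame_comp_C i s x q : W q -> frame_comp (Cc (inl i) s) x q =
  - P q i x * frame_comp s x q.
Proof.
move=> Wq; rewrite /frame_comp /Cc /Cform mulNmx (frame_product frobF aphi canchi) //.
by rewrite [LHS]mxE [X in - X]mxE -rowE [row _ _ _ _]mxE mulNr.
Qed.

Lemma form_rep_C : form_rep Cc (fun=> 0) coef_C.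
Proof.
split; last exact: coef_C_smooth.
case=> i s ss q Wq x; rewrite mul0r add0r; first exact: frame_comp_C.
by rewrite mul0r -[LHS]/(frame_comp (fun=> 0) x q) frame_comp0.
Qed.

Lemma form_rep_D1 : form_rep D1 lead_D1 coef_D1.
Proof.
split; last exact: coef_D1_smooth.
case=> i s ss q Wq x; first by rewrite mul1r; exact: frame_cov.
by rewrite !mul0r addr0 -[LHS]/(frame_comp (fun=> 0) x q) frame_comp0.
Qed.

Lemma form_rep_D2 : form_rep D2 lead_D2 (fun _ _ _ => 0).
Proof.
split; last by move=> a x; exact: smooth_in_cst.
case=> i s ss q Wq x; last by rewrite mul1r mul0r addr0; exact: frame_dbar.
by rewrite !mul0r addr0 -[LHS]/(frame_comp (fun=> 0) x q) frame_comp0.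
Qed.

Let k := fiberop (kappa_map K phi).

Lemma frame_comp_k s x q : W q -> frame_comp (k s) x q = conjc (frame_comp s x q) * kp x q.
Proof. by move=> Wq; rewrite /frame_comp /k /fiberop /kappa_map frame_kappa // mxE. Qed.

Lemma k_smx s : smooth_mx phi W s -> smooth_mx phi W (k s).
Proof.
move=> ss; apply: smooth_mx_of_comp => x.
apply: (@smooth_in_eq _ _ _ _ _ (fun q => conjc (frame_comp s x q) * kp x q)) => //.
  by move=> q Wq; rewrite frame_comp_k.
apply: (smooth_inM pW); first exact: smooth_inJ pW (frame_comp_smooth x ss).
by exact: kappa_coef_smooth.
Qed.

Let kk q x : W q -> conjc (kp x q) * kp x q = 1.
Proof. by move=> Wq; exact: (kappa_coef_unimodular frobF canchi x Wq). Qed.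

Lemma frame_kK q (x : 'rV[C]_m) : W q -> kappa_map K phi q (kappa_map K phi q x) = x.
Proof.
move=> Wq; apply: (injP Wq); rewrite /kappa_map frame_kappa //.
apply/rowP => y; rewrite [LHS]mxE frame_kappa // [(\row__ _) _ _]mxE.
by rewrite rmorphM /= conjcK -mulrA kk // mulr1.
Qed.

Let kLk_algebra (c f w : C) : conjc w * w = 1 -> conjc (c * (conjc f * w)) * w = conjc c * f.
Proof.
move=> E; have -> : conjc (c * (conjc f * w)) = conjc c * (f * conjc w).
  by rewrite rmorphM; congr (_ * _); rewrite rmorphM; congr (_ * _); exact: conjcK.
by rewrite -!mulrA E mulr1.
Qed.

Lemma frame_comp_kLk L a c s x q : diag_rep L 0 a c -> smooth_mx phi W s -> W q ->
  frame_comp (compop k (compop L k) s) x q = conjc (c x q) * frame_comp s x q.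
Proof.
move=> rL ss Wq; rewrite -[LHS]/(frame_comp (k (L (k s))) x q) frame_comp_k //.
rewrite (rL _ (k_smx ss) _ Wq x) mul0r add0r frame_comp_k //.
exact: kLk_algebra (kk x Wq).
Qed.

Lemma form_rep_Ct : form_rep Ct (fun=> 0) coef_Ct.
Proof.
split; last exact: coef_Ct_smooth.
case=> i s ss q Wq x; rewrite mul0r add0r.
  by rewrite mul0r -[LHS]/(frame_comp (fun=> 0) x q) frame_comp0.
rewrite -[Ct (inr i)]/(compop k (compop (Cc (inl i)) k)).
have [rC _] := form_rep_C.
by rewrite (frame_comp_kLk x (rC (inl i)) ss Wq) /coef_C rmorphN.
Qed.

Let P_sym i j x q : W q -> pdd phi (inl i) (fun r => P r j x) q =
  pdd phi (inl j) (fun r => P r i x) q.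
Proof. by move=> Wq; exact: (jac_sym i j x aphi achi). Qed.

Let P_bar i j x q : W q -> pdd phi (inr i) (fun r => P r j x) q = 0.
Proof. by move=> Wq; have [_] := hP j x; exact. Qed.

Let pd_neg a f q : smooth_in phi W f -> W q ->
  pdd phi a (fun r => - f r) q = - pdd phi a f q.
Proof. by move=> sf Wq; exact: pddN pW sf Wq. Qed.

Let pd_cC i j x q : W q -> pdd phi (inl i) (coef_C (inl j) x) q =
  pdd phi (inl j) (coef_C (inl i) x) q.
Proof.
move=> Wq; rewrite /coef_C (pd_neg _ (sP j x) Wq) (pd_neg _ (sP i x) Wq).
by congr (- _); exact: P_sym.
Qed.

Let pdbar_cC i a x q : W q -> pdd phi (inr i) (coef_C a x) q = 0.
Proof.
move=> Wq; case: a => j; last exact: pdd_cst.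
by rewrite /coef_C pd_neg ?P_bar ?oppr0 //; exact: sP.
Qed.

Let pdbar_cCt i j x q : W q -> pdd phi (inr i) (coef_Ct (inr j) x) q =
  pdd phi (inr j) (coef_Ct (inr i) x) q.
Proof.
move=> Wq; have h l : smooth_in phi W (fun r => conjc (P r l x))
  by exact: smooth_inJ pW (sP l x).
rewrite /coef_Ct (pd_neg _ (h j) Wq) (pd_neg _ (h i) Wq); congr (- _).
apply: etrans (pddJ (inr i) (sP j x) Wq) _; apply: etrans _ (esym (pddJ (inr j) (sP i x) Wq)).
by congr conjc; exact: P_sym.
Qed.

Let pd_cCt i a x q : W q -> pdd phi (inl i) (coef_Ct a x) q = 0.
Proof.
move=> Wq; case: a => j; first exact: pdd_cst.
rewrite /coef_Ct pd_neg //; last exact: smooth_inJ pW (sP j x).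
rewrite (_ : pdd _ _ _ _ = 0) ?oppr0 //.
apply: etrans (pddJ (inl i) (sP j x) Wq) _.
by rewrite -[pdd _ _ _ _]/(pdd phi (inr i) (fun r => P r j x) q) P_bar // conjc0.
Qed.

Let pdbar_cD1 i a x q : W q -> pdd phi (inr i) (coef_D1 a x) q = 0.
Proof.
move=> Wq; case: a => j; last exact: pdd_cst.
by have [_] := chern_coef_hol frobF aphi canchi j x; exact.
Qed.

Let lam_algebra (e u v w : C) : e != 0 ->
  v / (2 * e) + u * (- (2 * w) / (2 * e) ^+ 2) = v / (2 * e) + w * (- (2 * u) / (2 * e) ^+ 2).
Proof. by move=> e0; field. Qed.

Let pd_cD1 i j x q : W q -> pdd phi (inl i) (coef_D1 (inl j) x) q =
  pdd phi (inl j) (coef_D1 (inl i) x) q.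
Proof.
move=> Wq; have [se _] := frame_eta_hol frobF aphi canchi x.
have s2 : smooth_in phi W (fun r => 2 * eta x r)
  by exact: smooth_inM pW (smooth_in_cst _ _ _) se.
have nz r : W r -> 2 * eta x r != 0 by move=> Wr; rewrite mulf_neq0 ?pnatr_eq0 // eta0.
have E l l' : pdd phi (inl l) (coef_D1 (inl l') x) q =
   pdd phi (inl l) (pdd phi (inl l') (eta x)) q / (2 * eta x q) +
   pdd phi (inl l') (eta x) q * (- (2 * pdd phi (inl l) (eta x) q) / (2 * eta x q) ^+ 2).
  have sd := smooth_in_pdd (inl l') pW se.
  apply: etrans (pddM (inl l) pW sd (smooth_inV pW nz s2) Wq) _; congr (_ + _ * _).
  apply: etrans (pddV (inl l) pW nz s2 Wq) _; congr (- _ / _).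
  apply: etrans (pddM (inl l) pW (smooth_in_cst _ _ 2) se Wq) _.
  by rewrite pdd_cst mul0r add0r.
rewrite !E (pdd_schwarz (inl i) (inl j) pW se Wq).
by apply: lam_algebra; exact: eta0.
Qed.

Let form_rep_add X dl c Y dl' c' : form_rep X dl c -> form_rep Y dl' c' ->
  form_rep (addform X Y) (fun a => dl a + dl' a) (fun a x q => c a x q + c' a x q).
Proof.
move=> [rX sX] [rY sY]; split=> [a|a x]; first exact: rep_add (rX a) (rY a).
exact: smooth_inD pW (sX a x) (sY a x).
Qed.

Let sum_cases (Q : 'I_m + 'I_m -> 'I_m + 'I_m -> Prop) :
  (forall i j, Q (inl i) (inl j)) -> (forall i j, Q (inl i) (inr j)) ->
  (forall i j, Q (inr i) (inl j)) -> (forall i j, Q (inr i) (inr j)) -> forall a b, Q a b.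
Proof. by move=> ? ? ? ? [i|i] [j|j]. Qed.

(* The terms of a commutator with leading coefficients d, d' equal to 0 or 1 are
   compared case by case. *)
Let c11 (d d' x y : C) : d = 1 -> d' = 1 -> x = y -> d * x = d' * y.
Proof. by move=> -> -> ->. Qed.
Let c10 (d d' x y : C) : d' = 0 -> x = 0 -> d * x = d' * y.
Proof. by move=> -> ->; rewrite mulr0 mul0r. Qed.
Let c01 (d d' x y : C) : d = 0 -> y = 0 -> d * x = d' * y.
Proof. by move=> -> ->; rewrite mulr0 mul0r. Qed.
Let c00 (d d' x y : C) : d = 0 -> d' = 0 -> d * x = d' * y.
Proof. by move=> -> ->; rewrite !mul0r. Qed.
Let mixed_l (d d' u v u' v' : C) : d * u = d' * u' ->
  d * u - 0 * v = d' * u' - 0 * v'.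
Proof. by move=> ->; rewrite !mul0r. Qed.
Let mixed_0 (e e' d d' v v' : C) : d' * v = d * v' ->
  e * 0 - d * v' = e' * 0 - d' * v.
Proof. by move=> ->; rewrite !mulr0. Qed.
Let add00 : (0 + 0 : C) = 0. Proof. exact: addr0. Qed.
Let add01 : (0 + 1 : C) = 1. Proof. exact: add0r. Qed.
Let dl1l i : lead_D1 (inl i) = 1. Proof. by []. Qed.
Let dl1r i : lead_D1 (inr i) = 0. Proof. by []. Qed.
Let dl2l i : lead_D2 (inl i) = 0. Proof. by []. Qed.
Let dl2r i : lead_D2 (inr i) = 1. Proof. by []. Qed.
Let cC_r a j x q : pdd phi a (coef_C (inr j) x) q = 0.
Proof. exact: pdd_cst. Qed.
Let cCt_l a j x q : pdd phi a (coef_Ct (inl j) x) q = 0.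
Proof. exact: pdd_cst. Qed.
Let cD1_r a j x q : pdd phi a (coef_D1 (inr j) x) q = 0.
Proof. exact: pdd_cst. Qed.

(** The coefficients of C are those of - du^a, which are holomorphic. *)
Lemma C_dbar_square a b : opeqW (wedge (addform Cc D2) (addform Cc D2) a b) (@zeroop R m M).
Proof.
apply: (form_rep_wedge (form_rep_add form_rep_C form_rep_D2)) => {}a {}b x q Wq.
have E l l' : pdd phi l (fun q => coef_C l' x q + 0) q = pdd phi l (coef_C l' x) q.
  by apply: (pdd_eq _ pW) => // r _; rewrite addr0.
rewrite (E a b) (E b a); move: a b; apply: sum_cases => i j.
- by apply: c00; rewrite dl2l add00.
- by apply: c01; [rewrite dl2l add00|exact: pdbar_cC].
- by apply: c10; [rewrite dl2l add00|exact: pdbar_cC].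
- apply: c11; [by rewrite dl2r add01|by rewrite dl2r add01|].
  by rewrite !pdbar_cC.
Qed.

(** The coefficients are those of - conj du^a and of the forms
    d eta_a / (2 eta_a): the former has no (1,0)-derivatives, the latter is
    closed. *)
Lemma Ct_D1_square a b : opeqW (wedge (addform Ct D1) (addform Ct D1) a b) (@zeroop R m M).
Proof.
apply: (form_rep_wedge (form_rep_add form_rep_Ct form_rep_D1)) => {}a {}b x q Wq.
have E l l' : pdd phi l (fun q => coef_Ct l' x q + coef_D1 l' x q) q =
   pdd phi l (coef_Ct l' x) q + pdd phi l (coef_D1 l' x) q.
  exact: pddD (coef_Ct_smooth _ _) (coef_D1_smooth _ _) Wq.
rewrite (E a b) (E b a); move: a b; apply: sum_cases => i j.
- apply: c11; [by rewrite dl1l add01|by rewrite dl1l add01|].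
  rewrite (pd_cCt i _ x Wq) (pd_cCt j _ x Wq) (pd_cD1 i j x Wq); reflexivity.
- apply: c10; first by rewrite dl1r add00.
  by rewrite (pd_cCt i _ x Wq) cD1_r add00.
- apply: c01; first by rewrite dl1r add00.
  by rewrite (pd_cCt j _ x Wq) cD1_r add00.
- by apply: c00; rewrite dl1r add00.
Qed.

(** The forms du^a are closed. *)
Lemma D1_C a b : opeqW (addop (wedge D1 Cc a b) (wedge Cc D1 a b)) (@zeroop R m M).
Proof.
apply: (form_rep_mixed form_rep_D1 form_rep_C) => {}a {}b x q Wq; apply: mixed_l.
move: a b; apply: sum_cases => i j.
- apply: c11; [exact: dl1l|exact: dl1l|exact: pd_cC].
- by apply: c10; [exact: dl1r|exact: cC_r].
- by apply: c01; [exact: dl1r|exact: cC_r].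
- by apply: c00; exact: dl1r.
Qed.

Lemma D2_Ct a b : opeqW (addop (wedge D2 Ct a b) (wedge Ct D2 a b)) (@zeroop R m M).
Proof.
apply: (form_rep_mixed form_rep_D2 form_rep_Ct) => {}a {}b x q Wq; apply: mixed_l.
move: a b; apply: sum_cases => i j.
- by apply: c00; exact: dl2l.
- by apply: c01; [exact: dl2l|exact: cCt_l].
- by apply: c10; [exact: dl2l|exact: cCt_l].
- apply: c11; [exact: dl2r|exact: dl2r|exact: pdbar_cCt].
Qed.

(** Both sides vanish: the left one is the dbar-derivative of the connection
    forms, which are holomorphic, and on the right the operators are diagonal
    matrices. *)
Lemma D_curvature a b : opeqW (addop (wedge D1 D2 a b) (wedge D2 D1 a b))
  (oppop (addop (wedge Cc Ct a b) (wedge Ct Cc a b))).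
Proof.
move=> s ss q Wq.
transitivity (0 : 'rV[C]_m).
  apply: (form_rep_mixed form_rep_D1 form_rep_D2 _ a b ss Wq) => {}a {}b x r Wr.
  rewrite (pdd_cst phi a 0) (pdd_cst phi b 0); apply: mixed_0; move: a b;
    apply: sum_cases => i j.
  - by apply: c00; exact: dl2l.
  - by apply: c01; [exact: dl2l|exact: pdbar_cD1].
  - by apply: c10; [exact: dl2l|exact: pdbar_cD1].
  - apply: c11; [exact: dl2r|exact: dl2r|by rewrite !cD1_r].
rewrite /oppop (form_rep_mixed form_rep_C form_rep_Ct _ a b ss Wq) ?/zeroop ?oppr0 //.
by move=> {}a {}b x r Wr; rewrite !mul0r.
Qed.

(** * Compatibility with the involution *)

Let cjM (x y : C) : conjc (x * y) = conjc x * conjc y. Proof. exact: rmorphM. Qed.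
Let cjD (x y : C) : conjc (x + y) = conjc x + conjc y. Proof. exact: rmorphD. Qed.
Let cjN (x : C) : conjc (- x) = - conjc x. Proof. exact: rmorphN. Qed.
Let cj_norm (x : C) : conjc `|x| = `|x|.
Proof. by apply/eqP; rewrite eq_complex /= eqxx /= oppr0. Qed.

Let cov_k_algebra (f' l f w : C) : f' * w + conjc f * (- l * w) + l * (conjc f * w) = f' * w.
Proof. by rewrite mulNr mulrN [l * (_ * _)]mulrCA subrK. Qed.

(** kappa is f |-> k * conj f on components, and d' k = - l k cancels the
    connection term. *)
Lemma D1_kappa i : opeqW (compop (D1 (inl i)) k) (compop k (D2 (inr i))).
Proof.
move=> s ss q Wq; apply: (frame_comp_inj Wq) => x.
have sf := frame_comp_smooth x ss; have sk := kappa_coef_smooth frobF aphi canchi x.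
rewrite -[LHS]/(frame_comp (cov phi chern i (k s)) x q) -[RHS]/(frame_comp (k (pdbar_section
  phi i s)) x q).
apply: etrans (frame_cov i x (k_smx ss) Wq) _; apply: etrans _ (esym (frame_comp_k _ _ Wq)).
have -> : frame_comp (pdbar_section phi i s) x q = pdd phi (inr i) (frame_comp s x) q
  by exact: frame_dbar.
have -> : pdd phi (inl i) (frame_comp (k s) x) q = pdd phi (inl i) (fun r =>
  conjc (frame_comp s x r) * kp x r) q.
  by apply: (pdd_eq _ pW) => // r Wr; exact: frame_comp_k.
rewrite (pddM (inl i) pW (smooth_inJ pW sf) sk Wq) frame_comp_k //.
rewrite -[pdd phi (inl i) (kappa_coef _ _ _) _]/(pdd phi (inl i) (kp x) q).
have -> : pdd phi (inl i) (kp x) q = - lm i x q * kp x q.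
  by rewrite mulNr; exact: pd_kappa_coef.
have -> : pdd phi (inl i) (fun r => conjc (frame_comp s x r)) q =
  conjc (pdd phi (inr i) (frame_comp s x) q).
  exact: (pddJ (inl i) sf Wq).
exact: cov_k_algebra.
Qed.

Let dbar_k_algebra (f' l f w : C) : conjc f' * w + conjc f * (conjc l * w) =
  conjc (f' + l * f) * w.
Proof.
rewrite mulrA -mulrDl; congr (_ * w); rewrite rmorphD; congr (_ + _).
by rewrite rmorphM mulrC.
Qed.

(** The derivative d'' k = conj l * k produces the image under kappa of the
    connection term. *)
Lemma D2_kappa i : opeqW (compop (D2 (inr i)) k) (compop k (D1 (inl i))).
Proof.
move=> s ss q Wq; apply: (frame_comp_inj Wq) => x.
have sf := frame_comp_smooth x ss; have sk := kappa_coef_smooth frobF aphi canchi x.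
rewrite -[LHS]/(frame_comp (pdbar_section phi i (k s)) x q) -[RHS]/(frame_comp (k (cov phi
  chern i s)) x q).
apply: etrans (frame_dbar i x (k_smx ss) Wq) _; apply: etrans _ (esym (frame_comp_k _ _ Wq)).
have -> : frame_comp (cov phi chern i s) x q =
  pdd phi (inl i) (frame_comp s x) q + lm i x q * frame_comp s x q.
  exact: frame_cov.
have -> : pdd phi (inr i) (frame_comp (k s) x) q = pdd phi (inr i) (fun r =>
  conjc (frame_comp s x r) * kp x r) q.
  by apply: (pdd_eq _ pW) => // r Wr; exact: frame_comp_k.
rewrite (pddM (inr i) pW (smooth_inJ pW sf) sk Wq).
have -> : pdd phi (inr i) (kappa_coef F chi x) q = conjc (lm i x q) * kp x q
  by exact: pdbar_kappa_coef.
have -> : pdd phi (inr i) (fun r => conjc (frame_comp s x r)) q =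
  conjc (pdd phi (inl i) (frame_comp s x) q).
  exact: (pddJ (inr i) sf Wq).
exact: dbar_k_algebra.
Qed.

(** * The Hermitian form *)

Let h := hform F K phi.
Let n x q : C := `|eta x q|.

Let frame_hs s t q : W q -> hsec h s t q =
  \sum_x frame_comp s x q * conjc (frame_comp t x q) * n x q.
Proof. by move=> Wq; exact: frame_h. Qed.

Let n_gt0 x q : W q -> 0 < n x q.
Proof. by move=> Wq; rewrite normr_gt0 eta0. Qed.

Lemma frame_h_conj q x y : W q -> h q y x = conjc (h q x y).
Proof.
move=> Wq; rewrite /h !frame_h // rmorph_sum; apply: eq_bigr => a _.
rewrite -[complex_conjc__canonical__GRing_RMorphism _ _]/(conjc _).
by rewrite !cjM conjcK cj_norm; congr (_ * _); rewrite mulrC.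
Qed.

Lemma frame_h_pos q x : W q -> x != 0 -> 0 < h q x x.
Proof.
move=> Wq x0; rewrite /h frame_h //.
have ge0 (a : 'I_m) : 0 <= (x *m P q) 0 a * conjc ((x *m P q) 0 a) * `|eta a q|.
  by rewrite -normCK mulr_ge0 ?exprn_ge0.
rewrite lt_neqAle sumr_ge0 // andbT eq_sym psumr_neq0 //.
have : x *m P q != 0.
  by apply: contraNneq x0 => E; apply/eqP; apply: (injP Wq); rewrite E mul0mx.
move=> xP0; have [a a0] : exists a : 'I_m, (x *m P q) 0 a != 0.
  apply: contrapT => ne; case/eqP: xP0; apply/rowP => a; rewrite [RHS]mxE.
  by apply: contrapT => /eqP na; apply: ne; exists a.
apply/hasP; exists a; rewrite ?mem_index_enum //=.
by rewrite -normCK mulr_gt0 ?n_gt0 // exprn_gt0 // normr_gt0.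
Qed.

Lemma frame_h_linear q c x x' y : W q -> h q (c *: x + x') y = c * h q x y + h q x' y.
Proof.
move=> Wq; rewrite /h !frame_h // mulr_sumr -big_split /=; apply: eq_bigr => a _.
by rewrite mulmxDl -scalemxAl addE [(c *: (x *m _)) _ _]mxE !mulrDl !mulrA.
Qed.

Lemma frame_h_pseudo q : W q ->
  [/\ forall (c : C) x x' y, h q (c *: x + x') y = c * h q x y + h q x' y,
      forall (c : C) x y y', h q x (c *: y + y') = conjc c * h q x y + h q x y',
      forall x, (forall y, h q x y = 0) -> x = 0 &
      forall x y, h q y x = conjc (h q x y)].
Proof.
move=> Wq; split=> [c x x' y|c x y y'|x hx|x y]; first exact: frame_h_linear.
- by rewrite frame_h_conj // frame_h_linear // cjD cjM -!frame_h_conj.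
- apply/eqP; apply: contraT => x0; have := frame_h_pos Wq x0.
  by rewrite hx ltxx.
- exact: frame_h_conj.
Qed.

Let conj_real (x : C) : conjc x = x -> x \is Num.real.
Proof.
case: x => a b [] E; have b0 : b = 0 by lra.
by rewrite realE !lecE /= b0 eqxx /=; exact: le_total.
Qed.

(** On fixed points of kappa, h coincides with the symmetric form g, and a
    Hermitian form which is symmetric is real. *)
Lemma frame_h_real q x y : W q -> kappa_map K phi q x = x -> kappa_map K phi q y = y ->
  h q x y \is Num.real.
Proof.
move=> Wq kx ky; apply: conj_real; apply: etrans (esym (frame_h_conj _ _ Wq)) _.
rewrite /h /hform kx ky.
rewrite !(frame_form frobF aphi canchi) //; apply: eq_bigr => a _.
by rewrite [(y *m _) _ _ * _]mulrC.
Qed.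

Lemma frame_h_C i s t q : smooth_mx phi W s -> smooth_mx phi W t -> W q ->
  hsec h (Cc (inl i) s) t q = hsec h s (Ct (inr i) t) q.
Proof.
move=> ss st Wq; rewrite !frame_hs //; apply: eq_bigr => x _; congr (_ * _).
have [rC _] := form_rep_Ct; rewrite (rC (inr i) _ st _ Wq x) frame_comp_C // mul0r add0r.
rewrite cjM /coef_Ct cjN conjcK mulrA; congr (_ * _).
by rewrite mulrC.
Qed.

Let metric_algebra (f f1 g g1 w l : C) :
  (f1 * conjc g + f * conjc g1) * w + f * conjc g * (l * w) =
  (f1 + l * f) * conjc g * w + f * conjc g1 * w.
Proof. ring. Qed.

Let metric_algebra' (f f1 g g1 w l : C) :
  (f1 * conjc g + f * conjc g1) * w + f * conjc g * (conjc l * w) =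
  f1 * conjc g * w + f * conjc (g1 + l * g) * w.
Proof. by rewrite cjD cjM; ring. Qed.

Lemma frame_h_metric s t q i : smooth_mx phi W s -> smooth_mx phi W t -> W q ->
  pd phi i (hsec h s t) q = hsec h (D1 (inl i) s) t q + hsec h s (D2 (inr i) t) q /\
  pdbar phi i (hsec h s t) q = hsec h (D2 (inr i) s) t q + hsec h s (D1 (inl i) t) q.
Proof.
move=> ss st Wq.
have sf x := frame_comp_smooth x ss; have sg x := frame_comp_smooth x st.
have sgJ x : smooth_in phi W (fun r => conjc (frame_comp t x r)) by exact: smooth_inJ pW (sg x).
have sfg x : smooth_in phi W (fun r => frame_comp s x r * conjc (frame_comp t x r))
  by exact: smooth_inM pW (sf x) (sgJ x).
have sn x : smooth_in phi W (n x) by exact: norm_eta_smooth.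
have sF x : smooth_in phi W (fun r =>
  frame_comp s x r * conjc (frame_comp t x r) * n x r) by exact: smooth_inM pW (sfg x) (sn x).
have dh a : pdd phi a (hsec h s t) q = \sum_x
   ((pdd phi a (frame_comp s x) q * conjc (frame_comp t x q) + frame_comp s x q * conjc (pdd
     phi (dw_bar a) (frame_comp t x) q)) * n x q
     + frame_comp s x q * conjc (frame_comp t x q) * pdd phi a (n x) q).
  rewrite (@pdd_eq _ _ _ _ W _ _ (fun r =>
    \sum_x frame_comp s x r * conjc (frame_comp t x r) * n x r)) //; last first.
    by move=> r Wr; exact: frame_hs.
  rewrite (pdd_sum _ _ _ pW sF Wq); apply: eq_bigr => x _.
  rewrite (pddM a pW (sfg x) (sn x) Wq); congr (_ * _ + _).
  rewrite (pddM a pW (sf x) (sgJ x) Wq); congr (_ + _ * _).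
  exact: pddJ (sg x) Wq.
rewrite pdE pdbarE !dh !frame_hs // -!big_split /=; split; apply: eq_bigr => x _.
- have -> : frame_comp (D1 (inl i) s) x q =
  pdd phi (inl i) (frame_comp s x) q + lm i x q * frame_comp s x q by exact: frame_cov.
  have -> : frame_comp (D2 (inr i) t) x q = pdd phi (inr i) (frame_comp t x) q
    by exact: frame_dbar.
  have -> : pdd phi (inl i) (n x) q = lm i x q * n x q by exact: pd_norm_eta.
  exact: metric_algebra.
- have -> : frame_comp (D1 (inl i) t) x q =
  pdd phi (inl i) (frame_comp t x) q + lm i x q * frame_comp t x q by exact: frame_cov.
  have -> : frame_comp (D2 (inr i) s) x q = pdd phi (inr i) (frame_comp s x) q
    by exact: frame_dbar.
  have -> : pdd phi (inr i) (n x) q = conjc (lm i x q) * n x q by exact: pdbar_norm_eta.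
  exact: metric_algebra'.
Qed.

(** * The Euler field *)

Let U := Uop F phi.
Let Q := Qop F phi chern.
Let E := euler F phi.
Let eps x q : C := frame_comp E x q.

Let E_hol : hol_mx phi W E.
Proof.
have [[[_ hF] _ _] _ _] := frobF; have [_ _ _ he] := hF _ aphi.
by move=> i j; rewrite ord1; apply: (@hol_in_sub _ _ _ _ (dom phi));
  [move=> r []|apply/hol_inE; exact: he].
Qed.

Let eps_hol x : hol_in phi W (eps x).
Proof. exact: (hol_mxM pW E_hol hP 0 x). Qed.

Let sE : smooth_mx phi W E := hol_mx_smooth E_hol.

Let pd_eps i x q : W q -> pdd phi (inl i) (eps x) q = P q i x.
Proof. by move=> Wq; exact: frame_euler_deriv. Qed.

Let pdbar_eps i x q : W q -> pdd phi (inr i) (eps x) q = 0.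
Proof. by move=> Wq; have [_] := eps_hol x; exact. Qed.

Lemma frame_comp_U s x q : W q -> frame_comp (U s) x q = eps x q * frame_comp s x q.
Proof. by move=> Wq; rewrite /frame_comp /U /Uop /gprod (frame_product frobF aphi canchi) //
  mxE. Qed.

Lemma rep_U a : diag_rep U 0 a eps.
Proof. by move=> s ss q Wq x; rewrite mul0r add0r frame_comp_U. Qed.

Lemma euler_chern_coef x q : W q -> \sum_i E q 0 i * lm i x q = - conf_dim F / 2.
Proof.
move=> Wq; have e0 := eta0 x Wq.
have -> : \sum_i E q 0 i * lm i x q =
  (\sum_i E q 0 i * pdd phi (inl i) (eta x) q) / (2 * eta x q).
  by rewrite mulr_suml; apply: eq_bigr => i _; rewrite mulrA.
rewrite (frame_euler_eta frobF aphi canchi) //.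
by rewrite -mulf_div divff // mulr1.
Qed.

Lemma unit_chern_coef x q : W q -> \sum_i unit_field F phi q 0 i * lm i x q = 0.
Proof.
move=> Wq.
have -> : \sum_i unit_field F phi q 0 i * lm i x q =
    (\sum_i unit_field F phi q 0 i * pdd phi (inl i) (eta x) q) / (2 * eta x q).
  by rewrite mulr_suml; apply: eq_bigr => i _; rewrite mulrA.
by rewrite (frame_unit_eta frobF aphi canchi) // mul0r.
Qed.

Lemma frame_comp_cov_along X s x q : smooth_mx phi W s -> W q ->
  frame_comp (cov_along phi chern X s) x q =
  lie phi X (frame_comp s x) q + (\sum_i X q 0 i * lm i x q) * frame_comp s x q.
Proof.
move=> ss Wq; rewrite /frame_comp /cov_along mulmx_suml summxE /lie mulr_suml -big_split /=.
apply: eq_bigr => i _; rewrite -scalemxAl mxE frame_cov // mulrDr mulrA.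
by rewrite pdE.
Qed.

(** The components of e in the frame are constant, and the connection term
    vanishes since e(eta_a) = 0. *)
Lemma frame_unit_parallel q : W q ->
  cov_along phi chern (unit_field F phi) (unit_field F phi) q = 0.
Proof.
move=> Wq; apply: (injP Wq); apply/rowP => x.
have su : smooth_mx phi W (unit_field F phi).
  have [[[_ hF] _ _] _ _] := frobF; have [_ _ hu _] := hF _ aphi.
  by move=> i j; rewrite ord1; apply: (@smooth_in_sub _ _ _ _ (dom phi));
    [move=> r []|exact: (hu j).1].
rewrite -[LHS]/(frame_comp _ x q) frame_comp_cov_along // unit_chern_coef // mul0r addr0
  mul0mx [RHS]mxE.
rewrite /lie big1 // => i _.
rewrite (_ : pd _ _ _ _ = 0) ?mulr0 // pdE (@pdd_eq _ _ _ _ W _ _ (fun=> 1)) ?pdd_cst //.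
by move=> r Wr; rewrite /frame_comp (frame_unit frobF aphi canchi) // mxE.
Qed.

Let bracket_sum s q :
  bracket phi E s q = \sum_i E q 0 i *: pd_section phi i s q - \sum_i s q 0 i *: pd_section
    phi i E q.
Proof.
apply/rowP => x; rewrite [LHS]mxE [RHS]addE oppE !summxE; congr (_ - _);
by apply: eq_bigr => i _; rewrite [RHS]mxE; congr (_ * _); rewrite [RHS]mxE.
Qed.

Let frame_comp_pd_sum (v s : section M) x q : smooth_mx phi W s -> W q ->
  ((\sum_i v q 0 i *: pd_section phi i s q) *m P q) 0 x =
  \sum_i v q 0 i * pdd phi (inl i) (frame_comp s x) q -
  \sum_i \sum_j v q 0 i * s q 0 j * pdd phi (inl i) (fun r => P r j x) q.
Proof.
move=> ss Wq; rewrite mulmx_suml summxE -sumrB; apply: eq_bigr => i _.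
rewrite -scalemxAl [LHS]mxE pd_sectionE frame_comp_pd // mulrBr; congr (_ - _).
rewrite mxE mulr_sumr; apply: eq_bigr => j _; rewrite mulrA; congr (_ * _).
by rewrite mxE.
Qed.

Let bracket_algebra (A B S f B' : C) : S = f -> B' = B -> A - B - (S - B') = A - f.
Proof. by move=> -> ->; rewrite opprB addrA subrK. Qed.

(** In the canonical frame this is L_E d_a = - d_a. The second derivatives of
    the coordinates cancel by symmetry. *)
Lemma frame_bracket s x q : smooth_mx phi W s -> W q ->
  frame_comp (bracket phi E s) x q = lie phi E (frame_comp s x) q - frame_comp s x q.
Proof.
move=> ss Wq.
have -> : frame_comp (bracket phi E s) x q =
    frame_comp (fun r => \sum_i E r 0 i *: pd_section phi i s r) x q -
    frame_comp (fun r => \sum_i s r 0 i *: pd_section phi i E r) x q.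
  by rewrite -frame_comp_sub {1}/frame_comp bracket_sum.
rewrite [X in X - _](frame_comp_pd_sum E x ss Wq) [X in _ - X](frame_comp_pd_sum s x sE Wq).
apply: bracket_algebra.
  by rewrite /frame_comp mxE; apply: eq_bigr => i _; congr (_ * _); exact: pd_eps.
rewrite exchange_big; apply: eq_bigr => i _; apply: eq_bigr => j _.
by rewrite [s q 0 j * _]mulrC; congr (_ * _); exact: P_sym.
Qed.

Let Q_algebra (l f d : C) : l + - d / 2 * f - (l - f) - (2 - d) / 2 * f = 0.
Proof. by field. Qed.

Lemma Q_zero : opeqW Q (@zeroop R m M).
Proof.
move=> s ss q Wq; apply: (frame_comp_inj Wq) => x; rewrite frame_comp0.
have -> : frame_comp (Q s) x q =
  frame_comp (cov_along phi chern E s) x q - frame_comp (bracket phi E s) x q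
   - (2 - conf_dim F) / 2 * frame_comp s x q.
  rewrite /frame_comp /Q /Qop mulmxBl mulmxBl -scalemxAl !addE !oppE.
  by congr (_ - _ - _); rewrite mxE.
rewrite frame_comp_cov_along // frame_bracket // euler_chern_coef //; exact: Q_algebra.
Qed.

Let kUk := compop k (compop U k).

Lemma frame_comp_kUk s x q : smooth_mx phi W s -> W q -> frame_comp (kUk s) x q =
  conjc (eps x q) * frame_comp s x q.
Proof.
by move=> ss Wq; exact: (frame_comp_kLk x (rep_U (inl x)) ss Wq).
Qed.

Lemma rep_kUk a : diag_rep kUk 0 a (fun x q => conjc (eps x q)).
Proof. by move=> s ss q Wq x; rewrite mul0r add0r frame_comp_kUk. Qed.

Let seps x : smooth_in phi W (eps x) := (eps_hol x).1.

Lemma comm_C_U a : opeqW (commform Cc U a) (@zeroop R m M).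
Proof.
have [rC sC] := form_rep_C.
apply: (rep_comm_zero (rC a) (rep_U a) (sC a) seps) => q x Wq.
exact: c00.
Qed.

Lemma comm_D2_U a : opeqW (commform D2 U a) (@zeroop R m M).
Proof.
have [rD sD2] := form_rep_D2.
apply: (rep_comm_zero (rD a) (rep_U a) (sD2 a) seps) => q x Wq.
case: a => i; first by apply: c00 => //; exact: dl2l.
by rewrite pdbar_eps // mulr0 mul0r.
Qed.

Lemma frame_comp_Q s x q : smooth_mx phi W s -> W q -> frame_comp (Q s) x q = 0.
Proof. by move=> ss Wq; rewrite /frame_comp Q_zero // mul0mx mxE. Qed.

Lemma rep_Q a : diag_rep Q 0 a (fun _ _ => 0).
Proof. by move=> s ss q Wq x; rewrite !mul0r add0r frame_comp_Q. Qed.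

Let s0 (x : 'I_m) : smooth_in phi W (fun=> 0) := smooth_in_cst phi W 0.

Let euler_algebra (d e u v w y c f : C) :
  (d * e - 0 * u) * f - (0 * v - 0 * w) * f + (0 * y + c * f) = (d * e + c) * f.
Proof. ring. Qed.

(** [D', U] has the coefficients d eps_a = du^a, which are the opposites of
    those of C, while Q = 0. *)
Lemma comm_D1_U a : opeqW
  (addform (addform (commform D1 U) (fun a => oppop (commform Cc Q a))) Cc a) (@zeroop R m M).
Proof.
move=> s ss q Wq; apply: (frame_comp_inj Wq) => x; rewrite frame_comp0.
have [rC sC] := form_rep_C; have [rD sD1] := form_rep_D1.
have E1 := rep_comm x (rD a) (rep_U a) (sD1 a) seps ss Wq.
have E2 := rep_comm x (rC a) (rep_Q a) (sC a) s0 ss Wq.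
have E3 := rC a s ss q Wq x.
transitivity (frame_comp (commform D1 U a s) x q - frame_comp (commform Cc Q a s) x q +
  frame_comp (Cc a s) x q).
  by rewrite -frame_comp_sub -frame_comp_add.
rewrite /commform E1 E2 E3 euler_algebra.
case: a {E1 E2 E3} => i; first by rewrite dl1l mul1r pd_eps // /coef_C subrr mul0r.
by rewrite dl1r mul0r add00 mul0r.
Qed.

Lemma comm_D1_Q a : opeqW (addform (commform D1 Q) (commform Cc kUk) a) (@zeroop R m M).
Proof.
have [rC sC] := form_rep_C; have [rD sD1] := form_rep_D1.
have se x : smooth_in phi W (fun q => conjc (eps x q)) by exact: smooth_inJ pW (seps x).
move=> s ss q Wq.
have E1 : commform D1 Q a s q = 0.
  apply: (rep_comm_zero (rD a) (rep_Q a) (sD1 a) s0 _ ss Wq) => r x Wr.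
  by apply: c10 => //; exact: pdd_cst.
have E2 : commform Cc kUk a s q = 0.
  apply: (rep_comm_zero (rC a) (rep_kUk a) (sC a) se _ ss Wq) => r x Wr.
  exact: c00.
by rewrite -[LHS]/(commform D1 Q a s q + commform Cc kUk a s q) E1 E2 addr0.
Qed.

Lemma kappa_Q : opeqW (addop (compop k (compop Q k)) Q) (@zeroop R m M).
Proof.
move=> s ss q Wq; apply: (frame_comp_inj Wq) => x; rewrite frame_comp0.
rewrite -[LHS]/(frame_comp (fun r => compop k (compop Q k) s r + Q s r) x q) frame_comp_add.
by rewrite (frame_comp_kLk x (rep_Q (inl x)) ss Wq) frame_comp_Q // conjc0 mul0r addr0.
Qed.

Lemma frame_h_U s t q : smooth_mx phi W s -> smooth_mx phi W t -> W q ->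
  hsec h (U s) t q = hsec h s (kUk t) q.
Proof.
move=> ss st Wq; rewrite !frame_hs //; apply: eq_bigr => x _; congr (_ * _).
rewrite frame_comp_U // frame_comp_kUk // cjM conjcK mulrA; congr (_ * _).
by rewrite mulrC.
Qed.

Lemma frame_h_Q s t q : smooth_mx phi W s -> smooth_mx phi W t -> W q ->
  hsec h (Q s) t q = hsec h s (Q t) q.
Proof.
move=> ss st Wq; rewrite !frame_hs //; apply: eq_bigr => x _; congr (_ * _).
by rewrite !frame_comp_Q // conjc0 mulr0 mul0r.
Qed.

End DiagonalOperators.

(** * Existence of the involution *)

(** Invariance under a change of charts J of an involution defined through a
    third chart, to which A and B are the two Jacobian matrices. *)
Lemma involution_algebra (R : realType) (m : nat) (x : 'rV[R[i]]_m) (A B J D : 'M[R[i]]_m) :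
  A = J *m B -> A \in unitmx -> B \in unitmx ->
  antilinear_eval (map_mx conjc A *m D *m invmx A) x *m J =
  antilinear_eval (map_mx conjc B *m D *m invmx B) (x *m J).
Proof.
move=> AE uA uB; rewrite /antilinear_eval map_mxM -!mulmxA; congr (_ *m _).
have -> : map_mx conjc A = map_mx conjc J *m map_mx conjc B by rewrite AE; exact: map_mxM.
rewrite -!mulmxA; congr (_ *m (_ *m (_ *m _))).
by apply: (canLR (mulKmx uA)); rewrite AE mulmxK.
Qed.

Section Patching.
Variables (R : realType) (m : nat) (M : complex_manifold R m) (F : frobenius_data M).
Hypothesis frobF : is_frobenius_manifold F.
Hypothesis ssF : semisimple F.
Local Notation C := R[i].
Local Notation chartM := (chart R m M).
Implicit Types (phi psi chi : chartM) (p q : M) (K : antilinear_endo M).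

Lemma potential_chart p : exists chi : chartM,
  [/\ canonical_coordinates F chi, dom chi p & exists e, metric_potential F chi e].
Proof. by have [phi cphi dp] := ssF p; exact: (local_potential frobF cphi dp). Qed.

Lemma potential_diag_metric phi e q a : metric_potential F phi e -> dom phi q ->
  pd phi a e q = diag_metric F phi a q.
Proof. by move=> [_ he] dq; rewrite -he // form_delta. Qed.

(** The vectors of a canonical frame are the primitive idempotents of the
    product, so two such frames differ by a permutation. *)
Lemma canonical_overlap phi chi q a b :
  canonical_coordinates F phi -> canonical_coordinates F chi -> overlap phi chi q ->
  jac phi chi q a b != 0 ->
  row a (jac phi chi q) = delta_mx 0 b /\ diag_metric F phi a q = diag_metric F chi b q.
Proof.
move=> cphi cchi Wq J0; have [dphi dchi] := Wq; have aphi := cphi.1.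
have uJ := frame_unitmx aphi cchi Wq.
set J := jac phi chi q in J0 uJ *.
have prodE (x : 'rV[C]_m) c : x 0 a * J a c = J a c * (x *m J) 0 c.
  have := frame_product frobF aphi cchi (delta_mx 0 a) x Wq.
  rewrite (canonical_product cphi) // => /rowP /(_ c); rewrite -/J -rowE !mxE => <-.
  rewrite (bigD1 a) //= big1 ?addr0; last by move=> j ja; rewrite !mxE (negbTE ja) andbF !mul0r.
  by rewrite !mxE !eqxx mul1r.
(* x is the vector d_b of chi in the frame of phi. Multiplying it by the vector
   d_a of phi gives x_a d_a, and also J_ab d_b. *)
pose x : 'rV[C]_m := delta_mx 0 b *m invmx J.
have xJ : x *m J = delta_mx 0 b by rewrite mulmxKV.
have x1 : x 0 a = 1.
  apply: (mulIf J0); by rewrite prodE xJ [X in _ * X]mxE !eqxx mulr1 mul1r.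
have J1 : J a b = 1.
  have := prodE (delta_mx 0 a) b; rewrite -rowE [X in X * _]mxE !eqxx [X in _ = _ * X]mxE => E.
  by apply: (mulIf J0); rewrite -E.
have rJ : row a J = delta_mx 0 b.
  apply/rowP => c; have := prodE x c; rewrite x1 mul1r xJ => E.
  have dE : (delta_mx 0 b : 'rV[C]_m) 0 c = (c == b)%:R by rewrite mxE eqxx.
  rewrite [LHS]mxE E dE; case: eqP => [->|_]; last by rewrite mulr0.
  by rewrite J1 mulr1.
split=> //; rewrite /diag_metric -form_delta (frame_form frobF aphi cchi) // -rowE -/J rJ.
rewrite (bigD1 b) //= big1 ?addr0; first by rewrite !mxE !eqxx !mul1r.
by move=> c cb; rewrite !mxE (negbTE cb) andbF !mul0r.
Qed.

Lemma canonical_overlap_kappa phi chi q :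
  canonical_coordinates F phi -> canonical_coordinates F chi -> overlap phi chi q ->
  diag_mx (\row_a kappa_coef F phi a q) *m jac phi chi q =
  map_mx conjc (jac phi chi q) *m diag_mx (\row_a kappa_coef F chi a q).
Proof.
move=> cphi cchi Wq; apply/matrixP => a b; rewrite mul_diag_mx mul_mx_diag.
rewrite [LHS]mxE [RHS]mxE [X in X * _ = _]mxE [X in _ = _ * X]mxE [X in _ = X * _]mxE.
have [->|J0] := eqVneq (jac phi chi q a b) 0; first by rewrite conjc0 mulr0 mul0r.
have [rJ eE] := canonical_overlap cphi cchi Wq J0.
have J1 : jac phi chi q a b = 1 by have /rowP /(_ b) := rJ; rewrite !mxE !eqxx.
by rewrite J1 conjc1 mulr1 mul1r /kappa_coef eE.
Qed.

Definition chart_at p : chartM := sval (cid (potential_chart p)).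
Lemma chart_atP p : canonical_coordinates F (chart_at p) /\ dom (chart_at p) p.
Proof. by have [] := svalP (cid (potential_chart p)). Qed.

(** kappa is defined at p through some canonical chart around p, and
    transported to the other charts. The choice does not matter, by
    [canonical_overlap_kappa]. *)
Definition canonical_involution : antilinear_endo M := fun phi p =>
  let J := jac phi (chart_at p) p in
  map_mx conjc J *m diag_mx (\row_a kappa_coef F (chart_at p) a p) *m invmx J.

Lemma canonical_involutionP : canonical_kappa F canonical_involution.
Proof.
split=> [phi psi p aphi apsi dphi dpsi x|phi e cphi he p dp].
  have [cchi dchi] := chart_atP p; rewrite /canonical_involution.
  set chi := chart_at p in cchi dchi *.
  set A := jac phi chi p; set B := jac psi chi p; set J := jac phi psi p.
  have AE : A = J *m B by exact: jac_chain cchi.1 dphi dpsi dchi.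
  have uB : B \in unitmx by exact: (frame_unitmx apsi cchi).
  have uA : A \in unitmx by exact: (frame_unitmx aphi cchi).
  have uJ : J \in unitmx by exact: jac_unit.
  exact: involution_algebra.
have [cchi dchi] := chart_atP p; rewrite /canonical_involution.
rewrite -canonical_overlap_kappa // mulmxK; last by exact: (frame_unitmx cphi.1 cchi).
by congr diag_mx; apply/rowP => a; rewrite !mxE (potential_diag_metric _ he dp).
Qed.

(** * From the canonical frame to the manifold *)

Section Chern.
Variable K : antilinear_endo M.
Hypothesis canK : canonical_kappa F K.

Lemma chern_coef_chain phi psi chi q i a : atlas M phi -> atlas M psi ->
  canonical_coordinates F chi ->
  dom phi q -> dom psi q -> dom chi q ->
  chern_coef F phi chi i a q = \sum_k jac phi psi q i k * chern_coef F psi chi k a q.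
Proof.
move=> aphi apsi cchi d1 d2 d3.
have [se _] := frame_eta_hol frobF apsi cchi a.
rewrite /chern_coef (pd_chain i aphi apsi (conj d1 d2));
  last exact: smooth_in_cdiff se (conj d2 d3).
by rewrite mulr_suml; apply: eq_bigr => k _; rewrite mulrA.
Qed.

(** If the connection matrices G and S become dP + P L and dP' + P' L in a
    common frame, with L the same connection matrix there, then they are related
    by the transformation law of connection forms. *)
Lemma connection_algebra (k : comUnitRingType) (n : nat) (G J P P' S dJ dP dP' L : 'M[k]_n) :
  P = J *m P' -> P' \in unitmx -> S *m P' = dP' + P' *m L ->
  dP = dJ *m P' + J *m dP' -> G *m P = dP + P *m L -> G *m J = dJ + J *m S.
Proof.
move=> PE uP' SE dPE GE; apply: (can_inj (mulmxK uP')).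
by rewrite mulmxDl -[J *m S *m _]mulmxA SE mulmxDr addrA -dPE -mulmxA -PE GE mulmxA -PE.
Qed.

Lemma chern_law : connection_law (chern F K).
Proof.
move=> phi psi q aphi apsi d1 d2 i.
have [chi [cchi d3 pchi]] := potential_chart q; have achi := cchi.1.
set P := jac phi chi; set P' := jac psi chi; set J := jac phi psi.
have uP' : P' q \in unitmx by exact: (frame_unitmx apsi cchi).
have PE r : (dom phi `&` dom psi `&` dom chi) r -> P r = J r *m P' r.
  by move=> [[? ?] ?]; exact: jac_chain.
pose W3 := overlap phi chi `&` dom psi.
have o3 : chart_open phi W3 by apply: chart_openI; [exact: chart_open_overlap|exact: open_dom].
have W3q : W3 q by [].
have hP' : hol_mx psi (overlap psi chi) P' by apply: hol_mx_jac.
have dP' : pdd_mx phi (inl i) P' q = \sum_k J q i k *: pdd_mx psi (inl k) P' q.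
  apply/matrixP => a b; rewrite summxE [LHS]mxE.
  rewrite (pd_chain i aphi apsi (conj d1 d2));
    last exact: smooth_in_cdiff (hP' a b).1 (conj d2 d3).
  by apply: eq_bigr => k _; rewrite [RHS]mxE; congr (_ * _); rewrite [RHS]mxE.
have LE : diag_mx (\row_a chern_coef F phi chi i a q) =
    \sum_k J q i k *: diag_mx (\row_a chern_coef F psi chi k a q).
  have -> : \row_a chern_coef F phi chi i a q =
    \sum_k J q i k *: (\row_a chern_coef F psi chi k a q : 'rV[C]_m).
    apply/rowP => a; rewrite summxE mxE (chern_coef_chain _ _ aphi apsi cchi) //.
    by apply: eq_bigr => k _; rewrite [RHS]mxE [X in _ = _ * X]mxE.
  by rewrite linear_sum; apply: eq_bigr => k _; rewrite linearZ.
have o' : (\sum_k J q i k *: chern F K psi q k) *m P' q =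
   pdd_mx phi (inl i) P' q + P' q *m diag_mx (\row_a chern_coef F phi chi i a q).
  rewrite dP' LE mulmx_sumr mulmx_suml -big_split /=; apply: eq_bigr => k _.
  by rewrite -scalemxAl -scalemxAr -scalerDr (frame_omega frobF canK apsi cchi pchi k (conj
    d2 d3)).
have sJ : smooth_mx phi W3 J.
  by move=> a b; apply: (@smooth_in_sub _ _ _ _ (overlap phi psi));
    [move=> r [[]]|exact: (hol_mx_jac aphi apsi a b).1].
have sP : smooth_mx phi W3 P.
  by move=> a b; apply: (@smooth_in_sub _ _ _ _ (overlap phi chi));
    [move=> r []|exact: (hol_mx_jac aphi achi a b).1].
have uJ r : W3 r -> J r \in unitmx by move=> [[? ?] ?]; exact: jac_unit.
have sP' : smooth_mx phi W3 P'.
  apply: (@smooth_mx_eq _ _ _ _ _ _ _ (fun r => invmx (J r) *m P r)) => //.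
    by move=> r W3r; rewrite PE ?mulKmx ?uJ //; case: W3r => -[].
  exact: smooth_mxM o3 (smooth_mx_inv o3 uJ sJ) sP.
have dP : pdd_mx phi (inl i) P q =
  pdd_mx phi (inl i) J q *m P' q + J q *m pdd_mx phi (inl i) P' q.
  rewrite (@pdd_mx_eq _ _ _ _ W3 _ _ _ _ (fun r => J r *m P' r)) //; last first.
    by move=> r [[? ?] ?]; exact: PE.
  exact: (pdd_mxM _ o3 sJ sP' W3q).
exact: (connection_algebra (PE q (conj (conj d1 d2) d3)) uP' o' dP
  (frame_omega frobF canK aphi cchi pchi i (conj d1 d3))).
Qed.

Local Notation Gamma := (chern F K).

Let section_smooth_mx phi chi (s : section M) : smooth_section phi s ->
  smooth_mx phi (overlap phi chi) s.
Proof.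
move=> ss i j; rewrite ord1; apply: (@smooth_in_sub _ _ _ _ (dom phi)); last exact: ss.
by move=> r [].
Qed.

(** The operators are local, and canonical charts with a potential cover the
    manifold. *)
Lemma opeq_local phi (A B : op M) :
  (forall chi, canonical_coordinates F chi -> (exists e, metric_potential F chi e) ->
     opeqW phi chi A B) -> opeq phi A B.
Proof.
move=> AB s ss p dp; have [chi [cchi d pchi]] := potential_chart p.
exact: (AB chi cchi pchi s (@section_smooth_mx phi chi s ss) p (conj dp d)).
Qed.

Lemma smooth_on_local phi (f : M -> C) :
  (forall chi, canonical_coordinates F chi -> (exists e, metric_potential F chi e) ->
     smooth_in phi (overlap phi chi) f) -> smooth_on phi f.
Proof.
move=> sf; apply: (@smooth_in_local _ _ _ phi (dom phi)) => p dp.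
have [chi [cchi d pchi]] := potential_chart p.
by exists (overlap phi chi) => //; exact: sf.
Qed.

Lemma kappa_smooth : smooth_antilinear_endo K.
Proof.
split=> [|phi aphi j k]; first by case: canK.
apply: smooth_on_local => chi cchi pchi.
exact: (frame_K_smooth frobF canK aphi cchi pchi j k).
Qed.

Lemma chern_metric phi : atlas M phi ->
  metric_connection phi (hform F K phi) (Dprime phi Gamma) (Ddoubleprime phi).
Proof.
move=> aphi s t ss st p dp i; have [chi [cchi d pchi]] := potential_chart p.
exact: (frame_h_metric frobF canK aphi cchi pchi i (@section_smooth_mx phi chi s ss)
  (@section_smooth_mx phi chi t st) (conj dp d)).
Qed.

Lemma chern_connection : is_chern_connection F K Gamma.
Proof.
split; first exact: chern_law.
move=> phi aphi; split; last exact: chern_metric.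
move=> i j k; apply: smooth_on_local => chi cchi pchi.
exact: (frame_omega_hol frobF canK aphi cchi pchi i j k).1.
Qed.

Lemma chern_CV1 phi : atlas M phi ->
  CV1 phi (Dprime phi Gamma) (Ddoubleprime phi) (Cform F phi) (Ctilde F K phi).
Proof.
move=> aphi; split=> a b; apply: opeq_local => chi cchi pchi.
- exact: C_dbar_square.
- exact: Ct_D1_square.
- exact: D1_C.
- exact: D2_Ct.
- exact: D_curvature.
Qed.

Lemma chern_CV2 phi : atlas M phi ->
  CV2 phi (Dprime phi Gamma) (Ddoubleprime phi) (Cform F phi) (Ctilde F K phi)
    (kappa_map K phi).
Proof.
move=> aphi; split=> [p dp x|i|i|i].
- by have [chi [cchi d pchi]] := potential_chart p; apply: (frame_kK frobF canK aphi cchi).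
- by apply: opeq_local => chi cchi pchi; exact: D1_kappa.
- by apply: opeq_local => chi cchi pchi; exact: D2_kappa.
- by [].
Qed.

Lemma chern_CV3 phi : atlas M phi ->
  CV3 phi (Dprime phi Gamma) (Ddoubleprime phi) (Cform F phi) (Ctilde F K phi)
    (kappa_map K phi) (hform F K phi).
Proof.
move=> aphi; split.
- move=> p dp; have [chi [cchi d pchi]] := potential_chart p.
  exact: (frame_h_pseudo frobF canK aphi cchi pchi (conj dp d)).
- move=> p dp x y; have [chi [cchi d pchi]] := potential_chart p.
  exact: (frame_h_real frobF canK aphi cchi pchi (conj dp d)).
- move=> i s t ss st p dp; have [chi [cchi d pchi]] := potential_chart p.
  exact: (frame_h_C frobF canK aphi cchi pchi i (@section_smooth_mx phi chi s ss)
    (@section_smooth_mx phi chi t st) (conj dp d)).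
- exact: chern_metric.
Qed.

Lemma chern_CV4 phi : atlas M phi ->
  CV4 phi (Dprime phi Gamma) (Ddoubleprime phi) (Cform F phi)
    (kappa_map K phi) (hform F K phi) (Uop F phi) (Qop F phi Gamma).
Proof.
move=> aphi; split.
- by move=> a; apply: opeq_local => chi cchi pchi; exact: comm_C_U.
- by move=> a; apply: opeq_local => chi cchi pchi; exact: comm_D1_U.
- by move=> a; apply: opeq_local => chi cchi pchi; exact: comm_D2_U.
- by move=> a; apply: opeq_local => chi cchi pchi; exact: comm_D1_Q.
split.
- by apply: opeq_local => chi cchi pchi; exact: kappa_Q.
- move=> s t ss st p dp; have [chi [cchi d pchi]] := potential_chart p.
  exact: (frame_h_U frobF canK aphi cchi pchi (@section_smooth_mx phi chi s ss)
    (@section_smooth_mx phi chi t st) (conj dp d)).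
- move=> s t ss st p dp; have [chi [cchi d pchi]] := potential_chart p.
  exact: (frame_h_Q frobF canK aphi cchi pchi (@section_smooth_mx phi chi s ss)
    (@section_smooth_mx phi chi t st) (conj dp d)).
Qed.

Lemma chern_Q phi : atlas M phi -> opeq phi (Qop F phi Gamma) (@zeroop R m M).
Proof. by move=> aphi; apply: opeq_local => chi cchi pchi; exact: Q_zero. Qed.

Lemma chern_CDVplus : conf_dim F \is Num.real -> is_CDVplus_structure F K Gamma.
Proof.
move=> dreal; split.
  apply: (And5 frobF kappa_smooth chern_connection dreal) => phi aphi; split.
    move=> p dp; have [chi [cchi d pchi]] := potential_chart p.
    exact: (frame_unit_parallel frobF canK aphi cchi pchi (conj dp d)).
  by split; [exact: chern_CV1|exact: chern_CV2|exact: chern_CV3|exact: chern_CV4].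
move=> phi aphi p dp x x0; have [chi [cchi d pchi]] := potential_chart p.
exact: (frame_h_pos frobF canK aphi cchi pchi (conj dp d) x0).
Qed.

(** On a canonical chart with a potential one may take chi = phi, for which the
    Jacobian matrix is the identity. *)
Section CanonicalChart.
Variables (phi : chartM) (e : M -> C).
Hypothesis cphi : canonical_coordinates F phi.
Hypothesis he : metric_potential F phi e.
Let pphi : exists e, metric_potential F phi e := ex_intro _ e he.
Let ov q : dom phi q -> overlap phi phi q. Proof. by []. Qed.
Let J1 q : dom phi q -> jac phi phi q = 1%:M.
Proof. by move=> dq; apply: jac_same => //; exact: chart_open_dom. Qed.

Lemma canonical_hmatrix q : dom phi q ->
  hmatrix F K phi q = diag_mx (\row_a `|pd phi a e q|).
Proof.
move=> dq; rewrite (frame_hmatrix frobF canK cphi.1 cphi pphi (ov dq)) /= J1 //.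
rewrite map_mx1 trmx1 mul1mx mulmx1; congr diag_mx; apply/rowP => a.
by rewrite !mxE (potential_diag_metric _ he dq).
Qed.

Lemma canonical_omega i q : dom phi q -> omega F K phi i q =
  diag_mx (\row_a (pd phi i (pd phi a e) q / (2 * pd phi a e q))).
Proof.
move=> dq; have := frame_omega frobF canK cphi.1 cphi pphi i (ov dq).
rewrite /= J1 // mulmx1 mul1mx => ->.
rewrite (@pdd_mx_eq _ _ _ _ (dom phi) _ _ _ _ (fun=> 1%:M)) //; last exact: chart_open_dom.
rewrite pdd_mx_cst add0r; congr diag_mx; apply/rowP => a; rewrite [LHS]mxE [RHS]mxE.
rewrite (potential_diag_metric _ he dq); congr (_ / _).
apply: (@pdd_eq _ _ _ _ (dom phi)) => //; first exact: chart_open_dom.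
by move=> r dr; rewrite (potential_diag_metric _ he dr).
Qed.

Lemma canonical_omega_hol i a b : holomorphic_on phi (fun p => omega F K phi i p a b).
Proof.
apply/(@hol_inE _ _ _ phi (dom phi)); apply: (@hol_in_sub _ _ _ _ (overlap phi phi)) => //.
exact: (frame_omega_hol frobF canK cphi.1 cphi pphi i a b).
Qed.
End CanonicalChart.
End Chern.
End Patching.

(** * The CDV-structure *)

Theorem theorem2p4 (R : realType) (m : nat) (M : complex_manifold R m)
    (F : frobenius_data M) (d : R)
    (frobF : is_frobenius_manifold F) (ssF : semisimple F)
    (chargeF : conf_dim F = d%:C) :
  (exists K : antilinear_endo M, canonical_kappa F K) /\
  forall K : antilinear_endo M, canonical_kappa F K ->
  exists Gamma : connection M,
    [/\ is_CDVplus_structure F K Gamma,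
        (forall phi, atlas M phi ->
           opeq phi (Qop F phi Gamma) (@zeroop R m M)) &
        forall phi (eta : M -> R[i]),
          canonical_coordinates F phi -> metric_potential F phi eta ->
          [/\ forall p, dom phi p ->
                hmatrix F K phi p = diag_mx (\row_a `|pd phi a eta p|),
              forall p, dom phi p -> forall i,
                Gamma phi p i = omega F K phi i p,
              forall i a b, holomorphic_on phi (fun p => omega F K phi i p a b) &
              forall p, dom phi p -> forall i,
                omega F K phi i p =
                diag_mx (\row_a (pd phi i (pd phi a eta) p /
                                 (2 * pd phi a eta p)))]].
Proof.
split; first by exists (canonical_involution frobF ssF); exact: canonical_involutionP.
move=> K canK; exists (chern F K); split.
- apply: chern_CDVplus => //; rewrite chargeF realE !lecE /= eqxx /=; exact: le_total.
- by move=> phi aphi; exact: chern_Q.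
move=> phi eta cphi he; split=> // [p dp|i a b|p dp i].
- exact: (canonical_hmatrix frobF canK cphi he dp).
- exact: (canonical_omega_hol frobF canK cphi he).
- exact: (canonical_omega frobF canK cphi he i dp).
Qed.
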